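(* Let $$X_N=\frac{1}{2+2m+2t+r_2}\left(V+V^{*}+\sum_{j=1}^{m}(D_j+D_j^* )+\sum_{j=1}^{t}(\Delta_{j}+\Delta_j^* )+\sum_{r=1}^{r_2}D'_r\right)$$ be the $N\times N$ random matrix described in the context, and for $n,N\in\mathbb{N}$ define $$Z_N(n)=\frac{1}{\sqrt N}\left[\mathrm{Tr}(X_N^n)-\mathbb{E}(\mathrm{Tr}(X_N^n))\right].$$ The family $(Z_N(n))_{n\in\mathbb{N}}$ converges (in the sense of finite-dimensional distributions) to a Gaussian process as $N$ goes to infinity.
   Context: Fixed integers $m,r_2,t\ge0$ and $q_1,\dots,q_t\ge3$. All matrices are $N\times N$. $V$ is a uniform random permutation matrix; $D_1,\dots,D_m$, $D'_1,\dots,D'_{r_2}$, $\Delta_1,\dots,\Delta_t$ are diagonal matrices whose diagonal entries are all independent and independent of $V$; the diagonal entries of each $D_j$ are uniform on the unit circle, those of each $D'_j$ are uniform on $\{\pm1\}$, and those of $\Delta_j$ are uniform on $\{\exp(2ik\pi/q_j):1\le k\le q_j\}$. $\mathrm{Tr}$ is the unnormalized trace. (This is the random matrix model for $\Lambda\wr\mathbb{Z}$ with $\Lambda=\mathbb{Z}^m\times(\mathbb{Z}/2\mathbb{Z})^{r_2}\times\prod_j\mathbb{Z}/q_j\mathbb{Z}$.) Gaussian processes may be degenerate. *)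

(* Defs.v *)
From HB Require Import structures.
From mathcomp Require Import all_boot all_order all_algebra all_fingroup.
From mathcomp Require Import complex.
From mathcomp Require Import all_classical all_reals all_analysis.

Set Implicit Arguments.
Unset Strict Implicit.
Unset Printing Implicit Defensive.

Import Order.TTheory GRing.Theory Num.Theory.
Import numFieldNormedType.Exports.

Local Open Scope classical_set_scope.
Local Open Scope ring_scope.
Local Open Scope complex_scope.
Local Open Scope sesquilinear_scope.

Section ComplexLaws.
Context {R : realType}.

(* R[i] carries no sigma-algebra in the library; its Borel sets are transported
   from R * R by this bijection. *)
Definition re_im (z : R[i]) : R * R := (complex.Re z, complex.Im z).

Definition cis (x : R) : R[i] := cos x +i* sin x.

Definition uniform_circle (A : set (R * R)) : \bar R :=
  uniform_prob (@ltr01 R) [set u | A (re_im (cis (2 * pi * u)))].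

(* Uniform law on the entries of a duplicate-free sequence. *)
Definition uniform_seq (s : seq R[i]) (A : set (R * R)) : \bar R :=
  (((size s)%:R^-1)%:E * \sum_(z <- s) \d_(re_im z) A)%E.

Definition unity_roots (q : nat) : seq R[i] :=
  [seq cis (2 * k%:R * pi / q%:R) | k <- iota 1 q].

Definition has_law d (T : measurableType d) (P : probability T R)
    (f : T -> R[i]) (mu : set (R * R) -> \bar R) : Prop :=
  measurable_fun setT (re_im \o f) /\
  forall A, measurable A -> P ((re_im \o f) @^-1` A) = mu A.

Definition sigma_complex d (T : measurableType d) (f : T -> R[i]) :
    set (set T) :=
  preimage_set_system setT (re_im \o f) measurable.

Definition sigma_discrete d (T : measurableType d) (F : finType)
    (f : T -> F) : set (set T) :=
  preimage_set_system setT f setT.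

Definition mutually_independent d (T : measurableType d) (P : probability T R)
    (I : finType) (S : I -> set (set T)) : Prop :=
  forall (J : {set I}) (A : I -> set T),
    (forall i, i \in J -> S i (A i)) ->
    P (\bigcap_(i in [set` J]) A i) = (\big[*%E/1]_(i in J) P (A i))%E.

End ComplexLaws.

(* [VN] is the permutation whose matrix is V; [DN j k], [D'N r k] and
   [DeltaN j k] are the k-th diagonal entries of D_j, D'_r and Delta_j. *)
Record wreath_model (R : realType) (m r2 t : nat) (q : 'I_t -> nat) (N : nat)
    d (T : measurableType d) (P : probability T R) := WreathModel {
  VN : T -> 'S_N ;
  DN : 'I_m -> 'I_N -> T -> R[i] ;
  D'N : 'I_r2 -> 'I_N -> T -> R[i] ;
  DeltaN : 'I_t -> 'I_N -> T -> R[i] ;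
  measurable_VN : forall s, measurable (VN @^-1` [set s]) ;
  uniform_VN : forall s, P (VN @^-1` [set s]) = (#|'S_N|%:R^-1)%:E ;
  uniform_DN : forall j k, has_law P (DN j k) uniform_circle ;
  uniform_D'N : forall r k, has_law P (D'N r k) (uniform_seq [:: 1; -1]) ;
  uniform_DeltaN : forall j k,
    has_law P (DeltaN j k) (uniform_seq (unity_roots (q j))) ;
  independent_entries : mutually_independent P
    (fun i : option ('I_m * 'I_N + 'I_r2 * 'I_N + 'I_t * 'I_N)%type =>
      match i with
      | None => sigma_discrete VN
      | Some (inl (inl (j, k))) => sigma_complex (DN j k)
      | Some (inl (inr (r, k))) => sigma_complex (D'N r k)
      | Some (inr (j, k)) => sigma_complex (DeltaN j k)
      end)
}.

Section TraceProcess.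
Context {R : realType} {m r2 t : nat} {q : 'I_t -> nat} {N : nat}.
Context {d} {T : measurableType d} {P : probability T R}.
Variable M : wreath_model m r2 q N P.

Definition diag_of (D : 'I_N -> T -> R[i]) (w : T) : 'M[R[i]]_N :=
  diag_mx (\row_k D k w).

Definition V_mx (w : T) : 'M[R[i]]_N := perm_mx (VN M w).

Definition X_mx (w : T) : 'M[R[i]]_N :=
  ((2 + 2 * m + 2 * t + r2)%N%:R)^-1 *:
    (V_mx w + (V_mx w) ^t*
     + \sum_(j < m) (diag_of (DN M j) w + (diag_of (DN M j) w) ^t*)
     + \sum_(j < t) (diag_of (DeltaN M j) w + (diag_of (DeltaN M j) w) ^t*)
     + \sum_(r < r2) diag_of (D'N M r) w).

(* The D'_r are only almost surely real, so Tr(X_N^n) is real almost surely;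
   its real part is taken to get a real random variable. *)
Definition trace_power (n : nat) (w : T) : R := complex.Re (\tr (X_mx w ^+ n)).

Definition ZN (n : nat) (w : T) : R :=
  (Num.sqrt N%:R)^-1 * (trace_power n w - fine ('E_P[trace_power n])%E).

End TraceProcess.

(* A standard deviation 0 is a point mass: [normal_prob m 0] is not. *)
Definition gaussian_law {R : realType} (m s : R) (A : set R) : \bar R :=
  if s == 0 then \d_m A else normal_prob m s A.

Definition gaussian_process {R : realType} d (T : measurableType d)
    (P : probability T R) (G : nat -> {RV P >-> R}) : Prop :=
  forall (k : nat) (ns : 'I_k -> nat) (a : 'I_k -> R),
    exists m s : R, forall A, measurable A ->
      P ((fun w => \sum_(i < k) a i * G (ns i) w) @^-1` A) = gaussian_law m s A.

(* Weak convergence of every finite-dimensional marginal; the N-th process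
   lives on its own probability space. *)
Definition fdd_converges {R : realType} (d : nat -> measure_display)
    (T : forall N, measurableType (d N)) (P : forall N, probability (T N) R)
    (Y : forall N, nat -> T N -> R)
    d' (T' : measurableType d') (P' : probability T' R)
    (G : nat -> T' -> R) : Prop :=
  forall (k : nat) (ns : 'I_k -> nat) (f : 'rV[R]_k -> R),
    continuous f -> (exists B : R, forall x, `|f x| <= B) ->
    ('E_(P N)[fun w => f (\row_(i < k) Y N (ns i) w)])%E @[N --> \oo] -->
    ('E_P'[fun w => f (\row_(i < k) G (ns i) w)])%E.

(* Main.v *)
(** Almost surely X_N = c (V + V^T + diag xi), where c = 1 / (2 + 2m + 2t + r_2) and the
    xi_k are i.i.d. bounded real variables. Hence Tr(X_N^n) is a sum over the sites x of the
    weights of the closed walks of length n from x along the cycles of the permutation, and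
    the summand at x only depends on the sites at distance at most n from x. For a fixed
    permutation, Stein's method for locally dependent sums, applied to E cos(t W + c), yields
    a Gaussian limit with error O(N^(-1/2)). Away from short cycles, which contain O(1) points
    on average, the local means and covariances do not depend on the permutation, so the
    randomness of V is negligible. Cosines of linear combinations suffice for convergence in
    distribution, by Fejer approximation and tightness. The limit lives on [0, 1]: the binary
    digits of a uniform variable, regrouped, give i.i.d. uniform variables, a quantile function
    makes them normal, and the Cholesky coefficients of the limiting covariance combine them. *)

Require Import Defs.
From HB Require Import structures.
From mathcomp Require Import all_boot all_order all_algebra all_fingroup.
From mathcomp Require Import complex.
From mathcomp Require Import all_classical all_reals all_analysis.
From mathcomp Require Import measurable_realfun ring lra zify.

Set Implicit Arguments.
Unset Strict Implicit.
Unset Printing Implicit Defensive.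

Import Order.TTheory GRing.Theory Num.Theory.
Import numFieldNormedType.Exports.

Local Open Scope classical_set_scope.
Local Open Scope ring_scope.

(** * Expectations and independence *)

(** Given V, both the mean and the variance of Tr(X_N^n) have to be compared with universal values.
    The conditional mean differs from N times a constant by at most a constant times the number of
    sites on short cycles. As this number is O(1) on average, division by sqrt N kills the
    difference, so that V adds no Gaussian term of its own. The phase c in cos(tW + c) replaces
    complex characteristic functions: cosines with phases include the sines, and a product of two of
    them is a sum of two. Walks on an arc of distinct sites read words that depend on nothing but
    positions, and the moments of xi_k do not depend on N; this yields formulas for the limiting
    mean and covariance in which N does not occur. These formulas do not show that the covariance is
    positive semidefinite: this is inherited, up to O(1/N), from genuine variances at finite N. The
    covariance may be degenerate, so the Cholesky elimination has to survive vanishing pivots.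
    Clipped entries make every statistic bounded everywhere; the original traces agree with them
    almost surely. *)

Definition bounded_measurable d (T : measurableType d) (R : realType)
    (f : T -> R) : Prop :=
  measurable_fun setT f /\ exists B : R, forall x, `|f x| <= B.

Section BoundedMeasurable.
Context d (T : measurableType d) (R : realType).
Implicit Types f g : T -> R.
Local Notation bm := (@bounded_measurable d T R).

Lemma eq_bm f g : f =1 g -> bm g -> bm f.
Proof. by move=> /funext ->. Qed.

Lemma bm_cst (a : R) : bm (fun=> a).
Proof. by split; [exact: measurable_cst|exists `|a|]. Qed.

Lemma bmD f g : bm f -> bm g -> bm (fun x => f x + g x).
Proof.
move=> [mf [B fB]] [mg [C gC]]; split; first exact: measurable_funD.
by exists (B + C) => x; rewrite (le_trans (ler_normD _ _))// lerD.
Qed.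

Lemma bmM f g : bm f -> bm g -> bm (fun x => f x * g x).
Proof.
move=> [mf [B fB]] [mg [C gC]]; split; first exact: measurable_funM.
by exists (B * C) => x; rewrite normrM ler_pM.
Qed.

Lemma bmZ a f : bm f -> bm (fun x => a * f x).
Proof. by move=> /(bmM (bm_cst a)). Qed.

Lemma bmB f g : bm f -> bm g -> bm (fun x => f x - g x).
Proof.
move=> bf bg; by apply: eq_bm (bmD bf (bmZ (-1) bg)) => x; rewrite mulN1r.
Qed.

Lemma bmX f n : bm f -> bm (fun x => f x ^+ n).
Proof.
move=> bf; elim: n => [|n ih]; first exact: bm_cst.
by apply: eq_bm (bmM bf ih) => x; rewrite exprS.
Qed.

Lemma bm_sum (I : Type) (r : seq I) (Q : pred I) (F : I -> T -> R) :
  (forall i, Q i -> bm (F i)) -> bm (fun x => \sum_(i <- r | Q i) F i x).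
Proof.
move=> bF; elim: r => [|i r ih].
  by apply: eq_bm (bm_cst 0) => x; rewrite big_nil.
case Qi: (Q i); first by apply: eq_bm (bmD (bF _ Qi) ih) => x; rewrite big_cons Qi.
by apply: eq_bm ih => x; rewrite big_cons Qi.
Qed.

Lemma bm_prod (I : Type) (r : seq I) (Q : pred I) (F : I -> T -> R) :
  (forall i, Q i -> bm (F i)) -> bm (fun x => \prod_(i <- r | Q i) F i x).
Proof.
move=> bF; elim: r => [|i r ih].
  by apply: eq_bm (bm_cst 1) => x; rewrite big_nil.
case Qi: (Q i); first by apply: eq_bm (bmM (bF _ Qi) ih) => x; rewrite big_cons Qi.
by apply: eq_bm ih => x; rewrite big_cons Qi.
Qed.

Lemma bm_norm f : bm f -> bm (fun x => `|f x|).
Proof.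
move=> [mf [B fB]]; split; first exact: measurableT_comp.
by exists B => x; rewrite normr_id.
Qed.

Lemma bm_comp (h : R -> R) f : measurable_fun setT f ->
  continuous h -> (exists B, forall y, `|h y| <= B) -> bm (fun x => h (f x)).
Proof.
move=> mf ch [B hB]; split; last by exists B => x.
by apply: (measurableT_comp _ mf); exact: continuous_measurable_fun.
Qed.

Lemma bm_cos f : measurable_fun setT f -> bm (fun x => cos (f x)).
Proof.
move=> mf; apply: (bm_comp (h := cos)) => //; first exact: continuous_cos.
by exists 1 => y; rewrite ler_norml cos_geN1 cos_le1.
Qed.

Lemma bm_sin f : measurable_fun setT f -> bm (fun x => sin (f x)).
Proof.
move=> mf; apply: (bm_comp (h := sin)) => //; first exact: continuous_sin.
by exists 1 => y; rewrite ler_norml sin_geN1 sin_le1.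
Qed.

Lemma bm_indic (A : set T) : measurable A -> bm (\1_A : T -> R).
Proof.
move=> mA; split; first exact: measurable_indic.
by exists 1 => x; rewrite indicE normr_nat; case: (_ \in _); rewrite ?ler01 ?lexx.
Qed.

End BoundedMeasurable.

Section Expectation.
Context d (T : measurableType d) (R : realType) (P : probability T R).
Implicit Types f g : T -> R.
Local Notation bm := (@bounded_measurable d T R).

Definition Ex (f : T -> R) : R := Rintegral P setT f.

Lemma bm_integrable f : bm f -> P.-integrable setT (EFin \o f).
Proof.
move=> [mf [B fB]]; apply: measurable_bounded_integrable => //.
  by rewrite -ge0_fin_numE//; exact: fin_num_measure.
exists B; split; first by rewrite num_real.
by move=> M BM x _; exact: le_trans (fB x) (ltW BM).
Qed.

(** Passage from the extended-real expectations of the statement to real arithmetic: for bounded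
    measurable functions all later manipulations of [Ex] are free of finiteness conditions. *)
Lemma bm_expectation f : bm f -> ('E_P[f] = (Ex f)%:E)%E.
Proof.
move=> bf; rewrite unlock /Ex /Rintegral fineK//.
exact: integrable_fin_num (bm_integrable bf).
Qed.

Lemma eq_Ex f g : f =1 g -> Ex f = Ex g.
Proof. by move=> /funext ->. Qed.

Lemma Ex_cst a : Ex (fun=> a) = a.
Proof.
rewrite /Ex Rintegral_cst// [X in fine X](_ : _ = 1%E) ?mulr1//.
exact: probability_setT.
Qed.

Lemma ExD f g : bm f -> bm g -> Ex (fun x => f x + g x) = Ex f + Ex g.
Proof. by move=> bf bg; rewrite /Ex RintegralD//; exact: bm_integrable. Qed.

Lemma ExB f g : bm f -> bm g -> Ex (fun x => f x - g x) = Ex f - Ex g.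
Proof. by move=> bf bg; rewrite /Ex RintegralB//; exact: bm_integrable. Qed.

Lemma ExZ a f : bm f -> Ex (fun x => a * f x) = a * Ex f.
Proof. by move=> bf; rewrite /Ex RintegralZl//; exact: bm_integrable. Qed.

Lemma Ex_sum (I : Type) (r : seq I) (Q : pred I) (F : I -> T -> R) :
  (forall i, Q i -> bm (F i)) ->
  Ex (fun x => \sum_(i <- r | Q i) F i x) = \sum_(i <- r | Q i) Ex (F i).
Proof.
move=> bF; elim: r => [|i r ih].
  by rewrite big_nil -[RHS]Ex_cst; apply: eq_Ex => x; rewrite big_nil.
rewrite big_cons -ih; case Qi: (Q i); last first.
  by apply: eq_Ex => x; rewrite big_cons Qi.
rewrite -ExD//; [|exact: bF|exact: bm_sum].
by apply: eq_Ex => x; rewrite big_cons Qi.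
Qed.

Lemma le_Ex f g : bm f -> bm g -> (forall x, f x <= g x) -> Ex f <= Ex g.
Proof. by move=> bf bg fg; apply: le_Rintegral => //; exact: bm_integrable. Qed.

Lemma norm_Ex f : bm f -> `|Ex f| <= Ex (fun x => `|f x|).
Proof. by move=> bf; apply: le_normr_Rintegral => //; exact: bm_integrable. Qed.

Lemma norm_Ex_le f (B : R) : bm f -> (forall x, `|f x| <= B) -> `|Ex f| <= B.
Proof.
move=> bf fB; rewrite (le_trans (norm_Ex bf))// -[leRHS]Ex_cst.
by apply: le_Ex => //; [exact: bm_norm|exact: bm_cst].
Qed.

End Expectation.

Lemma bm_measurable_comp d d' (T : measurableType d) (T' : measurableType d')
    (R : realType) (X : T -> T') (f : T' -> R) : measurable_fun setT X ->
  bounded_measurable f -> bounded_measurable (fun w => f (X w)).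
Proof.
by move=> mX [mf [B fB]]; split; [exact: measurableT_comp mf mX|exists B].
Qed.

Section Laws.
Context d d' (T : measurableType d) (T' : measurableType d') (R : realType).
Variable P : probability T R.

Definition law (X : T -> T') (mX : measurable_fun setT X) : probability T' R :=
  distribution P (mfun_Sub (mem_set mX)).

Lemma Ex_law (X : T -> T') (mX : measurable_fun setT X) (f : T' -> R) :
  bounded_measurable f -> Ex (law mX) f = Ex P (fun w => f (X w)).
Proof.
move=> bf; rewrite /Ex /Rintegral; congr fine.
rewrite (integral_distribution (f := EFin \o f))//.
  by apply/measurable_EFinP; case: bf.
exact: bm_integrable (bm_measurable_comp mX bf).
Qed.

Lemma eq_measure_Ex (Q1 Q2 : probability T' R) (f : T' -> R) :
  (forall A, measurable A -> Q1 A = Q2 A) -> Ex Q1 f = Ex Q2 f.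
Proof.
move=> Q12; rewrite /Ex /Rintegral; congr fine.
by apply: eq_measure_integral => A mA _; exact: Q12.
Qed.

Lemma bm_prodM (f : T -> R) (g : T' -> R) :
  bounded_measurable f -> bounded_measurable g ->
  bounded_measurable (fun z : T * T' => f z.1 * g z.2).
Proof.
move=> bf bg; apply: bmM.
- exact: (bm_measurable_comp (X := fst) (f := f)).
- exact: (bm_measurable_comp (X := snd) (f := g)).
Qed.

Lemma Ex_prod (Q : probability T' R) (f : T -> R) (g : T' -> R) :
  bounded_measurable f -> bounded_measurable g ->
  Ex (P \x Q)%E (fun z => f z.1 * g z.2) = Ex P f * Ex Q g.
Proof.
move=> bf bg; have bfg := bm_prodM bf bg.
rewrite {1}/Ex /Rintegral -(integral12_prod_meas1 (bm_integrable _ bfg)).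
have -> : fubini_F Q (fun z => (f z.1 * g z.2)%:E) = EFin \o (fun x => Ex Q g * f x).
  apply/funext => x; rewrite /fubini_F/=.
  under eq_integral do rewrite EFinM.
  rewrite integralZl//; last exact: bm_integrable.
  rewrite mulrC EFinM /Ex /Rintegral fineK//.
  exact: integrable_fin_num (bm_integrable _ bg).
by rewrite -/(Rintegral _ _ _) -/(Ex _ _) ExZ// mulrC.
Qed.

End Laws.

(* The diagonal map w |-> (w, w) sends P to the product of its restrictions to the
   two sigma-algebras, so the claim is Fubini's theorem. *)
Section TwoPiSystems.
Context d (T : measurableType d) (R : realType) (P : probability T R).
Implicit Types G : set (set T).

Lemma sub_measurable_sigma G : G `<=` measurable -> <<s G >> `<=` measurable.
Proof. by move=> mG; apply: smallest_sub => //; exact: sigma_algebra_measurable. Qed.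

(** For fixed [B], the finite measures A |-> P(A n B) and A |-> P(A) P(B) agree on the pi-system
    [G1], which contains the whole space, hence on the sigma-algebra that it generates. *)
Lemma indep_sigma_left G1 G2 A B :
  G1 `<=` measurable -> G2 `<=` measurable -> G1 setT -> setI_closed G1 ->
  (forall A B, G1 A -> G2 B -> P (A `&` B) = (P A * P B)%E) ->
  <<s G1 >> A -> G2 B -> P (A `&` B) = (P A * P B)%E.
Proof.
move=> mG1 mG2 G1T G1I G12 sA GB; have mB := mG2 _ GB.
have fB : P B \is a fin_num by exact: fin_num_measure.
pose m1 : {measure set T -> \bar R} := mrestr P mB.
pose r : {nonneg R} := NngNum (fine_ge0 (measure_ge0 P B)).
pose m2 : {measure set T -> \bar R} := mscale r P.
have m2E C : m2 C = (P C * P B)%E by rewrite /m2 /= /mscale/= fineK// muleC.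
rewrite -m2E.
apply: (@g_sigma_algebra_measure_unique _ _ _ G1 _ (fun=> setT) _ _ m1 m2) => //.
- by rewrite bigcup_const.
- by move=> C GC; rewrite m2E; exact: G12.
- move=> _; rewrite /m1/= /mrestr setTI (le_lt_trans (probability_le1 P mB))//.
  by rewrite ltry.
Qed.

(** The one-sided extension is applied twice with the roles exchanged; in the outer application the
    second family is already the whole sigma-algebra generated by [G1]. *)
Lemma indep_sigma G1 G2 A B :
  G1 `<=` measurable -> G2 `<=` measurable -> G1 setT -> G2 setT ->
  setI_closed G1 -> setI_closed G2 ->
  (forall A B, G1 A -> G2 B -> P (A `&` B) = (P A * P B)%E) ->
  <<s G1 >> A -> <<s G2 >> B -> P (A `&` B) = (P A * P B)%E.
Proof.
move=> mG1 mG2 G1T G2T G1I G2I G12 sA sB; rewrite setIC muleC.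
apply: (@indep_sigma_left G2 <<s G1 >>) => //.
- exact: sub_measurable_sigma.
- move=> C D GC sD; rewrite setIC muleC.
  exact: (@indep_sigma_left G1 G2).
Qed.

Lemma indep_Ex G1 G2 (f g : T -> R) :
  G1 `<=` measurable -> G2 `<=` measurable -> G1 setT -> G2 setT ->
  setI_closed G1 -> setI_closed G2 ->
  (forall A B, G1 A -> G2 B -> P (A `&` B) = (P A * P B)%E) ->
  bounded_measurable (f : g_sigma_algebraType G1 -> R) ->
  bounded_measurable (g : g_sigma_algebraType G2 -> R) ->
  Ex P (fun w => f w * g w) = Ex P f * Ex P g.
Proof.
move=> mG1 mG2 G1T G2T G1I G2I G12 bf bg.
pose T1 := g_sigma_algebraType G1; pose T2 := g_sigma_algebraType G2.
have m1 : measurable_fun setT (id : T -> T1).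
  by move=> _ Y mY; rewrite setTI preimage_id; exact: sub_measurable_sigma mY.
have m2 : measurable_fun setT (id : T -> T2).
  by move=> _ Y mY; rewrite setTI preimage_id; exact: sub_measurable_sigma mY.
have mD : measurable_fun [set: T] (fun w : T => ((w : T1), (w : T2))).
  exact: (@measurable_fun_pair _ _ _ T T1 T2 id id).
rewrite -(Ex_law P m1 bf) -(Ex_law P m2 bg) -Ex_prod//.
have := Ex_law P mD (bm_prodM bf bg) => /= <-.
apply: eq_measure_Ex => A mA; apply/esym.
apply: product_measure_unique => // B C mB mC.
exact: (indep_sigma mG1 mG2).
Qed.

End TwoPiSystems.

(** * Independence of functions of disjoint blocks of a family *)

Section IndependentFamilies.
Context d (T : measurableType d) (R : realType) (P : probability T R).
Variables (I : finType) (S : I -> set (set T)).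
Hypotheses (mS : forall i, S i `<=` measurable) (ST : forall i, S i setT).
Hypothesis SI : forall i, setI_closed (S i).
Hypothesis indepS : mutually_independent P S.

(** The pi-system of rectangles that generates the join of the [S i] for [i] in [J]; the join itself
    is not closed-form, and independence is only known on rectangles. *)
Definition cylinders (J : {set I}) : set (set T) :=
  [set A | exists2 B : I -> set T, (forall i, i \in J -> S i (B i)) &
    A = \bigcap_(i in [set` J]) B i].

Lemma measurable_cylinders J : cylinders J `<=` measurable.
Proof.
move=> _ [B SB ->]; apply: fin_bigcap_measurable => // i Ji.
exact: mS (SB i Ji).
Qed.

Lemma cylindersT J : cylinders J setT.
Proof. by exists (fun=> setT) => //; apply/esym/bigcapT. Qed.

Lemma cylindersI J : setI_closed (cylinders J).
Proof.
move=> _ _ [B SB ->] [C SC ->]; exists (fun i => B i `&` C i).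
  by move=> i Ji; apply: SI; [exact: SB|exact: SC].
by rewrite bigcapI.
Qed.

Lemma sub_cylinders (J J' : {set I}) : J \subset J' -> cylinders J `<=` cylinders J'.
Proof.
move=> /fintype.subsetP sJ _ [B SB ->].
exists (fun i => if i \in J then B i else setT).
  by move=> i _; case: ifPn => [/SB|].
apply/seteqP; split=> w BJ i Ji; first by case: ifPn => // /BJ.
by have := BJ i (sJ _ Ji); rewrite (Ji : i \in J).
Qed.

Lemma cylinders1 (J : {set I}) i : i \in J -> S i `<=` cylinders J.
Proof.
move=> iJ A SA; exists (fun j => if j == i then A else setT).
  by move=> j _; case: eqP => [->|].
apply/seteqP; split=> [w Aw j _|w]; first by case: ifP.
by move=> /(_ i iJ); rewrite eqxx.
Qed.

(** Rectangles over disjoint index sets intersect in a rectangle over the union, and the product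
    formula for the union splits into the two products. *)
Lemma cylinders_indep (J1 J2 : {set I}) A B : [disjoint J1 & J2]%B ->
  cylinders J1 A -> cylinders J2 B -> P (A `&` B) = (P A * P B)%E.
Proof.
move=> dJ [A' SA ->] [B' SB ->].
pose C i := if i \in J1 then A' i else B' i.
have CB i : i \in J2 -> C i = B' i.
  by move=> iJ2; rewrite /C (disjointFl dJ iJ2).
have -> : \bigcap_(i in [set` J1]) A' i `&` \bigcap_(i in [set` J2]) B' i =
          \bigcap_(i in [set` (J1 :|: J2)]) C i.
  apply/seteqP; split => w.
    move=> [Aw Bw] i /=; rewrite inE /C => /orP[i1|i2]; first by rewrite i1; exact: Aw.
    by rewrite (disjointFl dJ i2); exact: Bw.
  move=> Cw; split=> i iJ.
    have /Cw : i \in J1 :|: J2 by rewrite inE (iJ : i \in J1).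
    by rewrite /C (iJ : i \in J1).
  have /Cw : i \in J1 :|: J2 by rewrite inE (iJ : i \in J2) orbT.
  by rewrite CB.
rewrite !indepS//.
  rewrite (eq_bigl [predU J1 & J2]); last by move=> i; rewrite !inE.
  rewrite bigU//=; congr (_ * _)%E; apply: eq_bigr => i iJ.
    by rewrite /C iJ.
  by rewrite CB.
move=> i; rewrite inE /C; case: ifPn => [i1 _|_ /=]; [exact: SA|exact: SB].
Qed.

(** Measurability for a sub-sigma-algebra is encoded by retyping the domain, so that every closure
    property of [bounded_measurable] applies verbatim. *)
Definition bm_on (J : {set I}) (f : T -> R) : Prop :=
  bounded_measurable (f : g_sigma_algebraType (cylinders J) -> R).

Lemma bm_on_sub (J J' : {set I}) f : J \subset J' -> bm_on J f -> bm_on J' f.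
Proof.
move=> sJ [mf bf]; split=> // _ Y mY; have := mf measurableT _ mY.
rewrite !setTI; apply: sub_sigma_algebra2 => //; exact: sub_cylinders.
Qed.

Lemma bm_on_bm J f : bm_on J f -> bounded_measurable f.
Proof.
move=> [mf bf]; split=> // _ Y mY; have := mf measurableT _ mY.
apply: sub_measurable_sigma; exact: measurable_cylinders.
Qed.

Lemma bm_on_preimage (J : {set I}) i d' (T' : measurableType d') (X : T -> T') (f : T' -> R) :
  i \in J -> preimage_set_system setT X measurable `<=` S i ->
  bounded_measurable f -> bm_on J (fun w => f (X w)).
Proof.
move=> iJ XS [mf [B fB]]; split; last by exists B => w.
move=> _ Y mY; apply: sub_sigma_algebra.
apply: (cylinders1 iJ); apply: XS; exists (f @^-1` Y) => //.
by rewrite -[X in measurable X]setTI; exact: mf.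
Qed.

Lemma ExM_disjoint (J1 J2 : {set I}) (f g : T -> R) : [disjoint J1 & J2]%B ->
  bm_on J1 f -> bm_on J2 g -> Ex P (fun w => f w * g w) = Ex P f * Ex P g.
Proof.
move=> dJ bf bg; apply: (@indep_Ex _ _ _ _ (cylinders J1) (cylinders J2)) => //.
- exact: measurable_cylinders.
- exact: measurable_cylinders.
- exact: cylindersT.
- exact: cylindersT.
- exact: cylindersI.
- exact: cylindersI.
- move=> A B; exact: cylinders_indep.
Qed.

End IndependentFamilies.

(** * Trigonometric approximation *)

Section Fejer.
Context {R : realType}.
Implicit Types x t : R.

(* n^-2 |sum_(a < n) e^(i a x)|^2, normalised so that the translates by the points of a
   regular n-grid of the circle sum to 1. *)
Definition fejer (n : nat) x : R :=
  (n%:R^-1) ^+ 2 *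
  ((\sum_(a < n) cos (a%:R * x)) ^+ 2 + (\sum_(a < n) sin (a%:R * x)) ^+ 2).

Lemma fejer_ge0 n x : 0 <= fejer n x.
Proof. by rewrite mulr_ge0 ?addr_ge0 ?sqr_ge0. Qed.

Lemma fejerE n x : fejer n x =
  (n%:R^-1) ^+ 2 * \sum_(a < n) \sum_(b < n) cos ((a%:R - b%:R) * x).
Proof.
rewrite /fejer; congr (_ * _); rewrite !expr2 !big_distrlr/= -big_split/=.
apply: eq_bigr => a _; rewrite -big_split/=; apply: eq_bigr => b _.
by rewrite mulrBl cosB.
Qed.

(** Multiplied by 2 sin(x/2), the cosine and sine sums telescope to the coordinates of a difference
    of two points of the unit circle. Keeping the sine as a factor avoids dividing by zero. *)
Lemma fejer_bound n x : (0 < n)%N -> fejer n x * (n%:R * sin (x / 2)) ^+ 2 <= 1.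
Proof.
move=> n0; have n0' : n%:R != 0 :> R by rewrite pnatr_eq0 -lt0n.
rewrite /fejer exprMn mulrACA -exprMn mulVf// expr1n mul1r.
set C := \sum_(a < n) cos _; set S := \sum_(a < n) sin _.
pose u k : R := sin ((k%:R - 2^-1) * x); pose v k : R := cos ((k%:R - 2^-1) * x).
have kE k : (k%:R : R) * x = (k%:R - 2^-1) * x + x / 2 by ring.
have k1E k : (k.+1%:R - 2^-1 : R) * x = (k%:R - 2^-1) * x + x / 2 + x / 2.
  by rewrite -natr1; field.
have trig t y : 2 * sin y * cos (t + y) = sin (t + y + y) - sin t /\
    2 * sin y * sin (t + y) = cos t - cos (t + y + y).
  rewrite [in sin (t + y + y)]sinD [in cos (t + y + y)]cosD.
  have -> : sin t = sin ((t + y) - y) by rewrite addrK.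
  have -> : cos t = cos ((t + y) - y) by rewrite addrK.
  by rewrite sinB cosB; split; ring.
have CE : 2 * sin (x / 2) * C = u n - u 0%N.
  rewrite -(telescope_sumr u (leq0n n)) big_mkord mulr_sumr; apply: eq_bigr => k _.
  by rewrite /u k1E kE; case: (trig ((k%:R - 2^-1) * x) (x / 2)).
have SE : 2 * sin (x / 2) * S = v 0%N - v n.
  rewrite -[RHS]opprB -(telescope_sumr v (leq0n n)) big_mkord mulr_sumr -sumrN.
  apply: eq_bigr => k _; rewrite opprB.
  by rewrite /v k1E kE; case: (trig ((k%:R - 2^-1) * x) (x / 2)).
(* A chord of the unit circle has squared length at most 4. *)
have H1 : (2 * sin (x / 2)) ^+ 2 * (C ^+ 2 + S ^+ 2) <= 4.
  rewrite mulrDr -!exprMn CE SE.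
  have := cos2Dsin2 ((n%:R - 2^-1) * x); have := cos2Dsin2 ((0%:R - 2^-1) * x).
  rewrite -/(u n) -/(v n) -/(u 0%N) -/(v 0%N) => h0 hn.
  have := sqr_ge0 (u n + u 0%N); have := sqr_ge0 (v n + v 0%N).
  lra.
by move: H1; rewrite exprMn; lra.
Qed.

(** The factor 2 sin(pi d / n), nonzero because 0 < d < n, makes the sum telescope, and the two end
    terms differ by d full periods. *)
Lemma sum_cos_grid (n d : nat) t : (0 < d < n)%N ->
  \sum_(j < n) cos (t - d%:R * (2 * pi * j%:R / n%:R)) = 0.
Proof.
move=> /andP[d0 dn]; have n0 : (0 < n)%N by exact: leq_trans dn.
have n0' : (0 : R) < n%:R by rewrite ltr0n.
pose y : R := pi * d%:R / n%:R.
have y0 : 0 < sin y.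
  apply: sin_gt0_pi; rewrite divr_gt0 ?mulr_gt0 ?pi_gt0 ?ltr0n//=.
  by rewrite ltr_pdivrMr// ltr_pM2l ?pi_gt0// ltr_nat.
suff : 2 * sin y * \sum_(j < n) cos (t - d%:R * (2 * pi * j%:R / n%:R)) = 0.
  by move/eqP; rewrite !mulf_eq0 (gt_eqF y0) pnatr_eq0/= => /eqP.
pose h j : R := - sin (t + y - d%:R * (2 * pi * j%:R / n%:R)).
have n1 : n%:R != 0 :> R by rewrite gt_eqF.
transitivity (h n - h 0%N).
  rewrite -(telescope_sumr h (leq0n n)) big_mkord mulr_sumr.
  apply: eq_bigr => j _; rewrite /h.
  have -> : t + y - d%:R * (2 * pi * j.+1%:R / n%:R) =
            (t - d%:R * (2 * pi * j%:R / n%:R)) - y.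
    by rewrite /y -natr1; field.
  have -> : t + y - d%:R * (2 * pi * j%:R / n%:R) =
            (t - d%:R * (2 * pi * j%:R / n%:R)) + y by ring.
  move: (t - _) => X; rewrite sinB sinD; ring.
rewrite /h (_ : d%:R * (2 * pi * 0%:R / n%:R) = 0) ?mulr0 ?mul0r ?mulr0// subr0.
have -> : d%:R * (2 * pi * n%:R / n%:R) = pi *+ 2 *+ d :> R.
  by rewrite -[RHS]mulr_natl -[in RHS]mulr_natl; field.
have H s : sin (s - pi *+ 2 *+ d) = sin s; last by rewrite H subrr.
elim: d s {d0 dn y y0 h} => [|d ih] s; first by rewrite mulr0n subr0.
by rewrite mulrSr opprD addrA -[LHS]sinD2pi subrK ih.
Qed.

(** In the double cosine sum the pairs with a != b vanish on the grid, while each of the n diagonal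
    pairs contributes n; this is the origin of the factor n^-2. *)
Lemma fejer_partition n x : (0 < n)%N ->
  \sum_(j < n) fejer n (x - 2 * pi * j%:R / n%:R) = 1.
Proof.
move=> n0; under eq_bigr do rewrite fejerE.
rewrite -mulr_sumr exchange_big/=.
under eq_bigr do rewrite exchange_big/=.
have S (a b : 'I_n) : \sum_(j < n) cos ((a%:R - b%:R) * (x - 2 * pi * j%:R / n%:R)) =
    if a == b then n%:R else 0.
  have [->|] := eqVneq a b.
    under eq_bigr do rewrite subrr mul0r cos0.
    by rewrite big_const card_ord iter_addr addr0.
  wlog ab : a b / (b < a)%N => [H nab|].
    have := nab; rewrite -val_eqE neq_ltn => /orP[ab|]; last by move=> /H ->.
    under eq_bigr do rewrite -cosN -mulNr opprB.
    by apply: H => //; rewrite eq_sym.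
  move=> _; rewrite -[RHS](@sum_cos_grid n (a - b) ((a - b)%N%:R * x)); last first.
    by rewrite subn_gt0 ab/= (leq_ltn_trans (leq_subr _ _)).
  by apply: eq_bigr => j _; rewrite natrB ?(ltnW ab)// mulrBr.
under eq_bigr do under eq_bigr do rewrite S.
have S1 (a : 'I_n) : \sum_(b < n) (if a == b then n%:R else 0) = n%:R :> R.
  by rewrite -big_mkcond/= (big_pred1 a)// => b; rewrite eq_sym.
under eq_bigr do rewrite S1.
have n0' : n%:R != 0 :> R by rewrite pnatr_eq0 -lt0n.
rewrite big_const card_ord iter_addr addr0 -[X in _ * X]mulr_natr -expr2 -exprMn mulVf//.
by rewrite expr1n.
Qed.

End Fejer.

Section TrigPoly.
Context {R : realType} {k : nat}.
Implicit Types (F G : 'rV[R]_k -> R) (l w : 'rV[R]_k).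

Definition dot l w : R := \sum_i l 0 i * w 0 i.

(** The free phase [c] makes this class contain the sines and, by the product-to-sum formula, closes
    it under multiplication. *)
Inductive trig_poly : ('rV[R]_k -> R) -> Prop :=
| TrigCos a l c : trig_poly (fun w => a * cos (dot l w + c))
| TrigAdd F G : trig_poly F -> trig_poly G -> trig_poly (fun w => F w + G w).

Lemma eq_trig F G : F =1 G -> trig_poly G -> trig_poly F.
Proof. by move=> /funext ->. Qed.

Lemma dotDl l l' w : dot (l + l') w = dot l w + dot l' w.
Proof. by rewrite -big_split/=; apply: eq_bigr => i _; rewrite mxE mulrDl. Qed.

Lemma dotNl l w : dot (- l) w = - dot l w.
Proof. by rewrite -sumrN; apply: eq_bigr => i _; rewrite mxE mulNr. Qed.

Lemma trig_cst a : trig_poly (fun=> a).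
Proof.
apply: eq_trig (TrigCos a 0 0) => w.
by rewrite /dot big1 ?addr0 ?cos0 ?mulr1// => i _; rewrite mxE mul0r.
Qed.

Lemma trigM F G : trig_poly F -> trig_poly G -> trig_poly (fun w => F w * G w).
Proof.
move=> tF tG; elim: tF => [a l c|F1 F2 _ t1 _ t2]; last first.
  by apply: eq_trig (TrigAdd t1 t2) => w; rewrite mulrDl.
elim: tG => [a' l' c'|G1 G2 _ t1 _ t2]; last first.
  by apply: eq_trig (TrigAdd t1 t2) => w; rewrite mulrDr.
apply: eq_trig (TrigAdd (TrigCos (a * a' / 2) (l + l') (c + c'))
                        (TrigCos (a * a' / 2) (l - l') (c - c'))) => w.
rewrite !dotDl dotNl.
have -> : dot l w + dot l' w + (c + c') = (dot l w + c) + (dot l' w + c') by ring.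
have -> : dot l w - dot l' w + (c - c') = (dot l w + c) - (dot l' w + c') by ring.
by rewrite [X in _ = _ * X + _]cosD cosB; field.
Qed.

Lemma trig_sum (I : Type) (r : seq I) (F : I -> 'rV[R]_k -> R) :
  (forall i, trig_poly (F i)) -> trig_poly (fun w => \sum_(i <- r) F i w).
Proof.
move=> tF; elim: r => [|i r ih].
  by apply: eq_trig (trig_cst 0) => w; rewrite big_nil.
by apply: eq_trig (TrigAdd (tF i) ih) => w; rewrite big_cons.
Qed.

Lemma trig_prod (I : Type) (r : seq I) (F : I -> 'rV[R]_k -> R) :
  (forall i, trig_poly (F i)) -> trig_poly (fun w => \prod_(i <- r) F i w).
Proof.
move=> tF; elim: r => [|i r ih].
  by apply: eq_trig (trig_cst 1) => w; rewrite big_nil.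
by apply: eq_trig (trigM (tF i) ih) => w; rewrite big_cons.
Qed.

Lemma trig_fejer n (i : 'I_k) a b : trig_poly (fun w => fejer n (a * (w 0 i - b))).
Proof.
apply: (eq_trig (G := fun w => (n%:R^-1) ^+ 2 *
    \sum_(p < n) \sum_(q < n) cos ((p%:R - q%:R) * (a * (w 0 i - b))))).
  by move=> w; rewrite fejerE.
apply: trigM; first exact: trig_cst.
apply: trig_sum => p; apply: trig_sum => q.
apply: eq_trig (TrigCos 1 ((p%:R - q%:R) * a *: delta_mx 0 i)
  (- ((p%:R - q%:R) * a * b))) => w.
rewrite mul1r; congr cos; rewrite /dot (bigD1 i)//= big1.
  by rewrite !mxE !eqxx/=; ring.
by move=> j ji; rewrite !mxE (negbTE ji) andbF mulr0 mul0r.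
Qed.

End TrigPoly.

(** * Approximation of bounded continuous functions on a box *)

Section FejerApprox.
Context {R : realType} {k : nat}.
Variables (f : 'rV[R]_k -> R) (B : R).
Hypotheses (cf : continuous f) (fB : forall w, `|f w| <= B).

(** The nodes fill one period [- pi L, pi L[ of the kernel rescaled by L. A coordinate in [- L, L]
    has rescaled distance at most 1 + pi < 2 pi to each node, so the periodic copies of the peak are
    out of reach. *)
Definition fejer_node (L : R) n (a : 'I_n) : R := L * (2 * pi * a%:R / n%:R - pi).

Definition fejer_weight (L : R) n (w : 'rV[R]_k) (i : 'I_k) (a : 'I_n) : R :=
  fejer n (L^-1 * (w 0 i - fejer_node L a)).

(** A convex combination of values of [f], with tensor products of kernels as weights. It therefore
    keeps the bound of [f] on the whole space, which controls what happens outside the box. *)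
Definition fejer_approx (L : R) n (w : 'rV[R]_k) : R :=
  \sum_(j : {ffun 'I_k -> 'I_n})
    f (\row_i fejer_node L (j i)) * \prod_i fejer_weight L w i (j i).

Lemma trig_fejer_approx L n : trig_poly (fejer_approx L n).
Proof.
apply: trig_sum => j; apply: trigM; first exact: trig_cst.
by apply: trig_prod => i; exact: trig_fejer.
Qed.

Lemma fejer_weight_sum (L : R) n w i : 0 < L -> (0 < n)%N ->
  \sum_(a < n) fejer_weight L w i a = 1.
Proof.
move=> L0 n0; rewrite -(@fejer_partition _ n (L^-1 * w 0 i + pi) n0).
apply: eq_bigr => a _; congr fejer; rewrite /fejer_node.
have n0' : n%:R != 0 :> R by rewrite pnatr_eq0 -lt0n.
by field; rewrite n0' gt_eqF.
Qed.

Lemma fejer_weights_sum (L : R) n w : 0 < L -> (0 < n)%N ->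
  \sum_(j : {ffun 'I_k -> 'I_n}) \prod_i fejer_weight L w i (j i) = 1.
Proof.
move=> L0 n0; rewrite -bigA_distr_bigA/= big1// => i _.
exact: fejer_weight_sum.
Qed.

Lemma fejer_weights_ge0 L n w (j : {ffun 'I_k -> 'I_n}) :
  0 <= \prod_i fejer_weight L w i (j i).
Proof. by apply: prodr_ge0 => i _; exact: fejer_ge0. Qed.

Lemma fejer_approx_le (L : R) n w : 0 < L -> (0 < n)%N -> `|fejer_approx L n w| <= B.
Proof.
move=> L0 n0; rewrite (le_trans (ler_norm_sum _ _ _))//.
have -> : B = B * \sum_(j : {ffun 'I_k -> 'I_n}) \prod_i fejer_weight L w i (j i).
  by rewrite fejer_weights_sum// mulr1.
rewrite mulr_sumr.
apply: ler_sum => j _; rewrite normrM (ger0_norm (fejer_weights_ge0 _ _ _)) ler_wpM2r//.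
exact: fejer_weights_ge0.
Qed.

(** Only [w] is confined to the box: [x] will be a vector of nodes, which may lie outside.
    Compactness turns continuity at each point into a common radius. *)
Lemma uniform_continuity_box (L e : R) : 0 < e ->
  exists2 r : R, 0 < r & forall w x : 'rV[R]_k, (forall i, `|w 0 i| <= L) ->
    (forall i, `|x 0 i - w 0 i| < r) -> `|f x - f w| <= e.
Proof.
move=> e0.
have cK : compact [set w : 'rV[R]_k | forall i, `[- L, L]%classic (w 0 i)].
  by apply: (@rV_compact _ _ (fun=> `[- L, L]%classic)) => i; exact: segment_compact.
move/compact_near_coveringP : cK => /(_ R 0^'+ (fun r w => forall x : 'rV[R]_k,
  (forall i, `|x 0 i - w 0 i| < r) -> `|f x - f w| <= e) _) [].
  move=> w0 _.
  have /cvgrPdist_lt/(_ (e / 2)) := @cf w0.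
  rewrite divr_gt0// => /(_ isT)/nbhs_ballP[r /= r0 rf].
  exists (ball w0 (r / 2), [set s | 0 < s < r / 2]).
    split; first by apply/nbhs_ballP; exists (r / 2) => //=; rewrite divr_gt0.
    exists (r / 2); first by rewrite /= divr_gt0.
    by move=> s /=; rewrite sub0r normrN => + s0; rewrite gtr0_norm// s0 => ->.
  move=> [w s] /= [[_ bw] /andP[s0 sr]] x xw.
  have H1 : ball w0 r x.
    split=> // i j; have := bw i j; rewrite /ball/= !(ord1 i) => b1.
    have := xw j; rewrite distrC => b2.
    have -> : w0 0 j - x 0 j = (w0 0 j - w 0 j) + (w 0 j - x 0 j) by ring.
    by rewrite (le_lt_trans (ler_normD _ _))// [ltRHS](splitr r) ltrD// (lt_trans b2).
  have H2 : ball w0 r w.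
    split=> // i j; have := bw i j; rewrite /ball/= => /lt_trans; apply.
    by rewrite ltr_pdivrMr// ltr_pMr// ltr1n.
  have := rf _ H1; have := rf _ H2 => /= h2 h1.
  have -> : f x - f w = (f w0 - f w) - (f w0 - f x) by ring.
  by rewrite (le_trans (ler_normB _ _))// (splitr e) lerD// ltW.
move=> r /= r0 H; exists (r / 2); first by rewrite divr_gt0.
move=> w x wL; apply: H => /=.
- by rewrite sub0r normrN gtr0_norm ?divr_gt0// ltr_pdivrMr// ltr_pMr// ltr1n.
- by rewrite divr_gt0.
- by move=> i; rewrite in_itv/= -ler_norml.
Qed.


(** Since 1 + pi < 2 pi, the function sin(u/2)^2 has no zero for |u| between a and 1 + pi, and it
    attains its minimum there. *)
Lemma sin_half_lower (a : R) : 0 < a ->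
  exists2 s : R, 0 < s & forall u : R, a <= `|u| <= 1 + pi -> s <= sin (u / 2) ^+ 2.
Proof.
move=> a0; have [ab|ab] := leP a (1 + pi); last first.
  by exists 1 => // u /andP[au uab]; have := lt_le_trans ab (le_trans au uab); rewrite ltxx.
have cs : {within `[a, 1 + pi], continuous (fun u : R => sin (u / 2) ^+ 2)}.
  apply: continuous_subspaceT => u.
  apply: (continuous_comp (f := fun u : R => sin (u / 2)) (g := fun y => y ^+ 2)).
    apply: (continuous_comp (f := fun u : R => u / 2) (g := sin)).
      exact: mulrr_continuous.
    exact: continuous_sin.
  exact: exprn_continuous.
have [c + cmin] := EVT_min ab cs; rewrite in_itv/= => /andP[ac cb].
have pi1 : (1 : R) < pi by have := @pi_ge2 R; lra.
exists (sin (c / 2) ^+ 2).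
  rewrite exprn_gt0// sin_gt0_pi//; apply/andP; split; first by lra.
  lra.
move=> u; have -> : sin (u / 2) ^+ 2 = sin (`|u| / 2) ^+ 2.
  by case: (ger0P u) => // _; rewrite mulNr sinN sqrrN.
by move=> ua; apply: cmin; rewrite in_itv.
Qed.

(** The weights in each coordinate other than [i0] sum to 1 and drop out. *)
Lemma fejer_weight_marginal (L : R) n w (i0 : 'I_k) (g : 'I_n -> R) :
  0 < L -> (0 < n)%N ->
  \sum_(j : {ffun 'I_k -> 'I_n}) g (j i0) * \prod_i fejer_weight L w i (j i) =
  \sum_a g a * fejer_weight L w i0 a.
Proof.
move=> L0 n0.
pose W i a := if i == i0 then g a * fejer_weight L w i a else fejer_weight L w i a.
transitivity (\sum_(j : {ffun 'I_k -> 'I_n}) \prod_i W i (j i)).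
  apply: eq_bigr => j _; rewrite (bigD1 i0)//= [RHS](bigD1 i0)//= mulrA /W eqxx.
  by congr (_ * _); apply: eq_bigr => i /negbTE ->.
rewrite -bigA_distr_bigA/= (bigD1 i0)//= [X in _ * X]big1 ?mulr1.
  by apply: eq_bigr => a _; rewrite /W eqxx.
by move=> i /negbTE ii0; rewrite -[RHS](fejer_weight_sum w i L0 n0) /W ii0.
Qed.

(** Node vectors close to [w] in every coordinate cost at most e/2 by uniform continuity; the
    remaining ones carry little weight because the kernel is O(n^-2) away from its peak. *)
Lemma trig_approx_box (L e : R) : 0 < L -> 0 < e ->
  exists F : 'rV[R]_k -> R, [/\ trig_poly F, forall w, `|F w| <= B &
    forall w : 'rV[R]_k, (forall i, `|w 0 i| <= L) -> `|F w - f w| <= e].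
Proof.
move=> L0 e0.
have B0 : 0 <= B by exact: le_trans (normr_ge0 _) (fB 0).
have [r r0 fr] := @uniform_continuity_box L (e / 2) (divr_gt0 e0 (ltr0n _ 2)).
have [s s0 sP] := sin_half_lower (divr_gt0 r0 L0).
(* C / n bounds the contribution of the far nodes: an error of 2B, for each of k coordinates and n
   nodes, with weight at most 1 / (n^2 s). *)
pose C : R := 2 * B * k%:R / s.
have C0 : 0 <= C by rewrite divr_ge0 ?mulr_ge0// ltW.
pose n := (Num.truncn (C / (e / 2))).+1.
have n0 : (0 < n)%N by [].
have n0' : (0 : R) < n%:R by rewrite ltr0n.
have nC : C / n%:R <= e / 2.
  rewrite ler_pdivrMr// mulrC -ler_pdivrMr ?divr_gt0//.
  by rewrite ltW// truncnS_gt// divr_ge0// ltW// divr_gt0.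
exists (fejer_approx L n); split; first exact: trig_fejer_approx.
  by move=> w; exact: fejer_approx_le.
move=> w wL.
pose far i (a : 'I_n) := (r <= `|fejer_node L a - w 0 i|).
have farP i a : far i a -> fejer_weight L w i a <= (n%:R ^+ 2 * s)^-1.
  rewrite /far /fejer_weight; set u := L^-1 * _ => ru.
  have usin : s <= sin (u / 2) ^+ 2.
    have uE : `|u| = `|fejer_node L a - w 0 i| / L.
      by rewrite /u normrM gtr0_norm ?invr_gt0// mulrC distrC.
    apply: sP; rewrite uE ler_pM2r ?invr_gt0// ru/= ler_pdivrMr//.
    rewrite (le_trans (ler_normB _ _))// mulrDl mul1r addrC lerD//.
    rewrite /fejer_node normrM gtr0_norm// mulrC ler_pM2r// ler_norml.
    have a1 : 0 <= (a%:R : R) / n%:R by rewrite divr_ge0.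
    have a2 : (a%:R : R) / n%:R <= 1 by rewrite ler_pdivrMr// mul1r ler_nat ltnW.
    have := @pi_gt0 R => p0; rewrite -[2 * pi * a%:R / n%:R]mulrA.
    by apply/andP; split; nra.
  have := @fejer_bound _ n u n0; rewrite exprMn => fb.
  rewrite -[leRHS]mul1r ler_pdivlMr ?mulr_gt0 ?exprn_gt0//.
  apply: le_trans fb; rewrite ler_wpM2l ?fejer_ge0// ler_wpM2l//.
have bound j : `|f (\row_i fejer_node L (j i)) - f w| <=
    e / 2 + \sum_i 2 * B * (far i (j i))%:R.
  have [[i fi]|nofar] := pselect (exists i, far i (j i)); last first.
    rewrite ler_wpDr ?sumr_ge0// => [i _|]; first by rewrite !mulr_ge0.
    by apply: fr => // i; rewrite mxE ltNge; apply/negP => fi; apply: nofar; exists i.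
  rewrite (bigD1 i)//= fi mulr1.
  rewrite ler_wpDl ?divr_ge0 ?(ltW e0)// ler_wpDr ?sumr_ge0// => [i' _|].
    by rewrite !mulr_ge0.
  by rewrite (le_trans (ler_normB _ _))// mulr_natl mulr2n lerD.
have -> : fejer_approx L n w - f w = \sum_(j : {ffun 'I_k -> 'I_n})
    (f (\row_i fejer_node L (j i)) - f w) * \prod_i fejer_weight L w i (j i).
  under [RHS]eq_bigr do rewrite mulrBl.
  by rewrite sumrB -mulr_sumr fejer_weights_sum// mulr1.
rewrite (le_trans (ler_norm_sum _ _ _))//.
have le1 : \sum_(j : {ffun 'I_k -> 'I_n})
    `|(f (\row_i fejer_node L (j i)) - f w) * \prod_i fejer_weight L w i (j i)| <=
  \sum_(j : {ffun 'I_k -> 'I_n}) (e / 2 + \sum_i 2 * B * (far i (j i))%:R) *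
     \prod_i fejer_weight L w i (j i).
  apply: ler_sum => j _; rewrite normrM (ger0_norm (fejer_weights_ge0 _ _ _)).
  by rewrite ler_wpM2r// fejer_weights_ge0.
rewrite (le_trans le1)//.
under eq_bigr do rewrite mulrDl mulr_suml.
rewrite big_split/= -mulr_sumr fejer_weights_sum// mulr1 exchange_big/=.
rewrite [leRHS](splitr e) lerD2l (le_trans _ nC)//.
have le2 i : \sum_(j : {ffun 'I_k -> 'I_n}) 2 * B * (far i (j i))%:R *
    \prod_i0 fejer_weight L w i0 (j i0) <= 2 * B / (n%:R * s).
  rewrite (@fejer_weight_marginal L n w i (fun a => 2 * B * (far i a)%:R))//.
  have -> : 2 * B / (n%:R * s) = \sum_(a < n) 2 * B * (n%:R ^+ 2 * s)^-1.
    rewrite sumr_const card_ord -[RHS]mulr_natr.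
    by field; rewrite !gt_eqF.
  apply: ler_sum => a _; case: (boolP (far i a)) => fa.
    by rewrite mulr1 ler_wpM2l ?mulr_ge0//; exact: farP.
  by rewrite mulr0 mul0r !mulr_ge0// invr_ge0 mulr_ge0 ?exprn_ge0// ltW.
rewrite (le_trans (ler_sum _ (fun i _ => le2 i)))// sumr_const card_ord -[leLHS]mulr_natr.
rewrite le_eqVlt; apply/orP; left; apply/eqP; rewrite /C.
by field; rewrite !gt_eqF.
Qed.

End FejerApprox.

(** * Weak convergence from cosines *)

Section BoundedConvergence.
Context d (T : measurableType d) (R : realType) (P : probability T R).

Lemma bm_cvg (f_ : nat -> T -> R) (f : T -> R) (B : R) :
  (forall n, measurable_fun setT (f_ n)) -> (forall n x, `|f_ n x| <= B) ->
  (forall x, f_ n x @[n --> \oo] --> f x) -> bounded_measurable f.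
Proof.
move=> mf fB ff; split; first by apply: measurable_fun_cvg mf _ => x _; exact: ff.
exists B => x; have fx : `|f_ n x| @[n --> \oo] --> `|f x| by exact: cvg_norm.
have /(@cvg_lim _) <- // := fx.
apply: limr_le; first by apply/cvg_ex; exists `|f x|.
by apply: nearW => n; exact: fB.
Qed.

Lemma Ex_cvg (f_ : nat -> T -> R) (f : T -> R) (B : R) :
  (forall n, measurable_fun setT (f_ n)) -> (forall n x, `|f_ n x| <= B) ->
  (forall x, f_ n x @[n --> \oo] --> f x) ->
  Ex P (f_ n) @[n --> \oo] --> Ex P f.
Proof.
move=> mf fB ff; have bf := bm_cvg mf fB ff.
have bn n : bounded_measurable (f_ n) by split => //; exists B.
rewrite /Ex /Rintegral; apply: fine_cvg.
rewrite fineK; last exact: integrable_fin_num (bm_integrable P bf).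
apply: (@dominated_cvg _ _ _ P _ measurableT (fun n x => (f_ n x)%:E)
  (EFin \o f) (cst B%:E)) => //=.
- by move=> n; apply/measurable_EFinP.
- by move=> x _; apply: cvg_EFin; [exact: nearW|exact: ff].
- exact: (bm_integrable P (bm_cst T B)).
- by move=> n x _; rewrite lee_fin.
Qed.

End BoundedConvergence.

Lemma cvgn_sum (R : realType) (I : Type) (r : seq I) (F : I -> nat -> R) (l : I -> R) :
  (forall i, F i n @[n --> \oo] --> l i) ->
  \sum_(i <- r) F i n @[n --> \oo] --> \sum_(i <- r) l i.
Proof.
move=> Fl; elim: r => [|i r ih].
  rewrite big_nil; rewrite (_ : (fun n => _) = fun=> 0); first exact: cvg_cst.
  by apply/funext => n; rewrite big_nil.
rewrite big_cons (_ : (fun n => _) = fun n => F i n + \sum_(j <- r) F j n).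
  by apply: cvgD => //; exact: Fl.
by apply/funext => n; rewrite big_cons.
Qed.

Section RandomVectors.
Context d (T : measurableType d) (R : realType) (P : probability T R) (k : nat).
Variable X : T -> 'rV[R]_k.
Hypothesis mX : forall i, measurable_fun setT (fun w => X w 0 i).

Lemma trig_bm F : trig_poly F -> bounded_measurable (fun w => F (X w)).
Proof.
elim=> [a l c|F1 F2 _ b1 _ b2]; last exact: bmD.
apply: bmZ; apply: bm_cos; apply: measurable_funD => //.
apply: measurable_sum => i; exact: measurable_funM.
Qed.

(** [f] is a pointwise limit of trigonometric polynomials on growing boxes, so measurability of the
    coordinates suffices and no sigma-algebra on row vectors enters. *)
Lemma continuous_bm (f : 'rV[R]_k -> R) (B : R) : continuous f ->
  (forall w, `|f w| <= B) -> bounded_measurable (fun w => f (X w)).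
Proof.
move=> cf fB.
have /choice[F FP] : forall n : nat, exists F, [/\ trig_poly F, forall w, `|F w| <= B &
    forall w : 'rV[R]_k, (forall i, `|w 0 i| <= n.+1%:R) -> `|F w - f w| <= n.+1%:R^-1].
  by move=> n; apply: trig_approx_box.
apply: (@bm_cvg _ _ _ (fun n w => F n (X w)) _ B).
- by move=> n; case: (FP n) => /trig_bm [].
- by move=> n w; case: (FP n).
- move=> w; apply/cvgrPdist_le => e e0; near=> n.
  rewrite distrC; case: (FP n) => _ _ H; apply: le_trans (H _ _) _.
    move=> i; have : `|X w 0 i| <= \sum_j `|X w 0 j|.
      by rewrite (bigD1 i)//= lerDl sumr_ge0.
    move=> /le_trans; apply; apply: (@le_trans _ _ n%:R); last by rewrite ler_nat.
    by near: n; exact: nbhs_infty_ger.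
  rewrite invf_ple ?posrE//; apply: (@le_trans _ _ n%:R); last by rewrite ler_nat.
  by near: n; exact: nbhs_infty_ger.
Unshelve. all: by end_near. Qed.

(** The union bound for the event that some coordinate exceeds L in absolute value. *)
Definition tail (L : R) : R := \sum_i Ex P (fun w => (L < `|X w 0 i|)%R%:R).

Lemma tail_bm L i : bounded_measurable (fun w => (L < `|X w 0 i|)%R%:R : R).
Proof.
apply: (eq_bm (g := \1_[set w | L < `|X w 0 i|])).
  by move=> w; rewrite indicE mem_setE.
apply: bm_indic; rewrite -[X in measurable X]setTI.
apply: (@measurable_fun_ltr _ _ _ _ (cst L) (fun w => `|X w 0 i|)) => //.
exact: measurableT_comp.
Qed.

Lemma tail_cvg0 : tail n%:R @[n --> \oo] --> 0.
Proof.
have -> : (0 : R) = \sum_(i <- index_enum 'I_k) 0 by rewrite big1.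
apply: (@cvgn_sum R _ _ (fun i n => Ex P (fun w => (n%:R < `|X w 0 i|)%R%:R))) => i.
rewrite -[X in _ --> X](Ex_cst P 0).
apply: (@Ex_cvg _ _ _ P _ _ 1).
- by move=> n; case: (tail_bm n%:R i).
- by move=> n w; rewrite normr_nat; case: (_ < _); rewrite ?ler01.
- move=> w; apply: cvg_near_cst; near=> n.
  rewrite ltNge (_ : _ <= _) //; near: n; exact: nbhs_infty_ger.
Unshelve. all: by end_near. Qed.

(** Off the box the error is at most 2B, and the indicator of leaving the box is at most the sum of
    the indicators in [tail]. *)
Lemma Ex_trig_approx (f F : 'rV[R]_k -> R) (B L e : R) : continuous f ->
  (forall w, `|f w| <= B) -> trig_poly F -> (forall w, `|F w| <= B) ->
  (forall w : 'rV[R]_k, (forall i, `|w 0 i| <= L) -> `|F w - f w| <= e) -> 0 <= e ->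
  `|Ex P (fun w => F (X w)) - Ex P (fun w => f (X w))| <= e + 2 * B * tail L.
Proof.
move=> cf fB tF FB Ff e0.
have B0 : 0 <= B by exact: le_trans (normr_ge0 _) (fB 0).
have bF := trig_bm tF; have bf := continuous_bm cf fB.
have bt : bounded_measurable (fun w => e + 2 * B * \sum_i (L < `|X w 0 i|)%R%:R).
  apply: bmD; first exact: bm_cst.
  by apply: bmZ; apply: bm_sum => i _; exact: tail_bm.
rewrite -ExB// (le_trans (norm_Ex _ _))//; first exact: bmB.
apply: (@le_trans _ _ (Ex P (fun w => e + 2 * B * \sum_i (L < `|X w 0 i|)%R%:R))).
  apply: le_Ex => //; first by apply: bm_norm; exact: bmB.
  move=> w; have [[i Li]|nL] := pselect (exists i, L < `|X w 0 i|).
    rewrite (bigD1 i)//= Li mulrDr mulr1 addrA ler_wpDr//.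
      by rewrite !mulr_ge0// sumr_ge0.
    rewrite ler_wpDl// (le_trans (ler_normB _ _))// mulr_natl mulr2n.
    by rewrite lerD.
  rewrite ler_wpDr ?mulr_ge0 ?sumr_ge0//.
  by apply: Ff => i; rewrite leNgt; apply/negP => Li; apply: nL; exists i.
have bs : bounded_measurable (fun w => \sum_i (L < `|X w 0 i|)%R%:R : R).
  by apply: bm_sum => i _; exact: tail_bm.
rewrite ExD; [|exact: bm_cst|exact: bmZ].
rewrite Ex_cst ExZ// Ex_sum// => i _; exact: tail_bm.
Qed.

End RandomVectors.

Section WeakConvergence.
Context {R : realType} {k : nat}.
Context (d : nat -> measure_display) (T : forall N, measurableType (d N)).
Context (P : forall N, probability (T N) R) (X : forall N, T N -> 'rV[R]_k).
Context d' (T' : measurableType d') (P' : probability T' R) (Y : T' -> 'rV[R]_k).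
Arguments X : clear implicits.
Hypothesis mX : forall N i, measurable_fun setT (fun w => X N w 0 i).
Hypothesis mY : forall i, measurable_fun setT (fun w => Y w 0 i).
Hypothesis tight : forall e, 0 < e -> exists L0, forall L, L0 <= L ->
  \forall N \near \oo, tail (P N) (X N) L <= e.
Hypothesis cvg_cos : forall l c,
  Ex (P N) (fun w => cos (dot l (X N w) + c)) @[N --> \oo] -->
  Ex P' (fun w => cos (dot l (Y w) + c)).

Lemma trig_weak_cvg F : trig_poly F ->
  Ex (P N) (fun w => F (X N w)) @[N --> \oo] --> Ex P' (fun w => F (Y w)).
Proof.
elim=> [a l c|F1 F2 t1 c1 t2 c2].
  have tc : trig_poly (fun w : 'rV[R]_k => cos (dot l w + c)).
    by apply: eq_trig (TrigCos 1 l c) => w; rewrite mul1r.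
  rewrite ExZ; last exact: (trig_bm mY tc).
  rewrite (_ : (fun N => _) = fun N => a * Ex (P N) (fun w => cos (dot l (X N w) + c))).
    exact: cvgMr.
  by apply/funext => N; rewrite ExZ//; exact: (trig_bm (@mX N) tc).
rewrite ExD; [|exact: (trig_bm mY)|exact: (trig_bm mY)].
rewrite (_ : (fun N => _) =
    fun N => Ex (P N) (fun w => F1 (X N w)) + Ex (P N) (fun w => F2 (X N w))).
  exact: cvgD.
by apply/funext => N; rewrite ExD//; exact: (trig_bm (@mX N)).
Qed.

Lemma weak_cvg (f : 'rV[R]_k -> R) (B : R) : continuous f ->
  (forall w, `|f w| <= B) ->
  Ex (P N) (fun w => f (X N w)) @[N --> \oo] --> Ex P' (fun w => f (Y w)).
Proof.
move=> cf fB; apply/cvgrPdist_le => e e0.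
have B0 : 0 <= B by exact: le_trans (normr_ge0 _) (fB 0).
(* The summand 1 keeps the divisor positive when [B] is 0. *)
pose b := 2 * B + 1; have b0 : 0 < b by rewrite /b; lra.
(* Two shares of e/5 for each of the two truncations, one for the convergence of the trigonometric
   polynomial. *)
pose e1 := e / 5; have e10 : 0 < e1 by rewrite /e1; lra.
have [L0 L0P] := tight (divr_gt0 e10 b0).
have [L [L_gt0 L0L LY]] : exists L, [/\ 0 < L, L0 <= L & tail P' Y L <= e1 / b].
  have /cvgrPdist_le/(_ _ (divr_gt0 e10 b0)) tY := tail_cvg0 P' mY.
  near \oo => n; exists n%:R; split.
  - by rewrite ltr0n; near: n; exact: nbhs_infty_gt.
  - by near: n; exact: nbhs_infty_ger.
  - rewrite -[leLHS]opprK -[X in - X]add0r (le_trans (ler_norm _))// normrN.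
    by near: n.
have [F [tF FB Ff]] := trig_approx_box cf fB L_gt0 e10.
have tb t : t <= e1 / b -> e1 + 2 * B * t <= 2 * e1.
  move=> tb; have : 2 * B * t <= b * (e1 / b).
    apply: (@le_trans _ _ (2 * B * (e1 / b))); first by rewrite ler_wpM2l ?mulr_ge0.
    by rewrite ler_wpM2r ?divr_ge0 ?(ltW e10) ?(ltW b0)// /b; lra.
  by rewrite (mulrC b) divfK ?gt_eqF//; lra.
have /cvgrPdist_le/(_ _ e10) FN := trig_weak_cvg tF.
near=> N.
have h1 : `|Ex P' (fun w => F (Y w)) - Ex (P N) (fun w => F (X N w))| <= e1.
  by near: N.
have h2 := Ex_trig_approx P' mY cf fB tF FB Ff (ltW e10).
have h3 := Ex_trig_approx (P N) (@mX N) cf fB tF FB Ff (ltW e10).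
have h4 := tb _ LY.
have h5 : e1 + 2 * B * tail (P N) (X N) L <= 2 * e1.
  by apply: tb; near: N; exact: L0P.
have eE : e = 5 * e1 by rewrite /e1; field.
have {}h2 := le_trans h2 h4; have {}h3 := le_trans h3 h5.
move: h1 h2 h3; rewrite eE !ler_norml => /andP[? ?] /andP[? ?] /andP[? ?].
by apply/andP; split; lra.
Unshelve. all: by end_near. Qed.

End WeakConvergence.

(** A constant sequence of laws converges weakly to every law with the same cosine expectations;
    uniqueness of limits identifies the two. *)
Lemma trig_unique (R : realType) (k : nat) d (T : measurableType d) (P : probability T R)
    d' (T' : measurableType d') (P' : probability T' R)
    (X : T -> 'rV[R]_k) (Y : T' -> 'rV[R]_k) (f : 'rV[R]_k -> R) (B : R) :
  (forall i, measurable_fun setT (fun w => X w 0 i)) ->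
  (forall i, measurable_fun setT (fun w => Y w 0 i)) ->
  (forall l c, Ex P (fun w => cos (dot l (X w) + c)) =
               Ex P' (fun w => cos (dot l (Y w) + c))) ->
  continuous f -> (forall w, `|f w| <= B) ->
  Ex P (fun w => f (X w)) = Ex P' (fun w => f (Y w)).
Proof.
move=> mX mY eqXY cf fB.
have := @weak_cvg R k (fun=> d) (fun=> T) (fun=> P) (fun=> X) _ _ P' Y (fun=> mX) mY.
move=> /(_ _ _ f B cf fB) H.
have /cvg_lim <- // : Ex P (fun w => f (X w)) @[_ --> \oo] --> Ex P' (fun w => f (Y w)).
  apply: H.
    move=> e e0; have /cvgrPdist_le/(_ _ e0)[n _ tX] := tail_cvg0 P mX.
    exists n%:R => L nL; apply: nearW => _.
    apply: (@le_trans _ _ (tail P X n%:R)).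
      apply: ler_sum => i _; apply: le_Ex; [exact: tail_bm|exact: tail_bm|].
      move=> w; have [h|h] := ltP L; last by [].
      by rewrite (le_lt_trans nL h).
    have := tX n (leqnn n); rewrite sub0r normrN => /(le_trans (ler_norm _)).
    by [].
  by move=> l c; rewrite eqXY; exact: cvg_cst.
by apply/esym; apply: lim_cst.
Qed.

(** * A central limit theorem for local dependence *)

Section Lipschitz.
Context {R : realType}.
Implicit Types x y u : R.

Lemma cos_lip x y : `|cos x - cos y| <= `|x - y|.
Proof.
wlog xy : x y / x < y => [H|].
  have [/H//|/H|->] := ltgtP x y; last by rewrite subrr normr0.
  by rewrite distrC [X in _ -> _ <= X]distrC.
have [z _ zE] := @MVT R cos (fun z => - sin z) x y xy (fun z _ => is_derive_cos z)
  (continuous_subspaceT (@continuous_cos R)).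
rewrite distrC zE normrM normrN distrC -[leRHS]mul1r ler_wpM2r//.
exact: sin_max.
Qed.

(** Mean value theorem for the sine, then the Lipschitz bound for the cosine at the intermediate
    point; the constant 1 in place of 1/2 is good enough here. *)
Lemma sin_taylor x u : `|sin (x + u) - sin x - u * cos x| <= u ^+ 2.
Proof.
have H y z : y < z -> exists2 c, y < c < z & sin z - sin y = cos c * (z - y).
  move=> yz.
  have [c] := @MVT R sin (fun z => cos z) y z yz (fun z _ => is_derive_sin z)
    (continuous_subspaceT (@continuous_sin R)).
  by rewrite in_itv/= => ? ?; exists c.
have [u0|u0|->] := ltgtP u 0.
- have [|c /andP[c1 c2] cE] := H (x + u) x; first by rewrite gtrDl.
  have -> : sin (x + u) - sin x - u * cos x = u * (cos c - cos x).
    by rewrite -[sin (x + u) - _]opprB cE; ring.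
  rewrite normrM -(@real_normK _ u) ?num_real// expr2 ler_wpM2l//.
  by rewrite (le_trans (cos_lip _ _))// (ltr0_norm u0) ler_norml; apply/andP; split; lra.
- have [|c /andP[c1 c2] cE] := H x (x + u); first by rewrite ltrDl.
  have -> : sin (x + u) - sin x - u * cos x = u * (cos c - cos x).
    by rewrite cE; ring.
  rewrite normrM expr2 (gtr0_norm u0) ler_wpM2l ?(ltW u0)//.
  by rewrite (le_trans (cos_lip _ _))// ler_norml; apply/andP; split; lra.
- by rewrite addr0 subrr mul0r subrr normr0 expr0n.
Qed.

End Lipschitz.

Section CharacteristicDerivative.
Context d (T : measurableType d) (R : realType) (mu : {measure set T -> \bar R}).
Variables (W p : T -> R) (c : R).
Hypothesis mW : measurable_fun setT W.
Hypothesis ip : mu.-integrable setT (EFin \o p).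
Hypothesis iWp : mu.-integrable setT (EFin \o (fun w => W w * p w)).

Lemma integrable_bounded_mul (h g : T -> R) : measurable_fun setT h ->
  (forall w, `|h w| <= 1) -> mu.-integrable setT (EFin \o g) ->
  mu.-integrable setT (EFin \o (fun w => h w * g w)).
Proof.
move=> mh h1 ig; have [mg _] := integrableP _ _ _ ig.
apply: le_integrable ig => //.
  by apply/measurable_EFinP; apply: measurable_funM => //; exact/measurable_EFinP.
by move=> w _ /=; rewrite lee_fin normrM -[leRHS]mul1r ler_wpM2r.
Qed.

(** The measure and the weight [p] are arbitrary so that one differentiation serves both a
    probability with weight 1 and Lebesgue measure with a normal density. *)
Lemma is_derive_integral_cos (t : R) : is_derive t 1
  (fun s => \int[mu]_w (cos (s * W w + c) * p w))
  (- \int[mu]_w (sin (t * W w + c) * (W w * p w))).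
Proof.
have mlin s : measurable_fun setT (fun w => s * W w + c).
  by apply: measurable_funD => //; exact: measurable_funM.
pose f s w := cos (s * W w + c) * p w.
have df (s : R) (w : T) : is_derive s 1 (f ^~ w) (- (sin (s * W w + c) * (W w * p w))).
  have -> : f ^~ w = p w *: (cos \o (fun s => s * W w + c)).
    by apply/funext => x; rewrite /f /= mulrC.
  have d1 : is_derive s 1 (fun s : R => s * W w + c) (W w).
    have -> : (fun s : R => s * W w + c) = (W w) *: (@id R) + cst c.
      by apply/funext => x; rewrite /= mulrC.
    apply: is_derive_eq (_ : W w *: 1 + 0 = W w).
    by rewrite addr0 /GRing.scale/= mulr1.
  apply: (is_derive_eq (is_deriveZ (p w) (is_derive1_comp (is_derive_cos _) d1))).
  by rewrite /GRing.scale/=; ring.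
have intf (x : R) : `]t - 1, t + 1[%classic x -> mu.-integrable setT (EFin \o f x).
  move=> _; apply: integrable_bounded_mul => //.
    by case: (bm_cos (mlin x)).
  by move=> w; exact: cos_max.
have tI : (`]t - 1, t + 1[%classic : set R) t.
  by rewrite /= in_itv/=; apply/andP; split; lra.
have d1f (s : R) (w : T) : partial1of2 f s w = - (sin (s * W w + c) * (W w * p w)).
  by rewrite partial1of2E; exact: derive_val.
have der (x : R) (w : T) : `]t - 1, t + 1[%classic x -> setT w -> derivable (f ^~ w) x 1.
  by move=> _ _; exact: ex_derive.
have intG : mu.-integrable setT (EFin \o (fun w => `|W w * p w|)).
  exact: (integrable_norm iWp).
have ub (x : R) (w : T) :
    `]t - 1, t + 1[%classic x -> setT w -> `|partial1of2 f x w| <= `|W w * p w|.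
  move=> _ _; rewrite d1f normrN normrM -[leRHS]mul1r ler_wpM2r//.
  exact: sin_max.
have D := derivable_under_integral measurableT tI intf der
  (fun w => normr_ge0 (W w * p w)) intG ub.
have E := differentiation_under_integral measurableT tI intf der
  (fun w => normr_ge0 (W w * p w)) intG ub.
apply: DeriveDef => //.
rewrite -derive1E E -mulN1r -RintegralZl//.
  by apply: eq_Rintegral => w _; rewrite d1f mulN1r.
apply: integrable_bounded_mul => //.
  by case: (bm_sin (mlin t)).
by move=> w; exact: sin_max.
Qed.

End CharacteristicDerivative.

Lemma is_derive_Ex_cos d (T : measurableType d) (R : realType) (P : probability T R)
    (W : T -> R) (c t : R) : bounded_measurable W ->
  is_derive t 1 (fun s => Ex P (fun w => cos (s * W w + c)))
  (- Ex P (fun w => W w * sin (t * W w + c))).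
Proof.
move=> bW; have mW : measurable_fun setT W by case: bW.
have i1 := bm_integrable P (bm_cst T (1 : R)).
have iW := bm_integrable P (bmM bW (bm_cst T (1 : R))).
have := is_derive_integral_cos c mW i1 iW t.
have -> : (fun s => \int[P]_w (cos (s * W w + c) * 1)) =
    (fun s => Ex P (fun w => cos (s * W w + c))).
  by apply/funext => s; apply: eq_Rintegral => w _; rewrite mulr1.
have -> // : \int[P]_w (sin (t * W w + c) * (W w * 1)) =
    Ex P (fun w => W w * sin (t * W w + c)).
by apply: eq_Rintegral => w _; rewrite mulr1 mulrC.
Qed.

(* Tikhomirov's form of Stein's method: phi(t) = E cos(tW + c) satisfies
   phi' = - t v phi + O(a), where a is the normalisation, since Y x only interacts
   with its neighbourhood. *)
Section LocalDependenceCLT.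
Context d (T : measurableType d) (R : realType) (P : probability T R).
Variables (I : finType) (Y : I -> T -> R) (nb : I -> {set I}).
Variables (B a : R) (D : nat).
Hypothesis mY : forall x, measurable_fun setT (Y x).
Hypothesis YB : forall x w, `|Y x w| <= B.
Hypothesis nbD : forall x, (#|nb x| <= D)%N.
Hypotheses (a0 : 0 <= a) (aI : a ^+ 2 * #|I|%:R <= 1).

Definition part_sum (A : {set I}) (w : T) : R := a * \sum_(z in A) Y z w.

Local Notation W := (part_sum [set: I]).

(** Independence enters the argument through [local1] and [local2] alone: [Y x] is centred and
    independent of the sum outside its neighbourhood, and a neighbouring pair is independent of the
    sum outside both neighbourhoods. *)
Hypothesis local1 : forall x t c,
  Ex P (fun w => Y x w * sin (t * part_sum (~: nb x) w + c)) = 0.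
Hypothesis local2 : forall x y t c, y \in nb x ->
  Ex P (fun w => Y x w * Y y w * cos (t * part_sum (~: (nb x :|: nb y)) w + c)) =
  Ex P (fun w => Y x w * Y y w) *
  Ex P (fun w => cos (t * part_sum (~: (nb x :|: nb y)) w + c)).

Definition local_variance : R :=
  a ^+ 2 * \sum_x \sum_(y in nb x) Ex P (fun w => Y x w * Y y w).

Local Notation v := local_variance.

Let bY x : bounded_measurable (Y x).
Proof. by split; [exact: mY|exists B]. Qed.

Let bS A : bounded_measurable (part_sum A).
Proof. by apply: bmZ; apply: bm_sum => z _; exact: bY. Qed.

Let mt (t c : R) A : measurable_fun setT (fun w => t * part_sum A w + c).
Proof.
apply: measurable_funD => //; apply: measurable_funM => //.
by case: (bS A).
Qed.

Let bcos t c A : bounded_measurable (fun w => cos (t * part_sum A w + c)).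
Proof. by apply: bm_cos; exact: mt. Qed.

Let bsin t c A : bounded_measurable (fun w => sin (t * part_sum A w + c)).
Proof. by apply: bm_sin; exact: mt. Qed.

Let phi (c t : R) : R := Ex P (fun w => cos (t * W w + c)).

Let part_sum_split (A A' : {set I}) w : A \subset A' ->
  part_sum A' w = part_sum A w + part_sum (A' :\: A) w.
Proof.
move=> AA'; rewrite /part_sum -mulrDr; congr (_ * _).
by rewrite (big_setID A)/= (finset.setIidPr AA').
Qed.

Let part_sum_le (A : {set I}) w (n : nat) : 0 <= B -> (#|A| <= n)%N ->
  `|part_sum A w| <= a * (n%:R * B).
Proof.
move=> B0 An; rewrite /part_sum normrM ger0_norm// ler_wpM2l//.
rewrite (le_trans (ler_norm_sum _ _ _))//.
rewrite (le_trans (ler_sum _ (fun z _ => YB z w)))// sumr_const -[leLHS]mulr_natl.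
by rewrite ler_wpM2r// ler_nat.
Qed.

Let cos_part_le (A A' : {set I}) t c w (n : nat) : 0 <= B -> 0 <= t <= 1 ->
  A \subset A' -> (#|A' :\: A| <= n)%N ->
  `|cos (t * part_sum A w + c) - cos (t * part_sum A' w + c)| <= a * (n%:R * B).
Proof.
move=> B0 /andP[t0 t1] AA' An; rewrite (le_trans (cos_lip _ _))//.
rewrite (part_sum_split w AA').
have -> : t * part_sum A w + c - (t * (part_sum A w + part_sum (A' :\: A) w) + c) =
  - (t * part_sum (A' :\: A) w) by ring.
rewrite normrN normrM ger0_norm// (le_trans _ (part_sum_le w B0 An))//.
by rewrite -[leRHS]mul1r ler_wpM2r.
Qed.

(** The neighbourhood of [y] is removed to make the pair independent of the cosine, then everything
    is put back: at most D and 2D summands change, which gives the factor 3. *)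
Lemma local_pair_error x y t c : 0 <= B -> 0 <= t <= 1 -> y \in nb x ->
  `|Ex P (fun w => Y x w * Y y w * cos (t * part_sum (~: nb x) w + c)) -
    Ex P (fun w => Y x w * Y y w) * phi c t| <= 3 * a * D%:R * B ^+ 3.
Proof.
move=> B0 t01 yx; pose A := ~: (nb x :|: nb y).
have YYB w : `|Y x w * Y y w| <= B ^+ 2.
  by rewrite normrM expr2 ler_pM.
have bYY : bounded_measurable (fun w => Y x w * Y y w) by apply: bmM.
have E1 : `|Ex P (fun w => Y x w * Y y w *
      (cos (t * part_sum (~: nb x) w + c) - cos (t * part_sum A w + c)))| <=
    a * (D%:R * B) * B ^+ 2.
  apply: norm_Ex_le; first by apply: bmM => //; exact: bmB.
  move=> w; rewrite normrM mulrC ler_pM// distrC.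
  apply: cos_part_le => //; first by rewrite /A finset.setCU finset.subsetIl.
  rewrite (leq_trans _ (nbD y))//; apply: subset_leq_card.
  by apply/fintype.subsetP => z; rewrite !inE negb_or; case: (z \in nb x); case: (z \in nb y).
have E2 : `|Ex P (fun w => cos (t * part_sum A w + c)) - phi c t| <=
    a * ((D + D)%:R * B).
  rewrite /phi -ExB//; apply: norm_Ex_le; first exact: bmB.
  move=> w; apply: cos_part_le; rewrite ?finset.subsetT//.
  rewrite finset.setTD finset.setCK (leq_trans (leq_card_setU _ _))//.
  exact: leq_add.
have E3 : `|Ex P (fun w => Y x w * Y y w)| <= B ^+ 2 by exact: norm_Ex_le.
have -> : Ex P (fun w => Y x w * Y y w * cos (t * part_sum (~: nb x) w + c)) -
    Ex P (fun w => Y x w * Y y w) * phi c t =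
  Ex P (fun w => Y x w * Y y w *
      (cos (t * part_sum (~: nb x) w + c) - cos (t * part_sum A w + c))) +
  Ex P (fun w => Y x w * Y y w) *
   (Ex P (fun w => cos (t * part_sum A w + c)) - phi c t).
  rewrite mulrBr -local2// -/A.
  under [in RHS]eq_Ex do rewrite mulrBr.
  by rewrite ExB; [ring|exact: bmM|exact: bmM].
rewrite (le_trans (ler_normD _ _))// normrM.
have -> : 3 * a * D%:R * B ^+ 3 =
    a * (D%:R * B) * B ^+ 2 + B ^+ 2 * (a * ((D + D)%:R * B)).
  by rewrite natrD; ring.
by apply: lerD => //; rewrite ler_pM.
Qed.

(** Expand the sine around the sum outside the neighbourhood of [x]: the zeroth order vanishes by
    [local1], the first order is a sum of pair terms, and the remainder is quadratic in the local
    part. The shares are 3 for the pairs and 1 for the remainder. *)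
Lemma local_site_error x t c : 0 <= B -> 0 <= t <= 1 ->
  `|Ex P (fun w => Y x w * sin (t * W w + c)) -
    t * (a * \sum_(y in nb x) Ex P (fun w => Y x w * Y y w)) * phi c t| <=
  4 * a ^+ 2 * D%:R ^+ 2 * B ^+ 3.
Proof.
move=> B0 t01; have /andP[t0 t1] := t01.
pose u w := t * part_sum (~: nb x) w + c; pose s w := t * part_sum (nb x) w.
have bu : bounded_measurable (fun w => sin (u w)) by exact: bsin.
have bcu : bounded_measurable (fun w => cos (u w)) by exact: bcos.
have bs : bounded_measurable s by exact: bmZ.
have usE w : t * W w + c = u w + s w.
  rewrite /u /s (part_sum_split w (finset.subsetT (~: nb x))) finset.setTD finset.setCK; ring.
have E1 : `|Ex P (fun w => Y x w * (sin (u w + s w) - sin (u w) - s w * cos (u w)))|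
    <= B * (a * (D%:R * B)) ^+ 2.
  apply: norm_Ex_le.
    apply: bmM => //; apply: bmB; last exact: bmM.
    apply: bmB => //; apply: eq_bm (bsin t c [set: I]) => w.
    by rewrite usE.
  move=> w; rewrite normrM ler_pM// (le_trans (sin_taylor _ _))//.
  rewrite -(@real_normK _ (s w)) ?num_real// ler_pXn2r ?nnegrE//; last first.
    by rewrite !mulr_ge0.
  rewrite /s normrM ger0_norm// (le_trans _ (part_sum_le w B0 (nbD x)))//.
  by rewrite -[leRHS]mul1r ler_wpM2r.
have E2 : `|\sum_(y in nb x) (Ex P (fun w => Y x w * Y y w * cos (u w)) -
     Ex P (fun w => Y x w * Y y w) * phi c t)| <= D%:R * (3 * a * D%:R * B ^+ 3).
  rewrite (le_trans (ler_norm_sum _ _ _))//.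
  rewrite (le_trans (ler_sum _ (fun y yx => local_pair_error c B0 t01 yx)))//.
  rewrite sumr_const -[leLHS]mulr_natl ler_wpM2r ?ler_nat//.
  by rewrite !mulr_ge0 ?exprn_ge0.
have sE : Ex P (fun w => Y x w * (s w * cos (u w))) =
    t * a * \sum_(y in nb x) Ex P (fun w => Y x w * Y y w * cos (u w)).
  rewrite -Ex_sum; last by move=> y _; apply: bmM => //; exact: bmM.
  rewrite -ExZ; last by apply: bm_sum => y _; apply: bmM => //; exact: bmM.
  apply: eq_Ex => w; rewrite /s /part_sum !mulr_sumr mulr_suml mulr_sumr.
  by apply: eq_bigr => y _; ring.
have -> : Ex P (fun w => Y x w * sin (t * W w + c)) -
    t * (a * \sum_(y in nb x) Ex P (fun w => Y x w * Y y w)) * phi c t =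
  Ex P (fun w => Y x w * (sin (u w + s w) - sin (u w) - s w * cos (u w))) +
  t * a * \sum_(y in nb x) (Ex P (fun w => Y x w * Y y w * cos (u w)) -
     Ex P (fun w => Y x w * Y y w) * phi c t).
  rewrite sumrB mulrBr -sE -mulr_suml.
  have -> : Ex P (fun w => Y x w * (sin (u w + s w) - sin (u w) - s w * cos (u w))) =
     Ex P (fun w => Y x w * sin (t * W w + c)) - Ex P (fun w => Y x w * sin (u w)) -
     Ex P (fun w => Y x w * (s w * cos (u w))).
    have b1 : bounded_measurable (fun w => Y x w * sin (t * W w + c)) by exact: bmM.
    have b2 : bounded_measurable (fun w => Y x w * sin (u w)) by exact: bmM.
    have b3 : bounded_measurable (fun w => Y x w * (s w * cos (u w))).
      by apply: bmM => //; exact: bmM.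
    rewrite -(ExB P b1 b2) -(ExB P (bmB b1 b2) b3).
    by apply: eq_Ex => w; rewrite usE; ring.
  by rewrite local1; ring.
rewrite (le_trans (ler_normD _ _))//.
have -> : 4 * a ^+ 2 * D%:R ^+ 2 * B ^+ 3 =
  B * (a * (D%:R * B)) ^+ 2 + a * (D%:R * (3 * a * D%:R * B ^+ 3)) by ring.
apply: lerD => //; rewrite 2!normrM (ger0_norm t0) (ger0_norm a0) -mulrA.
rewrite -[leRHS]mul1r ler_pM// ?mulr_ge0// ler_wpM2l//.
Qed.

(** There are #|I| site errors of order a^2, with an outer factor a; the normalisation a^2 #|I| <= 1
    leaves a single a. *)
Lemma local_total_error t c : 0 <= B -> 0 <= t <= 1 ->
  `|Ex P (fun w => W w * sin (t * W w + c)) - t * v * phi c t| <=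
  4 * a * D%:R ^+ 2 * B ^+ 3.
Proof.
move=> B0 t01.
have -> : Ex P (fun w => W w * sin (t * W w + c)) - t * v * phi c t =
  a * \sum_x (Ex P (fun w => Y x w * sin (t * W w + c)) -
    t * (a * \sum_(y in nb x) Ex P (fun w => Y x w * Y y w)) * phi c t).
  have -> : Ex P (fun w => W w * sin (t * W w + c)) =
      a * \sum_x Ex P (fun w => Y x w * sin (t * W w + c)).
    have bx x : bounded_measurable (fun w => Y x w * sin (t * W w + c)) by exact: bmM.
    rewrite -Ex_sum// -ExZ; last by apply: bm_sum.
    apply: eq_Ex => w; rewrite {1}/part_sum -mulrA mulr_suml; congr (_ * _).
    by apply: eq_bigl => x; rewrite inE.
  rewrite sumrB mulrBr; congr (_ - _).
  rewrite -mulr_suml -mulr_sumr -mulr_sumr /v; ring.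
rewrite normrM ger0_norm//.
apply: (@le_trans _ _ (a * (#|I|%:R * (4 * a ^+ 2 * D%:R ^+ 2 * B ^+ 3)))).
  rewrite ler_wpM2l// (le_trans (ler_norm_sum _ _ _))//.
  rewrite (le_trans (ler_sum _ (fun x _ => local_site_error x c B0 t01)))//.
  by rewrite sumr_const -[leLHS]mulr_natl.
have -> : a * (#|I|%:R * (4 * a ^+ 2 * D%:R ^+ 2 * B ^+ 3)) =
  (a ^+ 2 * #|I|%:R) * (4 * a * D%:R ^+ 2 * B ^+ 3) by ring.
by rewrite -[leRHS]mul1r ler_wpM2r// !mulr_ge0// exprn_ge0.
Qed.

(** With the integrating factor h(t) = exp(t^2 v / 2), the derivative of h phi is h times the total
    error, and the mean value theorem on [0, 1] applies; h(t) <= h(1) is then cancelled by the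
    division by h(1). *)
Theorem local_clt c : 0 <= B -> 0 <= v ->
  `|Ex P (fun w => cos (W w + c)) - expR (- v / 2) * cos c| <=
  4 * a * D%:R ^+ 2 * B ^+ 3.
Proof.
move=> B0 v0; pose K := 4 * a * D%:R ^+ 2 * B ^+ 3.
pose h (t : R) := expR (t ^+ 2 * (v / 2)).
pose h' (t : R) := h t * (t * v).
have dh (t : R) : is_derive t 1 h (h' t).
  have d1 : is_derive t 1 (fun t : R => t ^+ 2 * (v / 2)) (t * v).
    have -> : (fun t : R => t ^+ 2 * (v / 2)) = (v / 2) *: (@id R ^+ 2).
      by apply/funext => x; rewrite /= mulrC.
    apply: is_derive_eq (_ : (v / 2) *: ((2%:R * t ^+ 1) *: 1) = t * v).
    by rewrite /GRing.scale/= expr1; field.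
  apply: (is_derive_eq (is_derive1_comp _ d1)).
  by rewrite /h' /h.
have dphi (t : R) : is_derive t 1 (phi c) (- Ex P (fun w => W w * sin (t * W w + c))).
  exact: is_derive_Ex_cos.
pose g := h * phi c.
have dg (t : R) : is_derive t 1 g
    (h t * (t * v * phi c t - Ex P (fun w => W w * sin (t * W w + c)))).
  apply: (is_derive_eq (is_deriveM (dh t) (dphi t))).
  by rewrite /GRing.scale/= /h'; ring.
have cg : {within `[0, 1], continuous g}.
  apply: continuous_subspaceT => t; apply: differentiable_continuous.
  by apply/derivable1_diffP; have [] := dg t.
have [t] := @MVT R g _ 0 1 ltr01 (fun t _ => dg t) cg.
rewrite in_itv/= => /andP[t0 t1] gE.
have g1 : g 1 = expR (v / 2) * Ex P (fun w => cos (W w + c)).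
  rewrite (_ : g 1 = h 1 * phi c 1)// /h /phi expr1n mul1r; congr (_ * _).
  by apply: eq_Ex => w; rewrite mul1r.
have g0 : g 0 = cos c.
  rewrite (_ : g 0 = h 0 * phi c 0)// /h /phi expr0n/= mul0r expR0 mul1r -[RHS](Ex_cst P).
  by apply: eq_Ex => w; rewrite mul0r add0r.
have e0 : 0 < expR (v / 2) by exact: expR_gt0.
rewrite mulNr expRN.
have -> : Ex P (fun w => cos (W w + c)) - (expR (v / 2))^-1 * cos c =
   (expR (v / 2))^-1 * (g 1 - g 0).
  by rewrite g1 g0; field; rewrite gt_eqF.
rewrite normrM gtr0_norm ?invr_gt0// ler_pdivrMl// gE subr0 mulr1 normrM.
rewrite gtr0_norm ?expR_gt0// ler_pM ?expR_ge0//.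
  rewrite ler_expR -[leRHS]mul1r ler_wpM2r ?divr_ge0// expr_le1// ltW//.
rewrite distrC; apply: local_total_error => //.
by rewrite (ltW t0) (ltW t1).
Qed.

End LocalDependenceCLT.

(** * Short cycles of permutations *)

Section ShortCycles.
Local Open Scope nat_scope.
Variable N : nat.
Implicit Types (s : 'S_N) (x y : 'I_N).

Definition short_cycle (K : nat) s x : bool := [exists j : 'I_K, iter j.+1 s x == x].

Definition cycle_length_is s x (l : nat) : bool :=
  (iter l s x == x) && [forall i : 'I_l, (0 < i) ==> (iter i s x != x)].

(** The proper iterates of [x] are excluded but [x] itself is not: [tperm x x] is the identity, and
    only l - 1 points are lost. *)
Definition off_arc s x (l : nat) : {set 'I_N} :=
  [set y | [forall i : 'I_l, (0 < i) ==> (iter i s x != y)]].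

(** The modified permutation applies [s] first. It follows [s] as long as neither [x] nor [y] is
    met; the l-th step returns to [x], which the transposition sends to [y]. *)
Lemma iter_tperm s x l y : 0 < l -> cycle_length_is s x l -> y \in off_arc s x l ->
  iter l (s * tperm x y)%g x = y.
Proof.
move=> l0 /andP[/eqP sl /forallP sx]; rewrite inE => /forallP sy.
have H i : i < l -> iter i (s * tperm x y)%g x = iter i s x.
  elim: i => // i ih il; rewrite iterS ih ?(ltnW il)// permM -iterS tpermD//.
    by rewrite eq_sym; exact: (implyP (sx (Ordinal il))).
  by rewrite eq_sym; exact: (implyP (sy (Ordinal il))).
case: l l0 sl sx sy H => // l _ sl _ _ H.
by rewrite iterS H// permM -iterS sl tpermL.
Qed.

Lemma card_off_arc s x l : N <= #|off_arc s x l| + l.-1.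
Proof.
rewrite -[X in X <= _]card_ord -(cardsC (off_arc s x l)) leq_add2l.
have : ~: off_arc s x l \subset [set iter i.+1 s x | i : 'I_l.-1]%SET.
  apply/fintype.subsetP => y; rewrite !inE => /forallPn[j].
  rewrite negb_imply negbK => /andP[j0 /eqP <-].
  have jl : j.-1 < l.-1 by case: j j0 => -[|j] //= jl _; rewrite -ltnS prednK// (leq_trans _ jl).
  apply/imsetP; exists (Ordinal jl) => //.
  by have -> : iter j s x = iter j.-1.+1 s x by rewrite prednK.
move=> /subset_leq_card /leq_trans; apply.
by rewrite (leq_trans (leq_imset_card _ _))// card_ord.
Qed.

(* (s, y) |-> s * tperm x y is injective on the pairs with x on an s-cycle of length l
   and y off the inner part of that cycle, since y is recovered as the l-th iterate. *)
Lemma card_cycle_length x l : 0 < l ->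
  #|[set s | cycle_length_is s x l]%SET| * (N - l.-1) <= N`!.
Proof.
move=> l0; pose A := [set s | cycle_length_is s x l]%SET.
pose Q := [set p : 'S_N * 'I_N | (p.1 \in A) && (p.2 \in off_arc p.1 x l)]%SET.
have QE : #|Q| = \sum_(s in A) #|off_arc s x l|.
  rewrite -sum1_card (eq_bigl (fun p => (p.1 \in A) && (p.2 \in off_arc p.1 x l))).
    rewrite -(pair_big_dep (fun s => s \in A) (fun s y => y \in off_arc s x l) (fun _ _ => 1)).
    by apply: eq_bigr => s _; rewrite sum1_card.
  by move=> p; rewrite inE.
apply: (@leq_trans #|Q|).
  rewrite QE -sum_nat_const; apply: leq_sum => s _.
  by rewrite leq_subLR addnC card_off_arc.
rewrite -card_Sn -(@card_in_imset _ _ (fun p : 'S_N * 'I_N => (p.1 * tperm x p.2)%g)).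
  exact: max_card.
have QP p : p \in Q -> cycle_length_is p.1 x l /\ p.2 \in off_arc p.1 x l.
  by rewrite [p \in Q]inE => /andP[]; rewrite [_ \in A]inE.
move=> [s y] [s' y'] /QP /= [sA yo] /QP /= [sA' yo'] E.
have yy : y = y' by rewrite -(iter_tperm l0 sA yo) E iter_tperm.
by move: E; rewrite yy => /mulIg ->.
Qed.

(** The least return time is the length of the cycle. *)
Lemma short_cycle_length K s x : short_cycle K s x ->
  [exists l : 'I_K, cycle_length_is s x l.+1].
Proof.
move=> /existsP[j jx].
have ex : exists j, (j < K) && (iter j.+1 s x == x) by exists j; rewrite ltn_ord.
case: (ex_minnP ex) => m /andP[mK mx] mmin.
apply/existsP; exists (Ordinal mK); rewrite /cycle_length_is mx/=.
apply/forallP => i; apply/implyP => i0; apply/negP => ix.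
have := mmin i.-1; rewrite prednK// ix andbT.
have := ltn_ord i; move: i0 mK; clear; lia.
Qed.

Lemma card_set_sum (I : finType) (p : pred I) : #|[set x | p x]%SET| = \sum_x p x.
Proof.
by rewrite -sum1_card big_mkcond/=; apply: eq_bigr => x _; rewrite inE; case: (p x).
Qed.

(** For l < K the hypothesis gives N - l >= N / 2, so each site lies on a cycle of length l + 1 for
    at most 2 N! / N permutations; sum over K lengths and N sites. *)
Lemma sum_short_cycles K : 2 * K <= N ->
  \sum_(s : 'S_N) #|[set x | short_cycle K s x]%SET| <= 2 * K * N`!.
Proof.
move=> KN; have [N0|N0] := posnP N.
  rewrite big1// => s _; apply/eqP; rewrite -leqn0 (leq_trans (max_card _))//.
  by rewrite card_ord N0.
have H x : N * (\sum_(s : 'S_N) short_cycle K s x) <= 2 * K * N`!.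
  have le1 : \sum_(s : 'S_N) short_cycle K s x <=
      \sum_(l < K) #|[set s | cycle_length_is s x l.+1]%SET|.
    under [leqRHS]eq_bigr do rewrite card_set_sum.
    rewrite exchange_big/=; apply: leq_sum => s _.
    have [/short_cycle_length/existsP[l sl]|//] := boolP (short_cycle K s x).
    by rewrite (bigD1 l)//= sl.
  apply: (@leq_trans (\sum_(l < K) 2 * N`!)); last first.
    by rewrite sum_nat_const card_ord mulnA (mulnC K).
  apply: (@leq_trans (N * \sum_(l < K) #|[set s | cycle_length_is s x l.+1]%SET|)).
    by rewrite leq_mul2l le1 orbT.
  rewrite big_distrr/=; apply: leq_sum => l _.
  apply: (leq_trans _ (leq_mul (leqnn 2) (card_cycle_length x (ltn0Sn l)))).
  rewrite mulnCA mulnC leq_mul2l; apply/orP; right => /=.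
  have : l < K by []; lia.
rewrite -(leq_pmul2l N0).
under eq_bigr do rewrite card_set_sum.
rewrite exchange_big/= big_distrr/= -[X in X * (2 * K * _)]card_ord -sum_nat_const.
by apply: leq_sum => x _; exact: H.
Qed.

End ShortCycles.

(** * Walks along a permutation *)

Section Walks.
Variables (N : nat) (s : 'S_N).
Implicit Types (x y : 'I_N) (L n : nat).

Definition near_site L x y : bool :=
  [exists j : 'I_L.+1, (iter j s x == y) || (iter j s y == x)].

Lemma near_siteP L x y : reflect (exists2 j, (j <= L)%N & iter j s x = y \/ iter j s y = x)
  (near_site L x y).
Proof.
apply: (iffP existsP) => [[j /orP jxy]|[j jL jxy]].
  exists j; first by rewrite -ltnS.
  by case: jxy => /eqP; [left|right].
exists (Ordinal (jL : j < L.+1)%N).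
by case: jxy => /= ->; rewrite eqxx ?orbT.
Qed.

Definition ball_site L x : {set 'I_N} := [set y | near_site L x y]%SET.

Lemma near_site_sym L x y : near_site L x y = near_site L y x.
Proof. by apply: eq_existsb => j; rewrite orbC. Qed.

Lemma iter_perm_inj j : injective (iter j s).
Proof. by elim: j => // j ih x y /perm_inj /ih. Qed.

Lemma near_site_trans L L' x y z :
  near_site L x y -> near_site L' y z -> near_site (L + L') x z.
Proof.
move=> /near_siteP[a aL xy] /near_siteP[b bL yz]; apply/near_siteP.
case: xy => [<-|xy] in yz *; case: yz => yz.
- by exists (b + a)%N; [rewrite addnC leq_add|left; rewrite iterD].
- have [ab|ba] := leqP a b.
    exists (b - a)%N; first by rewrite (leq_trans (leq_subr _ _))// (leq_trans bL)// leq_addl.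
    by right; apply: (@iter_perm_inj a); rewrite -iterD subnKC.
  exists (a - b)%N; first by rewrite (leq_trans (leq_subr _ _))// (leq_trans aL)// leq_addr.
  by left; apply: (@iter_perm_inj b); rewrite -iterD subnKC// ltnW.
- have [ab|ba] := leqP a b.
    exists (b - a)%N; first by rewrite (leq_trans (leq_subr _ _))// (leq_trans bL)// leq_addl.
    by left; rewrite -xy -iterD subnK.
  exists (a - b)%N; first by rewrite (leq_trans (leq_subr _ _))// (leq_trans aL)// leq_addr.
  by right; rewrite -yz -iterD subnK// ltnW.
- by exists (a + b)%N; [exact: leq_add|right; rewrite iterD yz].
Qed.

Lemma near_site_refl L x : near_site L x x.
Proof. by apply/near_siteP; exists 0%N => //; left. Qed.

Lemma near_site_step L x y : near_site L (s x) y -> near_site L.+1 x y.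
Proof.
rewrite -add1n; apply: near_site_trans; apply/near_siteP; exists 1%N => //.
by left.
Qed.

Lemma near_site_stepV L x y : near_site L (s^-1%g x) y -> near_site L.+1 x y.
Proof.
rewrite -add1n; apply: near_site_trans; apply/near_siteP; exists 1%N => //.
by right; rewrite /= permKV.
Qed.

Lemma iter_permVK j x : iter j s (iter j s^-1%g x) = x.
Proof. by elim: j x => // j ih x; rewrite iterSr [in X in s X]iterS permKV ih. Qed.

(** A ball is an arc of 2L + 1 successive iterates starting L steps behind [x]. This bounds its size
    and numbers its sites by natural numbers with forward steps only. *)
Lemma ball_site_arc L x :
  ball_site L x = [set iter (j : 'I_(L + L).+1) s (iter L s^-1%g x) | j in 'I_(L + L).+1]%SET.
Proof.
apply/finset.setP => y; rewrite inE; apply/near_siteP/imsetP => [[j jL]|[j _ ->]].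
  have jL2 : (L + j < (L + L).+1)%N by rewrite ltnS leq_add2l.
  have jL3 : (L - j < (L + L).+1)%N by rewrite ltnS (leq_trans (leq_subr _ _))// leq_addl.
  move=> [<-|jy].
    by exists (Ordinal jL2) => //=; rewrite addnC iterD iter_permVK.
  exists (Ordinal jL3) => //=; apply: (@iter_perm_inj j).
  by rewrite jy -iterD subnKC// iter_permVK.
have jl := ltn_ord j.
have [Lj|jL] := leqP L j.
  exists (j - L)%N; first by lia.
  by left; rewrite -{2}(subnK Lj) iterD iter_permVK.
exists (L - j)%N; first by lia.
by right; rewrite -iterD subnK ?iter_permVK// ltnW.
Qed.

Lemma card_ball_site L x : (#|ball_site L x| <= (L + L).+1)%N.
Proof. by rewrite ball_site_arc (leq_trans (leq_imset_card _ _))// card_ord. Qed.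

Lemma short_cycle_le K K' x : (K <= K')%N -> short_cycle K s x -> short_cycle K' s x.
Proof. by move=> KK' /existsP[j jx]; apply/existsP; exists (widen_ord KK' j). Qed.

(** All points of a cycle have the same return times, so a coincidence among the positions 0, ..., K
    would make [x] itself return within K steps. *)
Lemma arc_inj K M x : ~~ short_cycle K s x ->
  forall i j, (i <= K)%N -> (j <= K)%N ->
  iter i s (iter M s^-1%g x) = iter j s (iter M s^-1%g x) -> i = j.
Proof.
move=> nx; suff H i j : (i < j)%N -> (j <= K)%N ->
    iter i s (iter M s^-1%g x) <> iter j s (iter M s^-1%g x).
  move=> i j iK jK E; apply/eqP; rewrite eqn_leq leqNgt [X in _ && X]leqNgt.
  by apply/andP; split; apply/negP => /H; [move=> /(_ iK)|move=> /(_ jK)]; rewrite E.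
move=> ij jK E; move/negP : nx; apply; apply/existsP.
have jK' : ((j - i).-1 < K)%N by lia.
exists (Ordinal jK') => /=; rewrite -iterS prednK ?subn_gt0//.
apply/eqP; apply: (@iter_perm_inj i); rewrite -iterD subnKC ?(ltnW ij)//.
rewrite -{1}(iter_permVK M x) -[in RHS](iter_permVK M x) -!iterD addnC iterD -E.
by rewrite addnC -iterD.
Qed.

Context {R : nzRingType}.

(** The (x, y) entry of the n-th power of the permutation matrix plus its transpose plus the
    diagonal matrix of [z], expanded along its first factor. *)
Fixpoint walk (z : 'I_N -> R) n x y : R :=
  if n is n'.+1 then
    walk z n' (s x) y + walk z n' (s^-1%g x) y + z x * walk z n' x y
  else (x == y)%:R.

End Walks.

(* The words in the potentials read by the walks of length n from position a to position b
   on an arc numbered by nat. The truncated predecessor a.-1 is harmless when n <= a. *)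
Fixpoint walk_words n (a b : nat) : seq (seq nat) :=
  if n is n'.+1 then
    walk_words n' a.+1 b ++ walk_words n' a.-1 b ++ map (cons a) (walk_words n' a b)
  else if a == b then [:: [::]] else [::].

Section Words.
Context {R : comNzRingType}.

(** A list of words is a polynomial written as a sum of monomials. Positions stand for sites, so
    that the polynomial is the same for all permutations. *)
Definition eval_words (z : nat -> R) (F : seq (seq nat)) : R :=
  \sum_(l <- F) \prod_(j <- l) z j.

Definition mul_words (F G : seq (seq nat)) : seq (seq nat) :=
  [seq l ++ l' | l <- F, l' <- G].

Lemma eval_words_cat z F G : eval_words z (F ++ G) = eval_words z F + eval_words z G.
Proof. exact: big_cat. Qed.

Lemma eval_words_mul z F G :
  eval_words z (mul_words F G) = eval_words z F * eval_words z G.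
Proof.
rewrite /eval_words big_allpairs_dep/= mulr_suml; apply: eq_bigr => l _.
by rewrite mulr_sumr; apply: eq_bigr => l' _; rewrite big_cat.
Qed.

Definition words_le (M : nat) (F : seq (seq nat)) : Prop :=
  forall l j, l \in F -> j \in l -> (j <= M)%N.

Lemma words_le_mul M F G : words_le M F -> words_le M G -> words_le M (mul_words F G).
Proof.
move=> FM GM _ j /allpairsP[[l l'] /= [lF lG ->]]; rewrite mem_cat.
by move=> /orP[]; [exact: FM|exact: GM].
Qed.

Lemma walk_words_le n a b : words_le (a + n) (walk_words n a b).
Proof.
elim: n a => [|n ih] a l j /=; first by case: ifP => //; rewrite inE => _ /eqP ->.
rewrite !mem_cat => /or3P[/ih H|/ih H|/mapP[l' /ih H ->]].
- by move=> /H; lia.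
- by move=> /H; lia.
- by rewrite inE => /orP[/eqP ->|/H]; lia.
Qed.

(** The walk tests equality of sites only when it stops, so only coincidences with the end point
    [i b] have to be excluded. *)
Lemma walk_eval (N : nat) (s : 'S_N) (z : 'I_N -> R) (i : nat -> 'I_N) n a b :
  (forall j, i j.+1 = s (i j)) -> (n <= a)%N ->
  (forall j, (j <= a + n)%N -> i j = i b -> j = b) ->
  walk s z n (i a) (i b) = eval_words (fun j => z (i j)) (walk_words n a b).
Proof.
move=> iS; elim: n a => [|n ih] a na inj /=.
  case: eqP => [/inj|]; first by rewrite addn0 => -> //; rewrite eqxx /eval_words big_seq1 big_nil.
  move=> iab; case: eqP => [E|_]; first by rewrite E in iab.
  by rewrite /eval_words big_nil.
rewrite !eval_words_cat -iS ih; [|lia|by move=> j ja; apply: inj; lia].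
(* Here [a] is positive, because at least one step remains and n <= a. *)
have -> : s^-1%g (i a) = i a.-1 by rewrite -[in LHS](prednK (leq_trans _ na))// iS permK.
rewrite ih; [|lia|by move=> j ja; apply: inj; lia].
rewrite ih; [|lia|by move=> j ja; apply: inj; lia].
rewrite -addrA; congr (_ + (_ + _)).
rewrite /eval_words big_map mulr_sumr; apply: eq_bigr => l _.
by rewrite big_cons.
Qed.

(** The expectation of a monomial in independent variables with moments [mu]: equal letters are
    grouped, and each group contributes the moment of its multiplicity. *)
Definition word_moment (mu : nat -> R) (l : seq nat) : R :=
  \prod_(j <- undup l) mu (count_mem j l).

Definition words_moment (mu : nat -> R) (F : seq (seq nat)) : R :=
  \sum_(l <- F) word_moment mu l.

Definition walk_mean (mu : nat -> R) n : R := words_moment mu (walk_words n (3 * n) (3 * n)).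

(* The position 3L is far enough from 0, and L + j with j <= 4L runs through all the
   positions at distance at most 2L from it. *)
Definition walk_cov (mu : nat -> R) n n' : R := let L := maxn n n' in
  \sum_(j < (L.*2 + L.*2).+1)
    (words_moment mu (mul_words (walk_words n (3 * L) (3 * L))
                                (walk_words n' (L + j) (L + j))) -
     words_moment mu (walk_words n (3 * L) (3 * L)) *
     words_moment mu (walk_words n' (L + j) (L + j))).

End Words.

(* The only facts on the potential xi used by the limit theorem; [on A f] reads
   "f is bounded and measurable with respect to (xi k)_(k in A)". *)
Record site_model (R : realType) (N : nat) d (T : measurableType d)
    (P : probability T R) (xi : 'I_N -> T -> R) (K : R) (mu : nat -> R) := SiteModel {
  on : {set 'I_N} -> (T -> R) -> Prop;
  on_bm : forall A f, on A f -> bounded_measurable f;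
  on_sub : forall (A B : {set 'I_N}) f, A \subset B -> on A f -> on B f;
  on_cst : forall A a, on A (fun=> a);
  onD : forall A f g, on A f -> on A g -> on A (fun w => f w + g w);
  onM : forall A f g, on A f -> on A g -> on A (fun w => f w * g w);
  on_cos : forall A f, on A f -> on A (fun w => cos (f w));
  on_sin : forall A f, on A f -> on A (fun w => sin (f w));
  on_norm : forall A f, on A f -> on A (fun w => `|f w|);
  on_xi : forall k, on [set k]%SET (xi k);
  on_indep : forall (A B : {set 'I_N}) f g, [disjoint A & B]%B -> on A f -> on B g ->
    Ex P (fun w => f w * g w) = Ex P f * Ex P g;
  xi_moment : forall k j, Ex P (fun w => xi k w ^+ j) = mu j;
  xi_bound : forall k w, `|xi k w| <= K
}.

Section SiteModel.
Context {R : realType} {N : nat} {d} {T : measurableType d} {P : probability T R}.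
Context {xi : 'I_N -> T -> R} {K : R} {mu : nat -> R} (S : site_model P xi K mu).



Lemma eq_on A f g : f =1 g -> on S A g -> on S A f.
Proof. by move=> /funext ->. Qed.

Lemma on_sum (I : Type) (r : seq I) (Q : pred I) (F : I -> T -> R) A :
  (forall i, Q i -> on S A (F i)) -> on S A (fun w => \sum_(i <- r | Q i) F i w).
Proof.
move=> oF; elim: r => [|i r ih].
  by apply: eq_on (on_cst S A 0) => w; rewrite big_nil.
case Qi: (Q i).
  by apply: eq_on (onD (oF _ Qi) ih) => w; rewrite big_cons Qi.
by apply: eq_on ih => w; rewrite big_cons Qi.
Qed.

Lemma onX A f n : on S A f -> on S A (fun w => f w ^+ n).
Proof.
move=> of_; elim: n => [|n ih]; first exact: on_cst.
by apply: eq_on (onM of_ ih) => w; rewrite exprS.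
Qed.

Lemma walk_on (s : 'S_N) n x y (A : {set 'I_N}) : ball_site s n x \subset A ->
  on S A (fun w => walk s (xi^~ w) n x y).
Proof.
elim: n x => [|n ih] x sA /=; first exact: on_cst.
apply: onD; first apply: onD.
- apply: ih; apply: fintype.subset_trans sA; apply/fintype.subsetP => z.
  by rewrite !inE; exact: near_site_step.
- apply: ih; apply: fintype.subset_trans sA; apply/fintype.subsetP => z.
  by rewrite !inE; exact: near_site_stepV.
- apply: onM.
    apply: on_sub (on_xi S x); apply: fintype.subset_trans sA.
    by rewrite finset.sub1set inE near_site_refl.
  apply: ih; apply: fintype.subset_trans sA; apply/fintype.subsetP => z.
  rewrite !inE => /near_siteP[j jn H]; apply/near_siteP; exists j => //.
  exact: leqW.
Qed.

Lemma walk_le (s : 'S_N) n x y w : `|walk s (xi^~ w) n x y| <= (2 + K) ^+ n.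
Proof.
elim: n x => [|n ih] x /=; first by rewrite expr0 normr_nat; case: (_ == _).
rewrite exprS mulrDl (le_trans (ler_normD _ _))//.
apply: lerD.
  rewrite mulr_natl mulr2n (le_trans (ler_normD _ _))//.
  by apply: lerD.
by rewrite normrM ler_pM// (xi_bound S).
Qed.

(** The two parts are proved together: splitting off one site uses its independence of the remaining
    product, hence the sites on which that product depends. *)
Lemma Ex_site_prod (r : seq 'I_N) (e : 'I_N -> nat) : uniq r ->
  Ex P (fun w => \prod_(y <- r) xi y w ^+ e y) = \prod_(y <- r) mu (e y) /\
  on S [set y in r]%SET (fun w => \prod_(y <- r) xi y w ^+ e y).
Proof.
elim: r => [|y r ih] /=.
  move=> _; rewrite big_nil; split.
    by rewrite -[RHS](Ex_cst P); apply: eq_Ex => w; rewrite big_nil.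
  by apply: eq_on (on_cst S _ 1) => w; rewrite big_nil.
move=> /andP[yr /ih[E o]].
have -> : (fun w => \prod_(y0 <- y :: r) xi y0 w ^+ e y0) =
    (fun w => xi y w ^+ e y * \prod_(y0 <- r) xi y0 w ^+ e y0).
  by apply/funext => w; rewrite big_cons.
have o1 := onX (e y) (on_xi S y); split.
  rewrite (on_indep (s := S) _ o1 o) ?(xi_moment S) ?E ?big_cons//.
  by rewrite disjoints1 inE.
apply: onM.
  by apply: on_sub o1; rewrite finset.sub1set !inE eqxx.
apply: on_sub o; apply/fintype.subsetP => z; rewrite !inE => ->.
by rewrite orbT.
Qed.

(** An injective numbering preserves multiplicities, so the sites may be grouped exactly as the
    letters. *)
Lemma Ex_word (i : nat -> 'I_N) (l : seq nat) : {in l &, injective i} ->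
  Ex P (fun w => \prod_(j <- l) xi (i j) w) = word_moment mu l.
Proof.
move=> inj.
have u : uniq (map i (undup l)).
  rewrite map_inj_in_uniq ?undup_uniq// => a b; rewrite !mem_undup; exact: inj.
have [n_ nE] : exists n_ : 'I_N -> nat, forall j, j \in l -> n_ (i j) = count_mem j l.
  exists (fun y => count_mem y (map i l)) => j jl; rewrite count_map.
  apply: eq_in_count => j' j'l /=; apply/eqP/eqP => [/inj|->//]; exact.
have [E _] := Ex_site_prod n_ u; rewrite big_map in E.
rewrite /word_moment (eq_big_seq (fun j => mu (n_ (i j)))); last first.
  by move=> j; rewrite mem_undup => jl; rewrite nE.
rewrite -E; apply: eq_Ex => w; rewrite big_map -big_undup_iterop_count.
by apply: eq_big_seq => j; rewrite mem_undup => jl; rewrite nE.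
Qed.

Lemma Ex_words (i : nat -> 'I_N) M F : words_le M F ->
  (forall a b, (a <= M)%N -> (b <= M)%N -> i a = i b -> a = b) ->
  Ex P (fun w => eval_words (fun j => xi (i j) w) F) = words_moment mu F.
Proof.
move=> FM inj; rewrite Ex_sum; last first.
  move=> l _; apply: bm_prod => j _; exact: on_bm (on_xi S _).
apply: eq_big_seq => l lF; apply: Ex_word => a b al bl.
by apply: inj; [exact: FM al|exact: FM bl].
Qed.

Lemma bm_walk (s : 'S_N) n x y : bounded_measurable (fun w => walk s (xi^~ w) n x y).
Proof. exact: on_bm (walk_on _ (fintype.subxx _)). Qed.

(** Without returns within 6L steps the positions 0, ..., 6L are distinct sites. A walk of length at
    most L that starts at a position between L and 5L never leaves this range. *)
Let arc_eval (s : 'S_N) L x n j : ~~ short_cycle (6 * L) s x -> (n <= L)%N ->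
  (L <= j <= 5 * L)%N ->
  let i := fun j => iter j s (iter (3 * L) s^-1%g x) in
  forall w, walk s (xi^~ w) n (i j) (i j) =
            eval_words (fun a => xi (i a) w) (walk_words n j j).
Proof.
move=> nx nL /andP[Lj j5] i w.
apply: (@walk_eval R N s (xi^~ w) i n j j) => //; first exact: leq_trans Lj.
move=> a ja ab; apply: (arc_inj (M := (3 * L)%N) nx _ _ ab); lia.
Qed.

Lemma Ex_walk (s : 'S_N) L x n : ~~ short_cycle (6 * L) s x -> (n <= L)%N ->
  Ex P (fun w => walk s (xi^~ w) n x x) = walk_mean mu n.
Proof.
move=> nxL nL; have nx : ~~ short_cycle (6 * n) s x.
  by apply: contra nxL; apply: short_cycle_le; rewrite leq_mul2l nL orbT.
pose i j := iter j s (iter (3 * n) s^-1%g x).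
have ix : i (3 * n)%N = x by exact: iter_permVK.
have F1 : words_le (6 * n) (walk_words n (3 * n) (3 * n)).
  by move=> l j lF jl; have := walk_words_le lF jl; lia.
have inj a b : (a <= 6 * n)%N -> (b <= 6 * n)%N -> i a = i b -> a = b.
  by move=> aM bM; exact: (arc_inj nx).
rewrite /walk_mean -(Ex_words F1 inj).
by apply: eq_Ex => w; rewrite -{1 2}ix; apply: arc_eval => //; lia.
Qed.

(** Sites at distance more than twice the maximal length contribute nothing by independence; the
    others form an arc on which both walks read words. *)
Lemma sum_cov_walk (s : 'S_N) L x n n' :
  ~~ short_cycle (6 * L) s x -> (n <= L)%N -> (n' <= L)%N ->
  \sum_y (Ex P (fun w => walk s (xi^~ w) n x x * walk s (xi^~ w) n' y y) -
    Ex P (fun w => walk s (xi^~ w) n x x) * Ex P (fun w => walk s (xi^~ w) n' y y)) =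
  walk_cov mu n n'.
Proof.
move=> nxL nL0 nL0'; rewrite /walk_cov; set L1 := maxn n n'.
have nL : (n <= L1)%N by exact: leq_maxl.
have nL' : (n' <= L1)%N by exact: leq_maxr.
have nx : ~~ short_cycle (6 * L1) s x.
  apply: contra nxL; apply: short_cycle_le.
  by rewrite leq_mul2l geq_max nL0 nL0'.
(* [walk_cov] is built with the maximum of its own two lengths, while a site is good for all lengths
   up to [L] at once; from here on only the smaller radius matters. *)
clearbody L1; clear nxL nL0 nL0' L.
pose i j := iter j s (iter (3 * L1) s^-1%g x).
have ix : i (3 * L1)%N = x by exact: iter_permVK.
rewrite (bigID (mem (ball_site s L1.*2 x)))/= [X in _ + X]big1 ?addr0; last first.
  move=> y yx; apply/eqP; rewrite subr_eq0; apply/eqP.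
  apply: (on_indep (s := S) (A := ball_site s L1 x) (B := ball_site s L1 y)).
  - rewrite -finset.setI_eq0; apply/eqP/finset.setP => z; rewrite !inE; apply/negP => /andP[xz yz].
    move/negP : yx; apply; rewrite inE -addnn; apply: near_site_trans xz _.
    by rewrite near_site_sym.
  - apply: walk_on; apply/fintype.subsetP => z; rewrite !inE => /near_siteP[j jn H].
    by apply/near_siteP; exists j => //; exact: leq_trans nL.
  - apply: walk_on; apply/fintype.subsetP => z; rewrite !inE => /near_siteP[j jn H].
    by apply/near_siteP; exists j => //; exact: leq_trans nL'.
rewrite ball_site_arc.
have iE (j : nat) : iter j s (iter L1.*2 s^-1%g x) = i (L1 + j)%N.
  rewrite /i (_ : 3 * L1 = L1 + L1.*2)%N; last by lia.
  by rewrite addnC !iterD iter_permVK.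
have iinj a b : (a <= 6 * L1)%N -> (b <= 6 * L1)%N -> i a = i b -> a = b.
  by move=> aM bM; exact: (arc_inj nx).
rewrite big_imset/=; last first.
  move=> a b _ _; rewrite !iE => /iinj ab; apply/val_inj => /=.
  by have := ltn_ord a; have := ltn_ord b; move=> ? ?; lia.
apply: eq_bigr => j _; rewrite iE.
have j5 : (L1 <= L1 + j <= 5 * L1)%N by have := ltn_ord j; lia.
have wx w : walk s (xi^~ w) n x x =
    eval_words (fun a => xi (i a) w) (walk_words n (3 * L1) (3 * L1)).
  by rewrite -{1 2}ix; apply: arc_eval => //; lia.
have wy w : walk s (xi^~ w) n' (i (L1 + j)%N) (i (L1 + j)%N) =
    eval_words (fun a => xi (i a) w) (walk_words n' (L1 + j) (L1 + j)).
  exact: arc_eval.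
have F1 : words_le (6 * L1) (walk_words n (3 * L1) (3 * L1)).
  by move=> l a lF al; have := walk_words_le lF al; lia.
have F2 : words_le (6 * L1) (walk_words n' (L1 + j) (L1 + j)).
  by move=> l a lF al; have := walk_words_le lF al; lia.
rewrite -(Ex_words F1 iinj) -(Ex_words F2 iinj) -(Ex_words (words_le_mul F1 F2) iinj).
congr (_ - _ * _); apply: eq_Ex => w; rewrite ?eval_words_mul ?wx ?wy//.
Qed.

End SiteModel.

(** * Linear statistics of walks *)

Section LinearStatistic.
Context {R : realType}.
Variables (K : R) (mu : nat -> R) (k : nat) (ns : 'I_k -> nat) (al : 'I_k -> R).
Hypothesis K0 : 0 <= K.

Definition stat_range : nat := \max_i ns i.
Definition stat_bound : R := \sum_i `|al i| * (2 + K) ^+ ns i.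
Definition stat_mean : R := \sum_i al i * walk_mean mu (ns i).
Definition stat_cov : R :=
  \sum_i \sum_j al i * al j * walk_cov mu (ns i) (ns j).
(** The bound 4L + 1 on the number of sites at distance at most 2L, that is, of the sites whose
    statistics may depend on that of a given one. *)
Definition stat_degree : nat := (stat_range.*2 + stat_range.*2).+1.

Local Notation L := stat_range.
Local Notation B := stat_bound.
Local Notation D := stat_degree.

Lemma stat_bound_ge0 : 0 <= B.
Proof. by apply: sumr_ge0 => i _; rewrite mulr_ge0// exprn_ge0// addr_ge0. Qed.

Context {N : nat} {d} {T : measurableType d} {P : probability T R}.
Context {xi : 'I_N -> T -> R} (S : site_model P xi K mu).

Definition site_stat (s : 'S_N) (x : 'I_N) (w : T) : R :=
  \sum_i al i * walk s (xi^~ w) (ns i) x x.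

Lemma site_stat_on s x (A : {set 'I_N}) : ball_site s L x \subset A ->
  on S A (site_stat s x).
Proof.
move=> LA; apply: on_sum => i _; apply: onM; first exact: on_cst.
apply: walk_on; apply: fintype.subset_trans LA; apply/fintype.subsetP => z.
rewrite !inE => /near_siteP[j ji H]; apply/near_siteP; exists j => //.
by rewrite (leq_trans ji)// /L leq_bigmax.
Qed.

Lemma site_stat_le s x w : `|site_stat s x w| <= B.
Proof.
rewrite (le_trans (ler_norm_sum _ _ _))//; apply: ler_sum => i _.
by rewrite normrM ler_wpM2l//; exact: (walk_le S).
Qed.

Lemma bm_site_stat s x : bounded_measurable (site_stat s x).
Proof. exact: on_bm (site_stat_on (fintype.subxx _)). Qed.

(** * The central limit theorem for a fixed permutation *)

Section FixedPermutation.
Variable s : 'S_N.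

Definition centered (x : 'I_N) (w : T) : R := site_stat s x w - Ex P (site_stat s x).

Definition scale : R := (Num.sqrt N%:R)^-1.

Local Notation bad := #|[set x | short_cycle (6 * L) s x]%SET|.
Local Notation nb := (ball_site s L.*2).
Local Notation W := (part_sum centered scale [set: 'I_N]).
Local Notation v := (local_variance P centered nb scale).

Lemma centered_on x (A : {set 'I_N}) : ball_site s L x \subset A -> on S A (centered x).
Proof.
move=> LA; apply: eq_on (onD (site_stat_on LA) (on_cst S A (- Ex P (site_stat s x)))) => w.
by [].
Qed.

Lemma bm_centered x : bounded_measurable (centered x).
Proof. exact: on_bm (centered_on (fintype.subxx _)). Qed.

Lemma Ex_centered x : Ex P (centered x) = 0.
Proof.
rewrite ExB ?Ex_cst ?subrr//; last exact: bm_cst.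
exact: bm_site_stat.
Qed.

Lemma centered_le x w : `|centered x w| <= 2 * B.
Proof.
rewrite (le_trans (ler_normB _ _))// mulr_natl mulr2n lerD ?site_stat_le//.
by apply: norm_Ex_le; [exact: bm_site_stat|exact: site_stat_le].
Qed.

Lemma scale_ge0 : 0 <= scale.
Proof. by rewrite invr_ge0 sqrtr_ge0. Qed.

Lemma scale_sqr : scale ^+ 2 = N%:R^-1.
Proof. by rewrite /scale exprVn sqr_sqrtr. Qed.

Lemma part_sum_on (A C : {set 'I_N}) a t c :
  (forall z, z \in A -> ball_site s L z \subset C) ->
  on S C (fun w => t * part_sum centered a A w + c).
Proof.
move=> AC; apply: onD; last exact: on_cst.
apply: onM; first exact: on_cst.
apply: onM; first exact: on_cst.
by apply: on_sum => z zA; apply: centered_on; exact: AC.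
Qed.

Lemma ball_site_disjoint x z : z \notin nb x -> [disjoint ball_site s L x & ball_site s L z]%B.
Proof.
move=> zx; rewrite -finset.setI_eq0; apply/eqP/finset.setP => y; rewrite !inE.
apply/negP => /andP[xy zy]; move/negP : zx; apply; rewrite inE -addnn.
by apply: near_site_trans xy _; rewrite near_site_sym.
Qed.

(** The statistic of a site depends on a ball of radius L, so radius 2L is what makes the sites
    outside the neighbourhood independent of the centre. *)
Lemma ball_site_subC x z : z \notin nb x -> ball_site s L z \subset ~: ball_site s L x.
Proof.
move=> /ball_site_disjoint; rewrite disjoint_sym => /disjoint_setI0 => H.
by rewrite finset.subsets_disjoint finset.setCK -finset.setI_eq0 H.
Qed.

Lemma disjointC (A : {set 'I_N}) : [disjoint A & ~: A]%B.
Proof. by rewrite -finset.setI_eq0 finset.setICr. Qed.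

Lemma cov_off x y : y \notin nb x -> Ex P (fun w => centered x w * centered y w) = 0.
Proof.
move=> yx; rewrite (on_indep (s := S) (ball_site_disjoint yx)) ?Ex_centered ?mul0r//.
- exact: centered_on (fintype.subxx _).
- exact: centered_on (fintype.subxx _).
Qed.

Lemma fixed_perm_local1 x t c :
  Ex P (fun w => centered x w * sin (t * part_sum centered scale (~: nb x) w + c)) = 0.
Proof.
rewrite (on_indep (s := S) (disjointC (ball_site s L x))) ?Ex_centered ?mul0r//.
  exact: centered_on (fintype.subxx _).
apply: on_sin; apply: part_sum_on => z; rewrite !inE => zx.
by apply: ball_site_subC; rewrite inE.
Qed.

Lemma fixed_perm_local2 x y t c :
  Ex P (fun w => centered x w * centered y w *
     cos (t * part_sum centered scale (~: (nb x :|: nb y)) w + c)) =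
  Ex P (fun w => centered x w * centered y w) *
  Ex P (fun w => cos (t * part_sum centered scale (~: (nb x :|: nb y)) w + c)).
Proof.
apply: (on_indep (s := S) (disjointC (ball_site s L x :|: ball_site s L y))).
  by apply: onM; apply: centered_on; rewrite ?finset.subsetUl ?finset.subsetUr.
apply: on_cos; apply: part_sum_on => z; rewrite !inE negb_or => /andP[zx zy].
by rewrite finset.setCU finset.subsetI !ball_site_subC// inE.
Qed.

Lemma fixed_perm_variance :
  v = scale ^+ 2 * \sum_x \sum_y Ex P (fun w => centered x w * centered y w).
Proof.
rewrite /local_variance; congr (_ * _); apply: eq_bigr => x _.
rewrite [RHS](bigID (mem (nb x)))/= [X in _ = _ + X]big1 ?addr0// => y yx.
exact: cov_off.
Qed.

Lemma bm_W : bounded_measurable W.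
Proof. by apply: bmZ; apply: bm_sum => z _; exact: bm_centered. Qed.

(** Writing the local variance as a second moment yields its nonnegativity, and later the bound on E
    W^2 used for tightness. *)
Lemma fixed_perm_variance_sqr : v = Ex P (fun w => W w ^+ 2).
Proof.
rewrite fixed_perm_variance.
have bc x y : bounded_measurable (fun w => centered x w * centered y w).
  by apply: bmM; exact: bm_centered.
under eq_bigr do rewrite -Ex_sum//.
rewrite -Ex_sum; last by move=> x _; exact: bm_sum.
rewrite -ExZ; last by apply: bm_sum => x _; exact: bm_sum.
apply: eq_Ex => w; rewrite /part_sum exprMn; congr (_ * _).
rewrite expr2 big_distrlr/=; apply: eq_big => [x|x _]; first by rewrite inE.
by apply: eq_bigl => y; rewrite inE.
Qed.

Lemma fixed_perm_variance_ge0 : 0 <= v.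
Proof. by rewrite fixed_perm_variance_sqr; apply: Rintegral_ge0 => w _; exact: sqr_ge0. Qed.

Lemma site_cov_le x :
  `|\sum_(y in nb x) Ex P (fun w => centered x w * centered y w)| <= D%:R * (2 * B) ^+ 2.
Proof.
have B0 := stat_bound_ge0.
have bc y : bounded_measurable (fun w => centered x w * centered y w).
  by apply: bmM; exact: bm_centered.
apply: (@le_trans _ _ (\sum_(y in nb x) (2 * B) ^+ 2)).
  rewrite (le_trans (ler_norm_sum _ _ _))//; apply: ler_sum => y _.
  apply: norm_Ex_le => // w; rewrite normrM expr2.
  by apply: ler_pM => //; exact: centered_le.
rewrite sumr_const -[leLHS]mulr_natl ler_wpM2r ?exprn_ge0 ?mulr_ge0// ler_nat.
exact: card_ball_site.
Qed.

Lemma fixed_perm_variance_le : v <= D%:R * (2 * B) ^+ 2.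
Proof.
have B0 := stat_bound_ge0.
rewrite /local_variance scale_sqr.
have [N0|N0] := posnP N.
  have -> : N%:R^-1 = 0 :> R by rewrite [X in X%:R]N0 invr0.
  by rewrite mul0r mulr_ge0// exprn_ge0// mulr_ge0//.
rewrite ler_pdivrMl ?ltr0n//.
apply: (@le_trans _ _ (\sum_(x < N) D%:R * (2 * B) ^+ 2)).
  by apply: ler_sum => x _; exact: le_trans (ler_norm _) (site_cov_le x).
by rewrite sumr_const card_ord -[leLHS]mulr_natl.
Qed.

Lemma fixed_perm_clt c :
  `|Ex P (fun w => cos (W w + c)) - expR (- v / 2) * cos c| <=
  4 * scale * D%:R ^+ 2 * (2 * B) ^+ 3.
Proof.
apply: local_clt.
- by move=> x; case: (bm_centered x).
- exact: centered_le.
- by move=> x; exact: card_ball_site.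
- exact: scale_ge0.
- rewrite scale_sqr card_ord; have [->|N0] := posnP N; first by rewrite invr0 mul0r.
  by rewrite mulVf// pnatr_eq0 -lt0n.
- by move=> x t c'; exact: fixed_perm_local1.
- by move=> x y t c' _; exact: fixed_perm_local2.
- by rewrite mulr_ge0// stat_bound_ge0.
- exact: fixed_perm_variance_ge0.
Qed.

Lemma good_mean x : ~~ short_cycle (6 * L) s x -> Ex P (site_stat s x) = stat_mean.
Proof.
move=> nx; rewrite Ex_sum; last by move=> i _; apply: bmZ; exact: (bm_walk S).
apply: eq_bigr => i _; rewrite ExZ; last exact: (bm_walk S).
by rewrite (Ex_walk S nx)// /L leq_bigmax.
Qed.

(** By bilinearity the covariances of the statistics reduce to those of single walks, whose sum over
    all sites is universal at a good site. *)
Lemma good_cov x : ~~ short_cycle (6 * L) s x ->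
  \sum_(y in nb x) Ex P (fun w => centered x w * centered y w) = stat_cov.
Proof.
move=> nx.
transitivity (\sum_y Ex P (fun w => centered x w * centered y w)).
  rewrite [RHS](bigID (mem (nb x)))/= [X in _ = _ + X]big1 ?addr0// => y yx.
  exact: cov_off.
pose f i y w := walk s (xi^~ w) (ns i) y y.
have bf i y : bounded_measurable (f i y) by exact: (bm_walk S).
have E y : Ex P (fun w => centered x w * centered y w) =
    \sum_i \sum_j al i * al j *
      (Ex P (fun w => f i x w * f j y w) - Ex P (f i x) * Ex P (f j y)).
  have -> : Ex P (fun w => centered x w * centered y w) =
      Ex P (fun w => site_stat s x w * site_stat s y w) -
      Ex P (site_stat s x) * Ex P (site_stat s y).
    have b1 := bm_site_stat s x; have b2 := bm_site_stat s y.
    rewrite [LHS](_ : _ = Ex P (fun w => (site_stat s x w * site_stat s y w -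
      Ex P (site_stat s y) * site_stat s x w) -
      Ex P (site_stat s x) * centered y w)); last first.
      by apply: eq_Ex => w; rewrite /centered; ring.
    rewrite ExB; [|by apply: bmB; [exact: bmM|exact: bmZ]|by apply: bmZ; exact: bm_centered].
    rewrite ExB; [|exact: bmM|exact: bmZ].
    rewrite !ExZ//; last exact: bm_centered.
    by rewrite Ex_centered mulr0 subr0 mulrC.
  have S1 z : Ex P (site_stat s z) = \sum_i al i * Ex P (f i z).
    rewrite Ex_sum; last by move=> i _; apply: bmZ; exact: bf.
    by apply: eq_bigr => i _; rewrite ExZ//; exact: bf.
  rewrite !S1 big_distrlr/=.
  have bff i j : bounded_measurable (fun w => al i * al j * (f i x w * f j y w)).
    by apply: bmZ; exact: bmM.
  transitivity (Ex P (fun w => \sum_i \sum_j al i * al j * (f i x w * f j y w)) -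
    \sum_i \sum_j al i * Ex P (f i x) * (al j * Ex P (f j y))).
    congr (_ - _); apply: eq_Ex => w; rewrite /site_stat big_distrlr/=.
    by apply: eq_bigr => i _; apply: eq_bigr => j _; rewrite /f; ring.
  rewrite Ex_sum; last by move=> i _; exact: bm_sum.
  rewrite -sumrB; apply: eq_bigr => i _; rewrite Ex_sum// -sumrB.
  apply: eq_bigr => j _; rewrite ExZ; last exact: bmM.
  ring.
under eq_bigr do rewrite E.
rewrite exchange_big/=; apply: eq_bigr => i _.
rewrite exchange_big/=; apply: eq_bigr => j _.
rewrite -mulr_sumr; congr (_ * _); apply: (sum_cov_walk S nx); by rewrite /L leq_bigmax.
Qed.

(** Good sites have exactly the universal mean, so only the bad ones contribute. The variance is
    treated in the same way, with an additional division by N. *)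
Lemma fixed_perm_mean_error :
  `|\sum_x Ex P (site_stat s x) - N%:R * stat_mean| <= bad%:R * (B + `|stat_mean|).
Proof.
have -> : N%:R * stat_mean = \sum_(x < N) stat_mean.
  by rewrite sumr_const card_ord -[RHS]mulr_natl.
rewrite -sumrB (bigID (fun x => short_cycle (6 * L) s x))/= [X in _ + X]big1 ?addr0.
  rewrite (le_trans (ler_norm_sum _ _ _))// [leRHS]mulr_natl -sumr_const.
  rewrite (eq_bigl (fun x => x \in [set x | short_cycle (6 * L) s x]%SET)); last first.
    by move=> x; rewrite inE.
  apply: ler_sum => x _; rewrite (le_trans (ler_normB _ _))// lerD//.
  by apply: norm_Ex_le; [exact: bm_site_stat|exact: site_stat_le].
by move=> x /good_mean ->; rewrite subrr.
Qed.

Lemma fixed_perm_variance_error : (0 < N)%N ->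
  `|v - stat_cov| <= bad%:R / N%:R * (D%:R * (2 * B) ^+ 2 + `|stat_cov|).
Proof.
move=> N0; have N0' : (0 : R) < N%:R by rewrite ltr0n.
have -> : v - stat_cov = N%:R^-1 *
    \sum_x (\sum_(y in nb x) Ex P (fun w => centered x w * centered y w) - stat_cov).
  rewrite sumrB /local_variance scale_sqr sumr_const card_ord -[stat_cov *+ N]mulr_natl.
  by field; rewrite gt_eqF.
rewrite normrM gtr0_norm ?invr_gt0// [leRHS]mulrAC [leRHS]mulrC.
rewrite ler_wpM2l ?invr_ge0 ?(ltW N0')//.
rewrite (bigID (fun x => short_cycle (6 * L) s x))/= [X in _ + X]big1 ?addr0.
  rewrite (le_trans (ler_norm_sum _ _ _))// [leRHS]mulr_natl -sumr_const.
  rewrite (eq_bigl (fun x => x \in [set x | short_cycle (6 * L) s x]%SET)); last first.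
    by move=> x; rewrite inE.
  apply: ler_sum => x _; rewrite (le_trans (ler_normB _ _))// lerD//.
  exact: site_cov_le.
by move=> x /good_cov ->; rewrite subrr.
Qed.

End FixedPermutation.

(** * Averaging over the random permutation *)

Section RandomPermutation.
Variable V : T -> 'S_N.
Hypothesis mV : forall s, measurable (V @^-1` [set s]).
(** Uniformity of [V] and its independence of the potential in a single identity; conditioning on
    [V] then becomes a finite sum over indicators. *)
Hypothesis V_uniform : forall s f, on S [set: 'I_N] f ->
  Ex P (fun w => (V w == s)%:R * f w) = (N`!%:R)^-1 * Ex P f.

Definition perm_avg (f : 'S_N -> R) : R := (N`!%:R)^-1 * \sum_s f s.

Lemma perm_avg_cst a : perm_avg (fun=> a) = a.
Proof.
have f0 : N`!%:R != 0 :> R by rewrite pnatr_eq0 -lt0n fact_gt0.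
rewrite /perm_avg sumr_const -[a *+ _]mulr_natl.
have -> : #|{perm 'I_N}| = N`! by rewrite card_Sn.
by rewrite mulrA mulVf// mul1r.
Qed.

Lemma le_perm_avg f g : (forall s, f s <= g s) -> perm_avg f <= perm_avg g.
Proof. by move=> fg; rewrite ler_wpM2l// ler_sum. Qed.

Lemma perm_avgD f g : perm_avg (fun s => f s + g s) = perm_avg f + perm_avg g.
Proof. by rewrite /perm_avg big_split/= mulrDr. Qed.

Lemma perm_avgZ a f : perm_avg (fun s => a * f s) = a * perm_avg f.
Proof. by rewrite /perm_avg -mulr_sumr mulrCA. Qed.

Lemma norm_perm_avgB f a : `|perm_avg f - a| <= perm_avg (fun s => `|f s - a|).
Proof.
rewrite -[X in _ - X]perm_avg_cst /perm_avg -mulrBr -sumrB normrM ger0_norm//.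
by rewrite ler_wpM2l// ler_norm_sum.
Qed.

Lemma perm_indicator_bm s : bounded_measurable (fun w => (V w == s)%:R : R).
Proof.
apply: (eq_bm (g := \1_(V @^-1` [set s]))); last exact: bm_indic.
move=> w; rewrite indicE; congr ((nat_of_bool _)%:R).
by apply/eqP/idP => [E|]; rewrite inE.
Qed.

Lemma perm_split (h : 'S_N -> T -> R) w :
  h (V w) w = \sum_s (V w == s)%:R * h s w.
Proof.
rewrite (bigD1 (V w))//= eqxx mul1r big1 ?addr0// => s /negbTE.
by rewrite eq_sym => ->; rewrite mul0r.
Qed.

Lemma perm_bm (h : 'S_N -> T -> R) : (forall s, on S [set: 'I_N] (h s)) ->
  bounded_measurable (fun w => h (V w) w).
Proof.
move=> oh; apply: (eq_bm (perm_split h)); apply: bm_sum => s _.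
by apply: bmM; [exact: perm_indicator_bm|exact: on_bm (oh s)].
Qed.

Lemma Ex_perm (h : 'S_N -> T -> R) : (forall s, on S [set: 'I_N] (h s)) ->
  Ex P (fun w => h (V w) w) = perm_avg (fun s => Ex P (h s)).
Proof.
move=> oh; rewrite (eq_Ex P (perm_split h)) Ex_sum; last first.
  by move=> s _; apply: bmM; [exact: perm_indicator_bm|exact: on_bm (oh s)].
by rewrite /perm_avg mulr_sumr; apply: eq_bigr => s _; exact: V_uniform.
Qed.

Definition total_stat (w : T) : R := \sum_x site_stat (V w) x w.

Definition fluctuation (w : T) : R := scale * (total_stat w - Ex P total_stat).

Lemma site_sum_on s : on S [set: 'I_N] (fun w => \sum_x site_stat s x w).
Proof. by apply: on_sum => x _; apply: site_stat_on; exact: finset.subsetT. Qed.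

Local Notation bad s := #|[set x | short_cycle (6 * L) s x]%SET|.
Local Notation nb s := (ball_site s L.*2).
Local Notation W s := (part_sum (centered s) scale [set: 'I_N]).
Local Notation v s := (local_variance P (centered s) (nb s) scale).

(** The conditional mean of the fluctuation given V = s. It is the only part of the fluctuation
    through which the permutation moves the centre of the limit. *)
Definition mean_shift (s : 'S_N) : R :=
  scale * (\sum_x Ex P (site_stat s x) - Ex P total_stat).

Lemma fluctuation_fixed s w :
  scale * (\sum_x site_stat s x w - Ex P total_stat) = W s w + mean_shift s.
Proof.
rewrite /part_sum /mean_shift -mulrDr; congr (_ * _).
have -> : \sum_(z in [set: 'I_N]%SET) centered s z w =
    \sum_x site_stat s x w - \sum_x Ex P (site_stat s x).
  by rewrite -sumrB; apply: eq_bigl => x; rewrite inE.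
ring.
Qed.

Lemma Ex_total : Ex P total_stat = perm_avg (fun s => \sum_x Ex P (site_stat s x)).
Proof.
rewrite (Ex_perm (h := fun s w => \sum_x site_stat s x w)); last exact: site_sum_on.
congr perm_avg; apply/funext => s; rewrite Ex_sum// => x _.
exact: bm_site_stat.
Qed.

Hypotheses (N0 : (0 < N)%N) (NL : (2 * (6 * L) <= N)%N).

Lemma avg_bad : perm_avg (fun s => (bad s)%:R) <= (2 * (6 * L))%:R.
Proof.
have f0 : (0 : R) < N`!%:R by rewrite ltr0n fact_gt0.
rewrite /perm_avg ler_pdivrMl// -natr_sum -natrM ler_nat (mulnC N`!).
exact: sum_short_cycles.
Qed.

Lemma scale_le1 : scale <= 1.
Proof.
rewrite /scale invf_le1 ?sqrtr_gt0 ?ltr0n// -[leLHS]sqrtr1 ler_wsqrtr//.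
by rewrite ler1n.
Qed.

Lemma scale_sqr_le : N%:R^-1 <= scale.
Proof. by rewrite -scale_sqr expr2 -[leRHS]mulr1 ler_wpM2l ?scale_ge0// scale_le1. Qed.

(** Both the conditional and the total mean are compared with N times [stat_mean]. The total mean is
    the average of the conditional ones, which accounts for the second term. *)
Lemma mean_shift_le s : `|mean_shift s| <=
  scale * ((bad s)%:R * (B + `|stat_mean|) + (2 * (6 * L))%:R * (B + `|stat_mean|)).
Proof.
rewrite normrM ger0_norm ?scale_ge0// ler_wpM2l ?scale_ge0//.
set m := \sum_x _; rewrite (_ : m - _ = (m - N%:R * stat_mean) -
  (Ex P total_stat - N%:R * stat_mean)); last by ring.
rewrite (le_trans (ler_normB _ _))// lerD ?fixed_perm_mean_error//.
rewrite Ex_total (le_trans (norm_perm_avgB _ _))//.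
apply: (@le_trans _ _ (perm_avg (fun s => (B + `|stat_mean|) * (bad s)%:R))).
  by apply: le_perm_avg => s'; rewrite [leRHS]mulrC; exact: fixed_perm_mean_error.
rewrite perm_avgZ mulrC ler_wpM2r ?avg_bad//.
by rewrite addr_ge0 ?stat_bound_ge0.
Qed.

(** Three sources of error: the local central limit theorem, the variance at bad sites, and the mean
    at bad sites. The last enters twice, through the conditional mean and through the total one. *)
Definition clt_const : R := 4 * D%:R ^+ 2 * (2 * B) ^+ 3 +
  (2 * (6 * L))%:R * (D%:R * (2 * B) ^+ 2 + `|stat_cov|) +
  (2 * (2 * (6 * L)))%:R * (B + `|stat_mean|).

Lemma expR_lip (x y : R) : 0 <= x -> 0 <= y -> `|expR (- x) - expR (- y)| <= `|x - y|.
Proof.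
wlog yx : x y / y <= x => [H x0 y0|x0 y0].
  have [yx|/ltW xy] := leP y x; first exact: H.
  by rewrite distrC (distrC x); exact: H.
have e1 : expR (- x) <= expR (- y) by rewrite ler_expR lerN2.
rewrite distrC !ger0_norm ?subr_ge0//.
have -> : expR (- y) - expR (- x) = expR (- y) * (1 - expR (- (x - y))).
  by rewrite mulrBr mulr1 -expRD; congr (_ - expR _); ring.
rewrite -[leRHS]mul1r ler_pM ?expR_ge0//.
- by rewrite subr_ge0 -[leRHS]expR0 ler_expR oppr_le0 subr_ge0.
- by rewrite -[leRHS]expR0 ler_expR oppr_le0.
- by have := expR_ge1Dx (- (x - y)); lra.
Qed.

(** The variances at fixed permutations are nonnegative and on average within O(1/N) of [stat_cov].
    Letting N grow gives nonnegativity of the limiting variance. *)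
Lemma stat_cov_ge : - (N%:R^-1 * ((2 * (6 * L))%:R * (D%:R * (2 * B) ^+ 2 + `|stat_cov|)))
  <= stat_cov.
Proof.
set C := D%:R * (2 * B) ^+ 2 + `|stat_cov|.
have C0 : 0 <= C by rewrite addr_ge0// mulr_ge0// exprn_ge0// mulr_ge0// stat_bound_ge0.
rewrite -[leRHS]perm_avg_cst.
apply: (@le_trans _ _ (perm_avg (fun s => - (N%:R^-1 * C) * (bad s)%:R))).
  rewrite perm_avgZ mulNr lerN2 -mulrA ler_wpM2l ?invr_ge0// [leLHS]mulrC.
  by rewrite ler_wpM2r// avg_bad.
apply: le_perm_avg => s.
have := fixed_perm_variance_error s N0; rewrite -/C => /ler_normlW.
rewrite lerBlDr => H; have v0 := fixed_perm_variance_ge0 s.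
have {}H := le_trans v0 H; rewrite -lerBlDl sub0r in H.
rewrite mulNr; move: H; congr (_ <= _); congr (- _); ring.
Qed.

(* Conditionally on V = s, the mean and the variance differ from their universal values only
   through the points on short s-cycles, of which there are O(1) on average over s. *)
Theorem fluctuation_cos_error c : 0 <= stat_cov ->
  `|Ex P (fun w => cos (fluctuation w + c)) - expR (- stat_cov / 2) * cos c| <=
  scale * clt_const.
Proof.
move=> q0; pose h s w := cos (scale * (\sum_x site_stat s x w - Ex P total_stat) + c).
have oh s : on S [set: 'I_N] (h s).
  apply: on_cos; apply: onD; last exact: on_cst.
  apply: onM; first exact: on_cst.
  apply: onD; last exact: on_cst.
  exact: site_sum_on.
rewrite (Ex_perm oh) (le_trans (norm_perm_avgB _ _))//.
set C1 := 4 * D%:R ^+ 2 * (2 * B) ^+ 3.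
set C2 := D%:R * (2 * B) ^+ 2 + `|stat_cov|.
set C3 := B + `|stat_mean|.
have C2_ge0 : 0 <= C2.
  by rewrite addr_ge0// mulr_ge0// exprn_ge0// mulr_ge0// stat_bound_ge0.
have C3_ge0 : 0 <= C3 by rewrite addr_ge0// stat_bound_ge0.
have bs s : `|Ex P (h s) - expR (- stat_cov / 2) * cos c| <=
    scale * (C1 + (2 * (6 * L))%:R * C3) + scale * (C2 + C3) * (bad s)%:R.
  have mW : measurable_fun setT (W s) by case: (bm_W s).
  have bWc : bounded_measurable (fun w => cos (W s w + c)).
    by apply: bm_cos; exact: measurable_funD.
  have E1 : `|Ex P (h s) - Ex P (fun w => cos (W s w + c))| <= `|mean_shift s|.
    rewrite -ExB//; last exact: on_bm (oh s).
    apply: norm_Ex_le; first by apply: bmB => //; exact: on_bm (oh s).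
    move=> w; rewrite /h fluctuation_fixed (le_trans (cos_lip _ _))//.
    by rewrite (_ : _ - _ = mean_shift s)//; ring.
  have E2 := fixed_perm_clt s c.
  have E3 : `|expR (- v s / 2) * cos c - expR (- stat_cov / 2) * cos c| <=
      (bad s)%:R * scale * C2.
    rewrite -mulrBl normrM -[leRHS]mulr1 ler_pM// ?cos_max// !mulNr.
    rewrite (le_trans (expR_lip _ _))// ?divr_ge0 ?fixed_perm_variance_ge0//.
    rewrite -mulrBl normrM (@ger0_norm _ 2^-1)//.
    have := fixed_perm_variance_error s N0; rewrite -/C2 => H.
    apply: (@le_trans _ _ `|v s - stat_cov|).
      by rewrite ler_piMr// invf_le1// ler1n.
    (* The variance error is of order 1/N; 1/N <= [scale] brings it to the common order of
       magnitude. *)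
    rewrite (le_trans H)// ler_wpM2r// ler_wpM2l//; exact: scale_sqr_le.
  have E4 := mean_shift_le s.
  have -> : Ex P (h s) - expR (- stat_cov / 2) * cos c =
    (Ex P (h s) - Ex P (fun w => cos (W s w + c))) +
    ((Ex P (fun w => cos (W s w + c)) - expR (- v s / 2) * cos c) +
     (expR (- v s / 2) * cos c - expR (- stat_cov / 2) * cos c)) by ring.
  rewrite (le_trans (ler_normD _ _))//.
  rewrite (le_trans (lerD (le_trans E1 E4) (le_trans (ler_normD _ _) (lerD E2 E3))))//.
  rewrite le_eqVlt; apply/orP; left; apply/eqP; rewrite /C1 /C3; ring.
rewrite (le_trans (le_perm_avg bs))// perm_avgD perm_avg_cst perm_avgZ.
apply: (@le_trans _ _ (scale * (C1 + (2 * (6 * L))%:R * C3) +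
  scale * (C2 + C3) * (2 * (6 * L))%:R)).
  by rewrite lerD2l ler_wpM2l ?avg_bad// mulr_ge0 ?scale_ge0// addr_ge0.
rewrite le_eqVlt; apply/orP; left; apply/eqP.
rewrite /clt_const -/C1 -/C2 -/C3 (natrM _ 2 (2 * (6 * L))); ring.
Qed.

(** A first-moment bound uniform in N, which gives tightness by Markov's inequality. It follows from
    |W| <= 1 + W^2 and the bounds on the variance and on the mean shift. *)
Lemma Ex_fluctuation_le : Ex P (fun w => `|fluctuation w|) <=
  1 + D%:R * (2 * B) ^+ 2 + (2 * (2 * (6 * L)))%:R * (B + `|stat_mean|).
Proof.
set C3 := B + `|stat_mean|; set C4 := D%:R * (2 * B) ^+ 2.
have C3_ge0 : 0 <= C3 by rewrite addr_ge0// stat_bound_ge0.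
pose h s w := `|scale * (\sum_x site_stat s x w - Ex P total_stat)|.
have oh s : on S [set: 'I_N] (h s).
  apply: on_norm; apply: onM; first exact: on_cst.
  apply: onD; last exact: on_cst.
  exact: site_sum_on.
rewrite (Ex_perm oh).
have hs s : Ex P (h s) <= 1 + C4 + ((bad s)%:R * C3 + (2 * (6 * L))%:R * C3).
  have bW2 : bounded_measurable (fun w => W s w ^+ 2) by apply: bmX; exact: bm_W.
  apply: (@le_trans _ _ (Ex P (fun w => 1 + W s w ^+ 2 + `|mean_shift s|))).
    apply: le_Ex; first exact: on_bm (oh s).
      by apply: bmD; [apply: bmD => //; exact: bm_cst|exact: bm_cst].
    move=> w; rewrite /h fluctuation_fixed (le_trans (ler_normD _ _))// lerD2r.
    have := sqr_ge0 (W s w); have := sqr_ge0 (`|W s w| - 1).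
    by rewrite sqrrB real_normK ?num_real//; lra.
  rewrite ExD; [|by apply: bmD => //; exact: bm_cst|exact: bm_cst].
  rewrite ExD//; last exact: bm_cst.
  rewrite !Ex_cst -fixed_perm_variance_sqr.
  apply: lerD; first by rewrite lerD2l fixed_perm_variance_le.
  apply: le_trans (mean_shift_le s) _; rewrite -[leRHS]mul1r ler_wpM2r ?scale_le1//.
  by rewrite addr_ge0// mulr_ge0.
rewrite (le_trans (le_perm_avg hs))// perm_avgD perm_avg_cst perm_avgD perm_avg_cst.
have -> : (2 * (2 * (6 * L)))%:R * C3 = (2 * (6 * L))%:R * C3 + (2 * (6 * L))%:R * C3.
  by rewrite (natrM _ 2 (2 * (6 * L))); ring.
rewrite lerD2l lerD2r (_ : (fun s => _) = fun s => C3 * (bad s)%:R).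
  by rewrite perm_avgZ mulrC ler_wpM2r// avg_bad.
by apply/funext => s; rewrite mulrC.
Qed.

End RandomPermutation.

End LinearStatistic.

(** * The wreath product model *)

Section Components.
Context {R : realType} {m r2 t : nat} {q : 'I_t -> nat}.

Definition component : finType := ('I_m + 'I_r2 + 'I_t)%type.

Definition clip (b y : R) : R := Num.max (- b) (Num.min b y).

Definition component_bound (c : component) : R :=
  match c with inl (inr _) => 1 | _ => 2 end.

(* The contribution of D_j + D_j^*, Delta_j + Delta_j^* or D'_r to the diagonal of X_N;
   clipping changes it on a null set only. *)
Definition component_value (c : component) (z : R * R) : R :=
  match c with
  | inl (inr _) => clip 1 z.1
  | _ => clip 2 (2 * z.1)
  end.

Definition component_law (c : component) : set (R * R) -> \bar R :=
  match c with
  | inl (inl _) => uniform_circle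
  | inl (inr _) => uniform_seq [:: 1; -1]
  | inr j => uniform_seq (unity_roots (q j))
  end.

Definition total_bound : R := \sum_(c : component) component_bound c.

Lemma total_boundE : total_bound = (2 * m + 2 * t + r2)%:R.
Proof.
rewrite /total_bound big_sumType/= big_sumType/= !sumr_const !card_ord.
rewrite (natrD _ (2 * m + 2 * t)) (natrD _ (2 * m)) (natrM _ 2 m) (natrM _ 2 t).
by rewrite -(mulr_natr 2 m) -(mulr_natr 2 t); ring.
Qed.

Lemma clip_le b y : 0 <= b -> `|clip b y| <= b.
Proof.
move=> b0; rewrite ler_norml /clip le_max lexx/= ge_max ge_min lexx andbT.
lra.
Qed.

Lemma clip_id b y : `|y| <= b -> clip b y = y.
Proof.
rewrite ler_norml => /andP[y1 y2]; rewrite /clip (min_idPr y2).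
exact/max_idPr.
Qed.

Lemma measurable_clip b : measurable_fun setT (clip b).
Proof. by apply: measurable_maxr => //; apply: measurable_minr => //; exact: measurable_id. Qed.

Lemma component_value_le c z : `|component_value c z| <= component_bound c.
Proof. by case: c => [[?|?]|?] /=; apply: clip_le. Qed.

Lemma component_value_bm c : bounded_measurable (component_value c).
Proof.
split; last by exists (component_bound c); exact: component_value_le.
case: c => [[?|?]|?] /=; apply: measurableT_comp => //; try exact: measurable_clip.
- by apply: measurable_funM => //; exact: measurable_fst.
- by apply: measurable_funM => //; exact: measurable_fst.
Qed.

Section Model.
Context {N : nat} {d} {T : measurableType d} {P : probability T R}.
Variable M : wreath_model m r2 q N P.

Definition entry (c : component) (k : 'I_N) : T -> R[i] :=
  match c with
  | inl (inl j) => DN M j k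
  | inl (inr r) => D'N M r k
  | inr j => DeltaN M j k
  end.

Lemma entry_law c k : has_law P (entry c k) (component_law c).
Proof.
case: c => [[j|r]|j] /=; [exact: uniform_DN|exact: uniform_D'N|exact: uniform_DeltaN].
Qed.

Definition entry_index (c : component) (k : 'I_N) :
    option ('I_m * 'I_N + 'I_r2 * 'I_N + 'I_t * 'I_N)%type :=
  match c with
  | inl (inl j) => Some (inl (inl (j, k)))
  | inl (inr r) => Some (inl (inr (r, k)))
  | inr j => Some (inr (j, k))
  end.

(** Repeats the family of [independent_entries] literally, so that independence holds by conversion,
    while [entry] treats the three kinds of diagonal matrices uniformly. *)
Definition index_sigma (i : option ('I_m * 'I_N + 'I_r2 * 'I_N + 'I_t * 'I_N)%type) :
    set (set T) :=
  match i with
  | None => sigma_discrete (VN M)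
  | Some (inl (inl (j, k))) => sigma_complex (DN M j k)
  | Some (inl (inr (r, k))) => sigma_complex (D'N M r k)
  | Some (inr (j, k)) => sigma_complex (DeltaN M j k)
  end.

Lemma index_sigma_entry c k : index_sigma (entry_index c k) = sigma_complex (entry c k).
Proof. by case: c => [[]|]. Qed.

Lemma index_sigma_cases (Q : set (set T) -> Prop) :
  Q (sigma_discrete (VN M)) -> (forall c k, Q (sigma_complex (entry c k))) ->
  forall i, Q (index_sigma i).
Proof.
move=> Q0 Qc [[[[j k]|[r k]]|[j k]]|]//=.
- exact: (Qc (inl (inl j)) k).
- exact: (Qc (inl (inr r)) k).
- exact: (Qc (inr j) k).
Qed.

Lemma measurable_VN_preimage A : measurable (VN M @^-1` A).
Proof.
have -> : VN M @^-1` A = \bigcup_(s in A) (VN M @^-1` [set s]).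
  apply/seteqP; split=> [w Aw|w [s As /= E]].
    by exists (VN M w).
  by rewrite /preimage/= E.
apply: fin_bigcup_measurable; first exact: finite_finset.
by move=> s _; exact: measurable_VN.
Qed.

Lemma index_sigma_measurable i : index_sigma i `<=` measurable.
Proof.
apply: (index_sigma_cases (Q := fun G => G `<=` measurable)) => [|c k] _ [A mA <-];
  rewrite setTI.
  exact: measurable_VN_preimage.
by rewrite -[X in measurable X]setTI; case: (entry_law c k) => + _; apply.
Qed.

Lemma index_sigmaT i : index_sigma i setT.
Proof.
by apply: (index_sigma_cases (Q := fun G => G setT)) => [|c k]; exists setT; rewrite ?setTI.
Qed.

Lemma index_sigmaI i : setI_closed (index_sigma i).
Proof.
apply: (index_sigma_cases (Q := @setI_closed T)) => [|c k] _ _ [A mA <-] [B mB <-];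
  exists (A `&` B).
- by [].
- by rewrite !setTI preimage_setI.
- exact: measurableI.
- by rewrite !setTI preimage_setI.
Qed.

Lemma index_sigma_indep : mutually_independent P index_sigma.
Proof. exact: independent_entries. Qed.

Definition potential (k : 'I_N) (w : T) : R :=
  \sum_(c : component) component_value c (re_im (entry c k w)).

(** All entries at the sites of [A]. The index [None] of the permutation is left out, which makes
    the potential independent of [VN]. *)
Definition site_index (A : {set 'I_N}) :
    {set option ('I_m * 'I_N + 'I_r2 * 'I_N + 'I_t * 'I_N)%type} :=
  [set i | match i with
           | None => false
           | Some (inl (inl (_, k))) => k \in A
           | Some (inl (inr (_, k))) => k \in A
           | Some (inr (_, k)) => k \in A
           end]%SET.

Lemma entry_index_in c k A : (entry_index c k \in site_index A) = (k \in A).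
Proof. by case: c => [[]|] ?; rewrite inE. Qed.

Local Notation bm_on := (bm_on index_sigma).

Lemma component_on (J : {set option ('I_m * 'I_N + 'I_r2 * 'I_N + 'I_t * 'I_N)%type}) c k :
  entry_index c k \in J ->
  bm_on J (fun w => component_value c (re_im (entry c k w))).
Proof.
move=> cJ.
apply: (bm_on_preimage index_sigmaT (X := re_im \o entry c k) (f := component_value c) cJ).
  by rewrite index_sigma_entry.
exact: component_value_bm.
Qed.

Lemma ExM_index (J1 J2 : {set option ('I_m * 'I_N + 'I_r2 * 'I_N + 'I_t * 'I_N)%type}) f g :
  [disjoint J1 & J2]%B -> bm_on J1 f -> bm_on J2 g ->
  Ex P (fun w => f w * g w) = Ex P f * Ex P g.
Proof.
apply: ExM_disjoint; [exact: index_sigma_measurable|exact: index_sigmaT|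
  exact: index_sigmaI|exact: index_sigma_indep].
Qed.

Lemma potential_le k w : `|potential k w| <= total_bound.
Proof.
rewrite (le_trans (ler_norm_sum _ _ _))//; apply: ler_sum => c _.
exact: component_value_le.
Qed.

Lemma VN_uniform (s : 'S_N) f : bm_on (site_index [set: 'I_N]) f ->
  Ex P (fun w => (VN M w == s)%:R * f w) = (N`!%:R)^-1 * Ex P f.
Proof.
move=> of_; have E : (fun w => (VN M w == s)%:R : R) = \1_(VN M @^-1` [set s]).
  apply/funext => w; rewrite indicE; congr ((nat_of_bool _)%:R).
  by apply/eqP/idP => [E|]; rewrite inE.
rewrite (ExM_index (J1 := [set None]%SET) (J2 := site_index [set: 'I_N])) //.
- congr (_ * _); rewrite E /Ex /Rintegral integral_indic ?setIT//; last exact: measurable_VN.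
  by rewrite [X in fine X](uniform_VN M s)/= card_Sn.
- by rewrite disjoints1 inE.
- rewrite E; split.
    apply: measurable_indic; apply: sub_sigma_algebra.
    apply: (cylinders1 index_sigmaT (i := None)); first by rewrite inE.
    by exists [set s] => //; rewrite setTI.
  exists 1 => w; rewrite indicE normr_nat.
  by case: (_ \in _); rewrite ?ler01 ?lexx.
Qed.

End Model.

Lemma Ex_component (N1 N2 : nat) d1 (T1 : measurableType d1) (P1 : probability T1 R)
    d2 (T2 : measurableType d2) (P2 : probability T2 R)
    (M1 : wreath_model m r2 q N1 P1) (M2 : wreath_model m r2 q N2 P2) c k1 k2 n :
  Ex P1 (fun w => component_value c (re_im (entry M1 c k1 w)) ^+ n) =
  Ex P2 (fun w => component_value c (re_im (entry M2 c k2 w)) ^+ n).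
Proof.
have [m1 l1] := entry_law M1 c k1; have [m2 l2] := entry_law M2 c k2.
have b := bmX n (component_value_bm c).
rewrite -(Ex_law P1 m1 b) -(Ex_law P2 m2 b); apply: eq_measure_Ex => A mA.
exact: etrans (l1 _ mA) (esym (l2 _ mA)).
Qed.

(** The moments of the potential are universal: induction on the components, with the binomial
    formula and the independence of the components at a site. This gives a single sequence of
    moments for all N and all sites. *)
Lemma Ex_potential (N1 N2 : nat) d1 (T1 : measurableType d1) (P1 : probability T1 R)
    d2 (T2 : measurableType d2) (P2 : probability T2 R)
    (M1 : wreath_model m r2 q N1 P1) (M2 : wreath_model m r2 q N2 P2) k1 k2 n :
  Ex P1 (fun w => potential M1 k1 w ^+ n) = Ex P2 (fun w => potential M2 k2 w ^+ n).
Proof.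
rewrite /potential; elim: (index_enum component) (index_enum_uniq component) n => [|c r ih] /=.
  move=> _ n; under eq_Ex do rewrite big_nil.
  by under [RHS]eq_Ex do rewrite big_nil; rewrite !Ex_cst.
move=> /andP[cr ur] n.
(* The recursion is stated for an arbitrary model, since it is used on both sides. *)
have H N0 d0 (T0 : measurableType d0) (P0 : probability T0 R)
    (M0 : wreath_model m r2 q N0 P0) k0 :
  Ex P0 (fun w => (\sum_(c <- c :: r) component_value c (re_im (entry M0 c k0 w))) ^+ n) =
  \sum_(i < n.+1) 'C(n, i)%:R *
    (Ex P0 (fun w => component_value c (re_im (entry M0 c k0 w)) ^+ (n - i)) *
     Ex P0 (fun w => (\sum_(c <- r) component_value c (re_im (entry M0 c k0 w))) ^+ i)).
  pose J := [set i | i \in map (fun c => entry_index c k0) r]%SET.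
  have einj : injective (fun c => entry_index c k0).
    by move=> [[a|a]|a] [[b|b]|b] //= [->].
  have b1 i : bm_on (index_sigma M0) [set entry_index c k0]%SET
      (fun w => component_value c (re_im (entry M0 c k0 w)) ^+ i).
    by apply: bmX; apply: component_on; rewrite inE.
  have b2 i : bm_on (index_sigma M0) J
      (fun w => (\sum_(c <- r) component_value c (re_im (entry M0 c k0 w))) ^+ i).
    apply: bmX; rewrite (_ : (fun w => _) = fun w => \sum_(c <- r | c \in r)
        component_value c (re_im (entry M0 c k0 w))).
      by apply: bm_sum => c' c'r; apply: component_on; rewrite inE;
        exact: (map_f (fun c => entry_index c k0)).
    by apply/funext => w; rewrite big_seq.
  have bE A i := bm_on_bm (@index_sigma_measurable _ _ _ _ M0) (J := A) (f := i).
  rewrite (_ : (fun w => _) = fun w => \sum_(i < n.+1) 'C(n, i)%:R *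
      (component_value c (re_im (entry M0 c k0 w)) ^+ (n - i) *
       (\sum_(c <- r) component_value c (re_im (entry M0 c k0 w))) ^+ i)).
    rewrite Ex_sum; last first.
      by move=> i _; apply: bmZ; apply: bmM; [exact: bE (b1 _)|exact: bE (b2 _)].
    apply: eq_bigr => i _; rewrite ExZ; last first.
      by apply: bmM; [exact: bE (b1 _)|exact: bE (b2 _)].
    congr (_ * _); apply: ExM_index (b1 _) (b2 _).
    by rewrite disjoints1 inE (mem_map einj).
  apply/funext => w; rewrite big_cons exprDn; apply: eq_bigr => i _.
  by rewrite mulr_natl.
rewrite !H; apply: eq_bigr => i _; congr (_ * (_ * _)); first exact: Ex_component.
exact: ih.
Qed.

Section Reduction.
Context {N : nat} {d} {T : measurableType d} {P : probability T R}.
Variable M : wreath_model m r2 q N P.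

Local Notation bm_on := (bm_on (index_sigma M)).

Lemma site_index_disjoint (A B : {set 'I_N}) : [disjoint A & B]%B ->
  [disjoint (site_index A : {set option ('I_m * 'I_N + 'I_r2 * 'I_N + 'I_t * 'I_N)%type})
   & site_index B]%B.
Proof.
rewrite -!finset.setI_eq0 => /eqP AB; apply/eqP/finset.setP => i; rewrite !inE.
have H k : (k \in A) && (k \in B) = false.
  by have := finset.in_setI k A B; rewrite AB inE.
by case: i => [[[[j k]|[r k]]|[j k]]|]//=.
Qed.

Lemma site_index_sub (A B : {set 'I_N}) : A \subset B ->
  (site_index A : {set option ('I_m * 'I_N + 'I_r2 * 'I_N + 'I_t * 'I_N)%type})
   \subset site_index B.
Proof.
move=> /fintype.subsetP AB; apply/fintype.subsetP => i; rewrite !inE.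
by case: i => [[[[j k]|[r k]]|[j k]]|]//=; exact: AB.
Qed.

Lemma potential_on k : bm_on (site_index [set k]%SET) (potential M k).
Proof.
by apply: bm_sum => c _; apply: component_on; rewrite entry_index_in inE.
Qed.

(** Kept transparent: [on] has to unfold to [bm_on] when [VN_uniform] is used as the hypothesis on
    the permutation. *)
Definition wreath_site_model (mu : nat -> R)
    (hmu : forall k j, Ex P (fun w => potential M k w ^+ j) = mu j) :
  site_model P (potential M) total_bound mu.
Proof.
refine (@SiteModel R N d T P (potential M) total_bound mu
  (fun A f => bm_on (site_index A) f) _ _ _ _ _ _ _ _ _ _ hmu (potential_le M)).
- by move=> A f; apply: bm_on_bm; exact: index_sigma_measurable.
- by move=> A B f AB; apply: bm_on_sub; [exact: index_sigmaT|exact: site_index_sub].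
- by move=> A a; exact: bm_cst.
- by move=> A f g; exact: bmD.
- by move=> A f g; exact: bmM.
- by move=> A f [mf _]; exact: bm_cos.
- by move=> A f [mf _]; exact: bm_sin.
- by move=> A f; exact: bm_norm.
- exact: potential_on.
- by move=> A B f g AB; apply: ExM_index; exact: site_index_disjoint.
Defined.

Definition norm_const : R := (2 + total_bound)^-1.

(** A surrogate for [trace_power] that is bounded everywhere and agrees with it as soon as the
    entries are regular. *)
Definition trace_stat (n : nat) (w : T) : R :=
  norm_const ^+ n * \sum_x walk (VN M w) ((potential M)^~ w) n x x.

(** [trace_power] is a function of complex entries that are real only almost surely, so its
    measurability is established through real and imaginary parts. *)
Definition complex_measurable (f : T -> R[i]) : Prop :=
  measurable_fun setT (fun w => complex.Re (f w)) /\
  measurable_fun setT (fun w => complex.Im (f w)).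

Lemma cmeas_cst a : complex_measurable (fun=> a).
Proof. by split; exact: measurable_cst. Qed.

Lemma cmeas_real (f : T -> R) : measurable_fun setT f ->
  complex_measurable (fun w => (f w)%:C%C).
Proof. by move=> mf; split. Qed.

Lemma cmeasD f g : complex_measurable f -> complex_measurable g ->
  complex_measurable (fun w => f w + g w).
Proof.
move=> [f1 f2] [g1 g2]; split.
  rewrite (_ : (fun w => _) = fun w => complex.Re (f w) + complex.Re (g w)).
    exact: measurable_funD.
  by apply/funext => w; case: (f w) (g w) => [? ?] [].
rewrite (_ : (fun w => _) = fun w => complex.Im (f w) + complex.Im (g w)).
  exact: measurable_funD.
by apply/funext => w; case: (f w) (g w) => [? ?] [].
Qed.

Lemma cmeasM f g : complex_measurable f -> complex_measurable g ->
  complex_measurable (fun w => f w * g w).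
Proof.
move=> [f1 f2] [g1 g2]; split.
  rewrite (_ : (fun w => _) = fun w => complex.Re (f w) * complex.Re (g w) -
      complex.Im (f w) * complex.Im (g w)).
    by apply: measurable_funB; exact: measurable_funM.
  by apply/funext => w; case: (f w) (g w) => [? ?] [].
rewrite (_ : (fun w => _) = fun w => complex.Re (f w) * complex.Im (g w) +
    complex.Im (f w) * complex.Re (g w)).
  by apply: measurable_funD; exact: measurable_funM.
by apply/funext => w; case: (f w) (g w) => [? ?] [].
Qed.

Lemma cmeas_conj f : complex_measurable f -> complex_measurable (fun w => (f w)^*).
Proof.
move=> [f1 f2]; split.
  rewrite (_ : (fun w => _) = fun w => complex.Re (f w))//.
  by apply/funext => w; case: (f w).
rewrite (_ : (fun w => _) = fun w => - complex.Im (f w)); first exact: measurableT_comp.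
by apply/funext => w; case: (f w).
Qed.

Lemma cmeas_sum (I : Type) (r : seq I) (F : I -> T -> R[i]) :
  (forall i, complex_measurable (F i)) ->
  complex_measurable (fun w => \sum_(i <- r) F i w).
Proof.
move=> mF; elim: r => [|i r ih].
  rewrite (_ : (fun w => _) = fun=> 0); first exact: cmeas_cst.
  by apply/funext => w; rewrite big_nil.
rewrite (_ : (fun w => _) = fun w => F i w + \sum_(j <- r) F j w).
  exact: cmeasD.
by apply/funext => w; rewrite big_cons.
Qed.

Lemma cmeas_entry c k : complex_measurable (entry M c k).
Proof.
have [mz _] := entry_law M c k; split.
- exact: (measurableT_comp (f := fst) measurable_fst mz).
- exact: (measurableT_comp (f := snd) measurable_snd mz).
Qed.

Lemma diag_entry (D : 'I_N -> T -> R[i]) w x y :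
  diag_of D w x y = D x w *+ (x == y).
Proof. by rewrite /diag_of !mxE. Qed.

Lemma conj_mxE (A : 'M[R[i]]_N) x y : (A ^t*)%sesqui x y = (A y x)^*.
Proof. by rewrite !mxE. Qed.

Lemma X_mx_entry w x y : X_mx M w x y =
  ((2 + 2 * m + 2 * t + r2)%N%:R)^-1 *
    ((VN M w x == y)%:R + (VN M w y == x)%:R +
     \sum_(j < m) (DN M j x w + (DN M j x w)^*) *+ (x == y) +
     \sum_(j < t) (DeltaN M j x w + (DeltaN M j x w)^*) *+ (x == y) +
     \sum_(r < r2) D'N M r x w *+ (x == y)).
Proof.
rewrite /X_mx mxE; congr (_ * _).
have E1 (D : 'I_N -> T -> R[i]) :
    (diag_of D w + ((diag_of D w) ^t*)%sesqui) x y = (D x w + (D x w)^*) *+ (x == y).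
  rewrite mxE conj_mxE !diag_entry eq_sym.
  by case: eqP => [->|_]; rewrite ?mulr1n// !mulr0n conjC0 addr0.
rewrite !mxE !summxE.
congr (_ + _ + _ + _ + _).
- by case: eqP => _; rewrite ?conjC1 ?conjC0.
- by apply: eq_bigr => j _; rewrite E1.
- by apply: eq_bigr => j _; rewrite E1.
- by apply: eq_bigr => j _; rewrite diag_entry.
Qed.

Lemma cmeas_VN x y : complex_measurable (fun w => (VN M w x == y)%:R).
Proof.
rewrite (_ : (fun w => _) = fun w => (\1_(VN M @^-1` [set s | s x = y]) w)%:C%C).
  by apply: cmeas_real; apply: measurable_indic; exact: measurable_VN_preimage.
apply/funext => w; rewrite indicE rmorph_nat; congr ((nat_of_bool _)%:R).
by apply/eqP/idP => [E|]; rewrite inE.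
Qed.

Lemma cmeas_X x y : complex_measurable (fun w => X_mx M w x y).
Proof.
rewrite (funext (fun w => X_mx_entry w x y)).
have mulb (f : T -> R[i]) : complex_measurable f -> complex_measurable (fun w => f w *+ (x == y)).
  by case: (x == y) => // _; exact: cmeas_cst.
apply: cmeasM; first exact: cmeas_cst.
apply: cmeasD; [apply: cmeasD; [apply: cmeasD; [apply: cmeasD|]|]|].
- exact: cmeas_VN.
- exact: cmeas_VN.
- apply: cmeas_sum => j; apply: mulb; apply: cmeasD; last apply: cmeas_conj;
  exact: (cmeas_entry (inl (inl j))).
- apply: cmeas_sum => j; apply: mulb; apply: cmeasD; last apply: cmeas_conj;
  exact: (cmeas_entry (inr j)).
- by apply: cmeas_sum => j; apply: mulb; exact: (cmeas_entry (inl (inr j))).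
Qed.

Lemma cmeas_X_power n x y : complex_measurable (fun w => (X_mx M w ^+ n) x y).
Proof.
elim: n x y => [|n ih] x y.
  rewrite (_ : (fun w => _) = fun=> (x == y)%:R); first exact: cmeas_cst.
  by apply/funext => w; rewrite expr0 mxE.
rewrite (_ : (fun w => _) = fun w => \sum_z X_mx M w x z * (X_mx M w ^+ n) z y).
  by apply: cmeas_sum => z; apply: cmeasM; [exact: cmeas_X|exact: ih].
by apply/funext => w; rewrite exprS mxE.
Qed.

Lemma measurable_trace_power n : measurable_fun setT (trace_power M n).
Proof. by case: (cmeas_sum (index_enum 'I_N) (fun x => cmeas_X_power n x x)). Qed.

(** The almost sure event on which clipping is inactive and the D'_r are real. *)
Definition regular_entries (w : T) : Prop := forall c k,
  `|complex.Re (entry M c k w)| <= 1 /\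
  (if c is inl (inr _) then complex.Im (entry M c k w) = 0 else True).

Lemma norm_constE : norm_const = ((2 + 2 * m + 2 * t + r2)%N%:R)^-1.
Proof.
rewrite /norm_const total_boundE -(natrD _ 2); congr (_%:R^-1).
Qed.

Lemma potentialE w x : regular_entries w ->
  potential M x w = \sum_(j < m) 2 * complex.Re (DN M j x w) +
    \sum_(r < r2) complex.Re (D'N M r x w) +
    \sum_(j < t) 2 * complex.Re (DeltaN M j x w).
Proof.
move=> rw; rewrite /potential big_sumType/= big_sumType/=.
have two (y : R) : `|y| <= 1 -> `|2 * y| <= 2.
  by move=> y1; rewrite normrM ger0_norm// -[leRHS]mulr1 ler_wpM2l.
congr (_ + _ + _); apply: eq_bigr => j _.
- by rewrite clip_id//; apply: two; case: (rw (inl (inl j)) x).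
- by rewrite clip_id//; case: (rw (inl (inr j)) x).
- by rewrite clip_id//; apply: two; case: (rw (inr j) x).
Qed.

Lemma X_mx_real w x y : regular_entries w -> X_mx M w x y =
  (norm_const * ((VN M w x == y)%:R + (VN M w y == x)%:R +
    (x == y)%:R * potential M x w))%:C%C.
Proof.
move=> rw; rewrite X_mx_entry norm_constE (potentialE x rw).
have conj2 (z : R[i]) : z + z^* = (2 * complex.Re z)%:C%C.
  by case: z => a b; apply/eqP; rewrite eq_complex/= subrr eqxx andbT mulr_natl mulr2n.
rewrite rmorphM fmorphV rmorph_nat; congr (_ * _).
rewrite !rmorphD !rmorphM !rmorphD !rmorph_sum !rmorph_nat -!addrA; congr (_ + (_ + _)).
under eq_bigr do rewrite conj2.
under [X in _ + (X + _)]eq_bigr do rewrite conj2.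
have DR j : D'N M j x w = (complex.Re (D'N M j x w))%:C%C.
  have [_ /= im0] := rw (inl (inr j)) x.
  by apply/eqP; rewrite eq_complex/= im0 !eqxx.
under [X in _ + (_ + X)]eq_bigr do rewrite DR.
rewrite !sumrMnl; case: (x == y); rewrite ?mul1r ?mul0r ?mulr1n ?mulr0n ?addr0//.
by congr (_ + _); rewrite addrC.
Qed.

Lemma X_mx_power_real w n x y : regular_entries w ->
  (X_mx M w ^+ n) x y = (norm_const ^+ n * walk (VN M w) ((potential M)^~ w) n x y)%:C%C.
Proof.
move=> rw; elim: n x y => [|n ih] x y.
  by rewrite !expr0 mxE/= mul1r rmorph_nat.
rewrite exprS [LHS]mxE.
under eq_bigr do rewrite X_mx_real// ih -rmorphM/=.
rewrite -rmorph_sum; congr (_%:C%C) => /=.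
set f := fun z => walk (VN M w) ((potential M)^~ w) n z y.
have sel (z0 : 'I_N) (g : 'I_N -> R) : \sum_z (z0 == z)%:R * g z = g z0.
  rewrite (bigD1 z0)//= eqxx mul1r big1 ?addr0// => z /negbTE.
  by rewrite eq_sym => ->; rewrite mul0r.
transitivity (norm_const ^+ n.+1 * \sum_z ((VN M w x == z)%:R * f z +
    ((VN M w)^-1%g x == z)%:R * f z + (x == z)%:R * (potential M x w * f z))).
  rewrite mulr_sumr; apply: eq_bigr => z _.
  have -> : (VN M w z == x) = ((VN M w)^-1%g x == z).
    by apply/eqP/eqP => [<-|<-]; rewrite ?permK ?permKV.
  by rewrite exprS /f; ring.
by rewrite !big_split/= !sel.
Qed.

Lemma trace_power_regular w n : regular_entries w -> trace_power M n w = trace_stat n w.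
Proof.
move=> rw; rewrite /trace_power /mxtrace /trace_stat.
under eq_bigr do rewrite X_mx_power_real//.
by rewrite -rmorph_sum/= mulr_sumr.
Qed.

Definition regular_set (c : component) : set (R * R) :=
  [set z | `|z.1| <= 1 /\ (if c is inl (inr _) then z.2 = 0 else True)].

Lemma measurable_regular_set c : measurable (regular_set c).
Proof.
have m1 : measurable [set z : R * R | `|z.1| <= 1].
  rewrite -[X in measurable X]setTI.
  apply: (@measurable_fun_ler _ _ _ _ (fun z : R * R => `|z.1|) (cst 1)) => //.
  by apply: measurableT_comp => //; exact: measurable_fst.
case: c => [[j|r]|j].
- by rewrite (_ : regular_set _ = [set z : R * R | `|z.1| <= 1])//; apply/seteqP; split => z [].
- rewrite (_ : regular_set _ = [set z : R * R | `|z.1| <= 1] `&` snd @^-1` [set 0]).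
    apply: measurableI => //; rewrite -[X in measurable X]setTI.
    by apply: measurable_snd.
  by apply/seteqP; split => z [].
- by rewrite (_ : regular_set _ = [set z : R * R | `|z.1| <= 1])//; apply/seteqP; split => z [].
Qed.

Lemma uniform_seq1 (s : seq R[i]) (A : set (R * R)) : (0 < size s)%N ->
  (forall z, z \in s -> A (re_im z)) -> uniform_seq s A = 1%E.
Proof.
move=> s0 sA; rewrite /uniform_seq (eq_big_seq (fun=> 1%E)); last first.
  by move=> z zs; rewrite diracE mem_set//; exact: sA.
have -> : (\sum_(z <- s) 1 = (size s)%:R%:E :> \bar R)%E.
  elim: s {s0 sA} => [|z s ih]; first by rewrite big_nil.
  by rewrite big_cons ih -EFinD -natr1 addrC.
by rewrite -EFinM mulVf// pnatr_eq0 -lt0n.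
Qed.

Hypothesis hq : forall j : 'I_t, (3 <= q j)%N.

Lemma component_law_regular c : component_law c (regular_set c) = 1%E.
Proof.
case: c => [[j|r]|j] /=.
- rewrite /uniform_circle (_ : [set u | _] = setT).
    exact: (@probability_setT _ _ _ (uniform_prob (@ltr01 R))).
  by apply/seteqP; split => // u _; split => //=; exact: cos_max.
- apply: uniform_seq1 => // z; rewrite !inE => /orP[] /eqP ->; split => //=;
    by rewrite ?normrN ?normr1 ?oppr0.
- apply: uniform_seq1.
    by rewrite size_map size_iota (leq_trans _ (hq j)).
  by move=> z /mapP[k _ ->]; split => //=; exact: cos_max.
Qed.

Lemma ae_regular : {ae P, forall w, regular_entries w}.
Proof.
apply: filter_forall => c; apply: filter_forall => k.
have [me le_] := entry_law M c k.
have mA := measurable_regular_set c.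
have PA : P ((re_im \o entry M c k) @^-1` regular_set c) = 1%E.
  by rewrite le_// component_law_regular.
have mB : measurable ((re_im \o entry M c k) @^-1` regular_set c).
  by rewrite -[X in measurable X]setTI; exact: me.
exists (~` ((re_im \o entry M c k) @^-1` regular_set c)); split.
- exact: measurableC.
- by rewrite probability_setC// PA subee.
- by apply: subsetC => w.
Qed.

Lemma ae_integral_eq (f g : T -> R) : measurable_fun setT f -> measurable_fun setT g ->
  (forall w, regular_entries w -> f w = g w) ->
  (\int[P]_w (f w)%:E = \int[P]_w (g w)%:E)%E.
Proof.
move=> mf mg fg; apply: ae_eq_integral => //; [exact/measurable_EFinP|exact/measurable_EFinP|].
by apply: filterS ae_regular => w rw _; rewrite fg.
Qed.

Variable mu : nat -> R.
Hypothesis hmu : forall k j, Ex P (fun w => potential M k w ^+ j) = mu j.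

Local Notation S := (wreath_site_model hmu).

Lemma trace_stat_on s n : on S [set: 'I_N]
  (fun w => norm_const ^+ n * \sum_x walk s ((potential M)^~ w) n x x).
Proof.
apply: (@onM _ _ _ _ _ _ _ _ S); first exact: on_cst.
by apply: on_sum => x _; apply: walk_on; exact: finset.subsetT.
Qed.

Lemma bm_trace_stat n : bounded_measurable (trace_stat n).
Proof.
exact: (perm_bm (S := S) (measurable_VN M)
  (h := fun s w => norm_const ^+ n * \sum_x walk s ((potential M)^~ w) n x x))
  (trace_stat_on ^~ n).
Qed.

Definition centered_trace (n : nat) (w : T) : R :=
  (Num.sqrt N%:R)^-1 * (trace_stat n w - Ex P (trace_stat n)).

Lemma bm_centered_trace n : bounded_measurable (centered_trace n).
Proof. by apply: bmZ; apply: bmB; [exact: bm_trace_stat|exact: bm_cst]. Qed.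

Lemma expectation_trace_power n : ('E_P[trace_power M n] = (Ex P (trace_stat n))%:E)%E.
Proof.
rewrite -bm_expectation; last exact: bm_trace_stat.
rewrite unlock; apply: ae_integral_eq; first exact: measurable_trace_power.
  by case: (bm_trace_stat n).
by move=> w rw; rewrite trace_power_regular.
Qed.

(** [ZN] and [centered_trace] have equal centring constants and agree on the regular event, so no
    bounded continuous test function distinguishes them. *)
Lemma expectation_ZN k (ns : 'I_k -> nat) (f : 'rV[R]_k -> R) (B : R) :
  continuous f -> (forall x, `|f x| <= B) ->
  ('E_P[fun w => f (\row_i ZN M (ns i) w)] =
   (Ex P (fun w => f (\row_i centered_trace (ns i) w)))%:E)%E.
Proof.
move=> cf fB.
have b2 : bounded_measurable (fun w => f (\row_i centered_trace (ns i) w)).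
  apply: (continuous_bm (X := fun w => \row_i centered_trace (ns i) w)) cf fB => i.
  rewrite (_ : (fun w => _) = centered_trace (ns i)); first by case: (bm_centered_trace (ns i)).
  by apply/funext => w; rewrite mxE.
rewrite -bm_expectation// unlock; apply: ae_integral_eq; last 2 first.
- by case: b2.
- move=> w rw; congr f; apply/rowP => i; rewrite !mxE /ZN expectation_trace_power/=.
  by rewrite /centered_trace trace_power_regular.
have [] // := continuous_bm (X := fun w => \row_i ZN M (ns i) w) _ cf fB.
move=> i; rewrite (_ : (fun w => _) = ZN M (ns i)).
  apply: measurable_funM => //; apply: measurable_funB => //.
  exact: measurable_trace_power.
by apply/funext => w; rewrite mxE.
Qed.

Variables (k : nat) (ns : 'I_k -> nat) (l : 'rV[R]_k).

Definition trace_coef (i : 'I_k) : R := l 0 i * norm_const ^+ ns i.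

(** Cramer-Wold reduction: a linear combination of normalised traces is the fluctuation of one local
    statistic, with the powers of the normalising constant absorbed into the coefficients. *)
Lemma dot_centered_trace w :
  dot l (\row_i centered_trace (ns i) w) = fluctuation (P := P) (xi := potential M)
    ns trace_coef (VN M) w.
Proof.
have tE w' : total_stat (xi := potential M) ns trace_coef (VN M) w' =
    \sum_i l 0 i * trace_stat (ns i) w'.
  rewrite /total_stat /site_stat exchange_big/=; apply: eq_bigr => i _.
  by rewrite -mulr_sumr /trace_coef /trace_stat mulrA.
rewrite /fluctuation (funext tE) Ex_sum; last by move=> i _; apply: bmZ; exact: bm_trace_stat.
rewrite -sumrB mulr_sumr; apply: eq_bigr => i _; rewrite mxE /centered_trace.
rewrite ExZ; last exact: bm_trace_stat.
by rewrite /scale; ring.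
Qed.

End Reduction.

End Components.

(** * Gaussian sequences and processes *)

Lemma ray_unique (R : realType) (Q1 Q2 : probability (measurableTypeR R) R) :
  (forall x : R, Q1 `]x, +oo[%classic = Q2 `]x, +oo[%classic) ->
  forall A, measurable A -> Q1 A = Q2 A.
Proof.
move=> ray A mA.
apply: (@measure_unique _ R (measurableTypeR R) (@RGenOInfty.G R)
  (fun n : nat => `](- n%:R), +oo[%classic)
  _ _ _ _ Q1 Q2) => //.
- exact: RGenOInfty.measurableE.
- move=> _ _ [x ->] [y ->]; exists (Num.max x y); apply/seteqP; split => z /=.
    by rewrite !in_itv/= !andbT gt_max => -[-> ->].
  by rewrite !in_itv/= !andbT gt_max => /andP[].
- by move=> n; exists (- n%:R).
- apply/seteqP; split => // z _; exists (Num.truncn `|z|).+1 => //=.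
  rewrite in_itv/= andbT ltrNl (le_lt_trans _ (truncnS_gt _))//.
  by rewrite -normrN ler_norm.
- by move=> _ [x ->]; exact: ray.
- move=> n; rewrite -ge0_fin_numE//; apply: fin_num_measure.
  exact: measurable_itv.
Qed.

(** * Cosine expectations determine a law on the line *)

Section LawUniqueness.
Context {R : realType}.
Notation mR := (measurableTypeR R).
Variables (Q1 Q2 : probability mR R).
Hypothesis cos_eq : forall l c : R,
  Ex Q1 (fun y => cos (l * y + c)) = Ex Q2 (fun y => cos (l * y + c)).

Lemma law_unique_continuous (h : R -> R) (B : R) : continuous h ->
  (forall y, `|h y| <= B) -> Ex Q1 h = Ex Q2 h.
Proof.
move=> ch hB.
pose X (y : R) : 'rV[R]_1 := \row_(i < 1) y.
have mX (i : 'I_1) : measurable_fun setT (fun y : mR => X y 0 i).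
  rewrite (_ : (fun y => _) = id); first exact: measurable_id.
  by apply/funext => y; rewrite mxE.
have dotX l y : dot l (X y) = l 0 0 * y.
  by rewrite /dot big_ord1 mxE.
have chX : continuous (fun v : 'rV[R]_1 => h (v 0 0)).
  move=> v; apply: (continuous_comp (f := fun v : 'rV[R]_1 => v 0 0) (g := h)).
    exact: coord_continuous.
  exact: ch.
have := @trig_unique R 1 _ mR Q1 _ mR Q2 X X (fun v => h (v 0 0)) B mX mX _ chX (fun v => hB _).
have XE (Q : probability mR R) : Ex Q (fun y => h (X y 0 0)) = Ex Q h.
  by apply: eq_Ex => y; rewrite mxE.
rewrite !XE; apply => l c.
have H (Q : probability mR R) : Ex Q (fun w => cos (dot l (X w) + c)) =
    Ex Q (fun y => cos (l 0 0 * y + c)) by apply: eq_Ex => y; rewrite dotX.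
by rewrite !H.
Qed.

(** The ramps are bounded and continuous and converge pointwise to the indicator of the ray ]x,
    +oo[; equality on rays extends to all Borel sets. *)
Lemma law_unique A : measurable A -> Q1 A = Q2 A.
Proof.
pose ramp (x : R) (n : nat) (y : R) : R := Num.max 0 (Num.min 1 (n%:R * (y - x))).
have ramp_c x n : continuous (ramp x n).
  move=> y; have c1 (a : R) : {for y, continuous (cst a : R -> R^o)} by exact: cst_continuous.
  have c2 : {for y, continuous (fun y : R => n%:R * (y - x) : R^o)}.
    apply: continuousM; first exact: cst_continuous.
    by apply: continuousB; [exact: id|exact: cst_continuous].
  exact: (continuous_max (c1 0) (continuous_min (c1 1) c2)).
have ramp_b x n y : `|ramp x n y| <= 1.
  rewrite /ramp ger0_norm; first by rewrite ge_max ler01 ge_min lexx.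
  by rewrite le_max lexx.
have ramp_cvg x y : ramp x n y @[n --> \oo] --> (\1_(`]x, +oo[%classic : set mR) y : R).
  rewrite indicE; have [yx|xy] := leP y x.
    rewrite memNset; last by rewrite /= in_itv/= andbT => /lt_le_trans/(_ yx); rewrite ltxx.
    apply: cvg_near_cst; apply: nearW => n; rewrite /ramp.
    apply/max_idPl; rewrite ge_min; apply/orP; right.
    by rewrite mulr_ge0_le0// subr_le0.
  rewrite mem_set; last by rewrite /= in_itv/= andbT.
  apply: cvg_near_cst; near=> n; rewrite /ramp (min_idPl _) ?(max_idPr _)//.
  rewrite -ler_pdivrMr ?subr_gt0// mul1r.
  by near: n; exact: nbhs_infty_ger.
have rayE (Q : probability mR R) x : Q (`]x, +oo[%classic : set mR) =
    (Ex Q (\1_(`]x, +oo[%classic : set mR)))%:E.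
  by rewrite /Ex /Rintegral integral_indic ?setIT// fineK// fin_num_measure.
have ray x : Q1 (`]x, +oo[%classic : set mR) = Q2 (`]x, +oo[%classic : set mR).
  rewrite !rayE; congr (_%:E).
  have H (Q : probability mR R) :
      Ex Q (ramp x n) @[n --> \oo] --> Ex Q (\1_(`]x, +oo[%classic : set mR)).
    apply: (@Ex_cvg _ _ _ Q _ _ 1) => // n.
    exact: continuous_measurable_fun.
  apply: (cvg_unique _ (H Q1)) => //.
  rewrite (_ : (fun n => _) = fun n => Ex Q2 (ramp x n)); first exact: H.
  by apply/funext => n; exact: (law_unique_continuous (@ramp_c x n) (ramp_b x n)).
exact: ray_unique.
Unshelve. all: by end_near. Qed.

End LawUniqueness.

Lemma measurable_affine (R : realType) (a c : R) :
  measurable_fun (setT : set (measurableTypeR R)) (fun x : measurableTypeR R => a * x + c).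
Proof.
by apply: measurable_funD => //; apply: measurable_funM => //; exact: measurable_id.
Qed.

(** * The characteristic function of the normal law *)

Section NormalCharacteristic.
Context {R : realType}.
Notation mR := (measurableTypeR R).
Notation leb := (@lebesgue_measure R).
Variable s : R.
Hypothesis s0 : 0 < s.

Let p : R -> R := normal_pdf 0 s.

Lemma normal_pdf0E x : normal_pdf 0 s x = normal_peak s * expR (- (x ^+ 2 / (s ^+ 2 *+ 2))).
Proof.
by rewrite normal_pdfE ?gt_eqF// /normal_fun subr0 mulNr.
Qed.

(** Change of variables with the Radon-Nikodym derivative of the normal law, which is almost
    everywhere the explicit density. *)
Lemma Ex_normal (f : R -> R) : bounded_measurable (f : mR -> R) ->
  Ex (normal_prob 0 s : probability mR R) f = \int[leb]_x (f x * normal_pdf 0 s x).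
Proof.
move=> bf; rewrite /Ex /Rintegral; congr fine.
have mf : measurable_fun setT f by case: bf.
rewrite -(Radon_Nikodym_change_of_variables (normal_prob_dominates 0 s))//=; last first.
  exact: bm_integrable.
apply: ae_eq_integral => //.
- apply: emeasurable_funM => //; first exact/measurable_EFinP.
  apply: (measurable_int leb); apply: Radon_Nikodym_integrable.
  exact: normal_prob_dominates.
- under eq_fun do rewrite EFinM.
  apply: emeasurable_funM => //; first exact/measurable_EFinP.
  by apply/measurable_EFinP; exact: measurable_normal_pdf.
- rewrite (_ : (fun x => (f x * normal_pdf 0 s x)%:E) =
      (fun x => (f x)%:E * (normal_pdf 0 s x)%:E)%E); last first.
    by apply/funext => x; rewrite EFinM.
  apply: ae_eqe_mul2l => /=.
  rewrite Radon_NikodymE//=; first exact: normal_prob_dominates.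
  move=> nmu; case: cid => /= h [h1 h2 h3].
  apply: integral_ae_eq => //=.
  + by apply/measurable_EFinP; exact: measurable_normal_pdf.
  + by move=> E _ mE; rewrite -h3.
Qed.

(** |x| times the density is dominated by a multiple of the normal density with deviation 2s, which
    is known to be integrable. *)
Lemma integrable_id_normal : leb.-integrable setT (EFin \o (fun x => x * p x)).
Proof.
pose C := normal_peak s * s / normal_peak (2 * s).
have s20 : 2 * s != 0 by rewrite mulf_neq0// gt_eqF.
apply: (le_integrable _ _ _ (integrableZl measurableT C (integrable_normal_pdf 0 (2 * s)))) => //.
  apply/measurable_EFinP; apply: measurable_funM; first exact: measurable_id.
  exact: measurable_normal_pdf.
move=> x _ /=; rewrite lee_fin.
rewrite [leRHS]ger0_norm; last first.
  rewrite mulr_ge0 ?normal_pdf_ge0// /C !mulr_ge0 ?normal_peak_ge0 ?invr_ge0 ?normal_peak_ge0//.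
  exact: ltW.
rewrite normrM (ger0_norm (normal_pdf_ge0 _ _ _)) normal_pdf0E.
rewrite normal_pdfE// /normal_fun subr0 mulNr /C.
have pk2 : normal_peak (2 * s) != 0 by rewrite gt_eqF// normal_peak_gt0.
have CE e : normal_peak s * s / normal_peak (2 * s) * (normal_peak (2 * s) * e) =
    normal_peak s * (s * e) by field.
rewrite CE mulrCA ler_wpM2l ?normal_peak_ge0//.
have sn : s != 0 by rewrite gt_eqF.
(* One quarter of the exponent is that of the wider density; the other three quarters absorb |x|
   through exp(y) >= 1 + y. *)
have E1 : x ^+ 2 / (s ^+ 2 *+ 2) = x ^+ 2 / ((2 * s) ^+ 2 *+ 2) + x ^+ 2 * (3 / 8) / s ^+ 2.
  by rewrite -!(mulr_natl (_ ^+ 2)); field.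
rewrite E1 opprD expRD mulrCA [leRHS]mulrC ler_wpM2l ?expR_ge0// expRN.
rewrite ler_pdivrMr ?expR_gt0//.
apply: (@le_trans _ _ (s * (1 + x ^+ 2 * (3 / 8) / s ^+ 2))); last first.
  by rewrite ler_wpM2l ?(ltW s0)// expR_ge1Dx.
have -> : s * (1 + x ^+ 2 * (3 / 8) / s ^+ 2) = (s ^+ 2 + (3 / 8) * x ^+ 2) / s.
  by field.
rewrite ler_pdivlMr// -(@real_normK _ x) ?num_real//.
have := sqr_ge0 (s - `|x| / 2); have := sqr_ge0 `|x|; rewrite !sqrrB => h1 h2.
by nra.
Qed.

Lemma is_derive_normal_pdf (x : R) : is_derive x 1 p (- (x / s ^+ 2) * p x).
Proof.
have sn : s != 0 by rewrite gt_eqF.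
have -> : p = normal_peak s *: (expR \o (fun x => - (x ^+ 2 / (s ^+ 2 *+ 2)))).
  by apply/funext => y; rewrite /p normal_pdf0E.
have d1 : is_derive x 1 (fun x : R => - (x ^+ 2 / (s ^+ 2 *+ 2))) (- (x / s ^+ 2)).
  have -> : (fun x : R => - (x ^+ 2 / (s ^+ 2 *+ 2))) =
      (- (s ^+ 2 *+ 2)^-1) *: (@id R ^+ 2).
    apply/funext => y; transitivity (- (s ^+ 2 *+ 2)^-1 * y ^+ 2) => //.
    by rewrite mulNr mulrC.
  apply: is_derive_eq (_ : (- (s ^+ 2 *+ 2)^-1) *: ((2%:R * x ^+ 1) *: 1) = - (x / s ^+ 2)).
  by rewrite /GRing.scale/= expr1 -(mulr_natl (s ^+ 2)); field.
apply: (is_derive_eq (is_deriveZ (normal_peak s) (is_derive1_comp (is_derive_expR _) d1))).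
rewrite /GRing.scale/=; move: (expR _) => e.
by transitivity (- (x / s ^+ 2) * (normal_peak s * e)); first ring.
Qed.

(** Integration by parts: the derivative of p(x) sin(ax + c) combines the two integrands, and its
    integral over the line vanishes. *)
Lemma normal_parts (a c : R) :
  \int[leb]_x (sin (a * x + c) * (x * p x)) = s ^+ 2 * a * \int[leb]_x (cos (a * x + c) * p x).
Proof.
have sn : s != 0 by rewrite gt_eqF.
have mlin := measurable_affine a c.
have isin : leb.-integrable setT (EFin \o (fun x => sin (a * x + c) * (x * p x))).
  apply: integrable_bounded_mul; [|by move=> x; exact: sin_max|exact: integrable_id_normal].
  by case: (bm_sin mlin).
have icos : leb.-integrable setT (EFin \o (fun x => cos (a * x + c) * p x)).
  apply: integrable_bounded_mul; [|by move=> x; exact: cos_max|exact: integrable_normal_pdf].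
  by case: (bm_cos mlin).
pose H (x : R) := p x * sin (a * x + c).
pose h (x : R) := (- (s ^+ 2)^-1) * (sin (a * x + c) * (x * p x)) + a * (cos (a * x + c) * p x).
have dH (x : R) : is_derive x 1 H (h x).
  have d1 : is_derive x 1 (fun x : R => a * x + c) a.
    have -> : (fun x : R => a * x + c) = a *: (@id R) + cst c by [].
    apply: is_derive_eq (_ : a *: 1 + 0 = a).
    by rewrite addr0 /GRing.scale/= mulr1.
  have -> : H = p * (sin \o (fun x => a * x + c)) by [].
  apply: (is_derive_eq (is_deriveM (is_derive_normal_pdf x)
    (is_derive1_comp (is_derive_sin _) d1))).
  by rewrite /GRing.scale/= /h; ring.
have iZ (r : R) (f : R -> R) : leb.-integrable setT (EFin \o f) ->
    leb.-integrable setT (EFin \o (fun x => r * f x)).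
  move=> if_; rewrite (_ : _ \o _ = (fun x => r%:E * (EFin \o f) x)%E).
    exact: integrableZl.
  by apply/funext => x; rewrite /= EFinM.
have i1 := iZ (- (s ^+ 2)^-1) _ isin; have i2 := iZ a _ icos.
pose f1 (x : R) := - (s ^+ 2)^-1 * (sin (a * x + c) * (x * p x)).
pose f2 (x : R) := a * (cos (a * x + c) * p x).
have ih : leb.-integrable setT (EFin \o h).
  rewrite (_ : EFin \o h = ((EFin \o f1) \+ (EFin \o f2))%E).
    exact: integrableD.
  by apply/funext => x; rewrite /= /h EFinD.
suff h0 : \int[leb]_x h x = 0.
  have : \int[leb]_x h x = (- (s ^+ 2)^-1) * \int[leb]_x (sin (a * x + c) * (x * p x)) +
      a * \int[leb]_x (cos (a * x + c) * p x).
    rewrite /h RintegralD//.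
    by rewrite !RintegralZl.
  rewrite h0 => /esym/eqP; rewrite addrC mulNr subr_eq0 => /eqP E.
  by rewrite -mulrA E mulVKf// expf_neq0.
have cont_h : continuous h.
  have cp : continuous p by apply: continuous_normal_pdf; rewrite gt_eqF.
  have clin : continuous (fun x : R => a * x + c).
    move=> x; apply: cvgD; last exact: cvg_cst.
    by apply: cvgM; [exact: cvg_cst|exact: cvg_id].
  move=> x; apply: cvgD; (apply: cvgM; first exact: cvg_cst); apply: cvgM.
  - by apply: (continuous_comp (clin x)); exact: continuous_sin.
  - by apply: cvgM; [exact: cvg_id|exact: cp].
  - by apply: (continuous_comp (clin x)); exact: continuous_cos.
  - exact: cp.
(* Truncation to [-n, n], where the fundamental theorem of calculus leaves only boundary values; the
   integrals converge by domination. *)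
pose hn (n : nat) (x : R) := h x * \1_(`[- n%:R, n%:R]%classic : set mR) x.
have lim1 : \int[leb]_x hn n x @[n --> \oo] --> \int[leb]_x h x.
  rewrite /Rintegral; apply: fine_cvg; rewrite fineK; last exact: integrable_fin_num ih.
  apply: (@dominated_cvg _ _ _ leb _ measurableT (fun n x => (hn n x)%:E) (EFin \o h)
    (EFin \o (fun x => `|h x|))) => //=.
  - move=> n; apply/measurable_EFinP; apply: measurable_funM.
      exact: continuous_measurable_fun cont_h.
    exact: measurable_indic.
  - move=> x _; apply: cvg_EFin; first exact: nearW.
    apply: cvg_near_cst; near=> n; rewrite /= /hn indicE mem_set ?mulr1//= in_itv/= -ler_norml.
    by near: n; exact: nbhs_infty_ger.
  - exact: (integrable_norm ih).
  - move=> n x _; rewrite lee_fin /hn normrM -[leRHS]mulr1 ler_wpM2l// indicE normr_nat.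
    by case: (_ \in _); rewrite ?ler01 ?lexx.
have E n : (0 < n)%N -> \int[leb]_x hn n x = H n%:R - H (- n%:R).
  move=> n0; have n1 : (0 : R) < n%:R by rewrite ltr0n.
  have nn : - n%:R < n%:R :> R by lra.
  rewrite /Rintegral -[RHS]/(fine (_%:E)) EFinB -(@continuous_FTC2 _ h H)//.
  - congr fine; rewrite [RHS]integral_mkcond; apply: eq_integral => x _.
    by rewrite /hn patchE indicE; case: (x \in _); rewrite ?mulr1 ?mulr0.
  - exact: continuous_subspaceT.
  - have cH : continuous H.
      by move=> x; apply: differentiable_continuous; apply/derivable1_diffP; have [] := dH x.
    split; first by move=> x _; have [] := dH x.
    + by apply: cvg_at_right_filter; exact: cH.
    + by apply: cvg_at_left_filter; exact: cH.
  - by move=> x _; rewrite derive1E; exact: derive_val.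
pose K := normal_peak s * (s ^+ 2 *+ 2).
have K0 : 0 <= K by rewrite mulr_ge0 ?normal_peak_ge0// mulrn_wge0// sqr_ge0.
(* From exp(-y) <= 1 / y with y = x^2 / (2 s^2), and x^2 >= |x|; any decay of the boundary values
   would do. *)
have Hle (x : R) : 1 <= `|x| -> `|H x| <= K / `|x|.
  move=> x1; rewrite /H normrM -[leRHS]mulr1 ler_pM// ?sin_max//.
  rewrite ger0_norm ?normal_pdf_ge0// /p normal_pdf0E /K -mulrA ler_wpM2l ?normal_peak_ge0//.
  have x0 : 0 < `|x| by exact: lt_le_trans x1.
  have s2 : 0 < s ^+ 2 *+ 2 by rewrite mulrn_wgt0 ?exprn_gt0.
  rewrite expRN -[leRHS]invrK lef_pV2 ?posrE ?expR_gt0 ?invr_gt0 ?divr_gt0//.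
  rewrite invf_div (le_trans _ (expR_ge1Dx _))// ler_wpDl// ler_wpM2r ?invr_ge0 ?(ltW s2)//.
  by rewrite -(@real_normK _ x) ?num_real// expr2 ler_peMl.
have lim2 : \int[leb]_x hn n x @[n --> \oo] --> (0 : R).
  apply/cvgrPdist_le => e e0; near=> n.
  have n1 : (1 : R) <= n%:R by near: n; exact: nbhs_infty_ger.
  have n0 : (0 : R) < n%:R by exact: lt_le_trans n1.
  rewrite sub0r normrN E; last by rewrite -(ltr0n R).
  have h1 := Hle n%:R; have h2 := Hle (- n%:R).
  rewrite (normrN n%:R) in h2; rewrite (ger0_norm (ltW n0)) in h1 h2.
  rewrite (le_trans (ler_normB _ _))// (le_trans (lerD (h1 n1) (h2 n1)))//.
  rewrite -mulrDl ler_pdivrMr// -ler_pdivrMl//.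
  by near: n; exact: nbhs_infty_ger.
by rewrite (cvg_unique _ lim1 lim2).
Unshelve. all: by end_near. Qed.

(* The left-hand side F satisfies F'(a) = - a s^2 F(a). *)
Lemma Ex_normal_cos (a c : R) :
  Ex (normal_prob 0 s : probability mR R) (fun x => cos (a * x + c)) =
  expR (- (a ^+ 2 * s ^+ 2) / 2) * cos c.
Proof.
pose F (a : R) := \int[leb]_x (cos (a * x + c) * p x).
have dF (t : R) : is_derive t 1 F (- (s ^+ 2 * t * F t)).
  have := is_derive_integral_cos c (@measurable_id _ _ (setT : set mR))
    (integrable_normal_pdf 0 s) integrable_id_normal t.
  by rewrite normal_parts.
pose h (t : R) := expR (t ^+ 2 * (s ^+ 2 / 2)).
have dh (t : R) : is_derive t 1 h (h t * (t * s ^+ 2)).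
  have d1 : is_derive t 1 (fun t : R => t ^+ 2 * (s ^+ 2 / 2)) (t * s ^+ 2).
    have -> : (fun t : R => t ^+ 2 * (s ^+ 2 / 2)) = (s ^+ 2 / 2) *: (@id R ^+ 2).
      by apply/funext => x; rewrite /= mulrC.
    apply: is_derive_eq (_ : (s ^+ 2 / 2) *: ((2%:R * t ^+ 1) *: 1) = t * s ^+ 2).
    by rewrite /GRing.scale/= expr1; field.
  exact: (is_derive_eq (is_derive1_comp (is_derive_expR _) d1)).
have dg (t : R) : is_derive t 1 (h * F) 0.
  apply: (is_derive_eq (is_deriveM (dh t) (dF t))).
  by rewrite /GRing.scale/=; ring.
have := is_derive_0_is_cst a 0 dg.
have bcos t : bounded_measurable (fun x : mR => cos (t * x + c)).
  exact: bm_cos (measurable_affine t c).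
have F0 : F 0 = cos c.
  rewrite /F -(Ex_normal (bcos 0)) -[RHS](Ex_cst (normal_prob 0 s : probability mR R)).
  by apply: eq_Ex => x; rewrite mul0r add0r.
rewrite Ex_normal// -/(F a).
have -> : (h * F) a = h a * F a by [].
have -> : (h * F) 0 = h 0 * F 0 by [].
rewrite F0 /h expr0n/= mul0r expR0 mul1r => <-.
rewrite mulrA -expRD (_ : _ + _ = 0) ?expR0 ?mul1r//.
by field.
Qed.

End NormalCharacteristic.

(** * Binary digits of a uniform variable *)

Section UniformBits.
Context {R : realType}.
Notation mR := (measurableTypeR R).
Notation leb := (@lebesgue_measure R).

Definition unif : probability mR R := uniform_prob (@ltr01 R).

Lemma unifE (A : set mR) : measurable A -> unif A = leb (A `&` `[0, 1]).
Proof.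
move=> mA; rewrite /unif /= /uniform_prob integral_uniform_pdf.
rewrite (eq_integral (fun=> 1%:E)) => [|x].
  by rewrite integral_cst ?mul1e//; exact: measurableI.
by rewrite inE => -[_]; rewrite /= in_itv/= /uniform_pdf => ->; rewrite subr0 invr1.
Qed.

Lemma unif_itv (a b : R) : 0 <= a -> a < b -> b <= 1 -> unif `[a, b[%classic = (b - a)%:E.
Proof.
move=> a0 ab b1; rewrite unifE//.
rewrite setIidl; last first.
  move=> x /=; rewrite !in_itv/= => /andP[ax xb].
  by rewrite (le_trans a0 ax)/= ltW// (lt_le_trans xb b1).
by rewrite lebesgue_measure_itv/= lte_fin ab EFinB.
Qed.

Lemma unif01 : unif `]0, 1[%classic = 1%E.
Proof.
rewrite unifE//.
rewrite setIidl; last by move=> x /=; rewrite !in_itv/= => /andP[/ltW -> /ltW ->].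
by rewrite lebesgue_measure_itv/= lte_fin ltr01 oppr0 adde0.
Qed.

(** The uniform law charges neither the end points nor the complement of [0, 1], so default values
    taken there by total functions are harmless. *)
Lemma eq_Ex_unif (f g : mR -> R) : bounded_measurable f -> bounded_measurable g ->
  (forall u, 0 < u < 1 -> f u = g u) -> Ex unif f = Ex unif g.
Proof.
move=> bf bg fg; rewrite /Ex /Rintegral; congr fine.
apply: ae_eq_integral => //.
- by apply/measurable_EFinP; case: bf.
- by apply/measurable_EFinP; case: bg.
exists (~` `]0, 1[%classic); split.
- by apply: measurableC; exact: measurable_itv.
- have := probability_setC unif (measurable_itv `]0, 1[).
  by rewrite unif01 subee.
move=> x /= nfg; rewrite in_itv/= => x01; apply: nfg => _.
by rewrite fg.
Qed.

(** The integer formed by the first n binary digits of [u]. Digits are numbered from 0, so [bit n]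
    is the last digit of [dyadic n.+1]. *)
Definition dyadic (n : nat) (u : R) : nat := Num.truncn (2 ^+ n * u).
Definition bit (n : nat) (u : R) : bool := odd (dyadic n.+1 u).

Lemma measurable_dyadic (F : nat -> R) n :
  measurable_fun (setT : set mR) (fun u : mR => F (dyadic n u)).
Proof.
have mt : measurable_fun (setT : set mR) (fun u : mR => (dyadic n u)%:R : R).
  apply: nondecreasing_measurable => // x y xy.
  by rewrite ler_nat le_truncn// ler_wpM2l// exprn_ge0.
move=> _ Y mY; rewrite setTI.
have -> : (fun u => F (dyadic n u)) @^-1` Y =
    \bigcup_(k in [set k | Y (F k)]) ((fun u : mR => (dyadic n u)%:R : R) @^-1` [set k%:R]).
  apply/seteqP; split => u /=; first by move=> Yu; exists (dyadic n u).
  by move=> [k /= Yk /eqP]; rewrite eqr_nat => /eqP ->.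
apply: bigcup_measurable => k _; rewrite -[X in measurable X]setTI.
by apply: mt => //; exact: measurable_set1.
Qed.

Lemma bit_bm (F : bool -> R) n : bounded_measurable (fun u : mR => F (bit n u)).
Proof.
split; first exact: (measurable_dyadic (fun k => F (odd k)) n.+1).
exists (`|F true| + `|F false|) => u.
by case: (bit n u); rewrite ?lerDl ?lerDr.
Qed.

Lemma dyadic_half n u : (dyadic n.+1 u)./2 = dyadic n u.
Proof.
case: (lerP 0 u) => u0; last first.
  have z k : dyadic k u = 0%N.
    apply/eqP; rewrite -leqn0 truncn_le_nat.
    by rewrite (lt_trans _ ltr01)// pmulr_rlt0// exprn_gt0.
  by rewrite !z.
apply/esym; apply: truncn_def.
have := truncn_itv (mulr_ge0 (exprn_ge0 n.+1 (ler0n R 2)) u0).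
rewrite -/(dyadic n.+1 u) exprS -mulrA; move: (_ * u) (dyadic n.+1 u) => y k.
have kE : (k%:R : R) = (odd k)%:R + 2 * k./2%:R.
  by rewrite -natrM mul2n -natrD odd_double_half.
rewrite -(addn1 k) -(addn1 k./2) !natrD kE => /andP[h1 h2].
by apply/andP; split; case: (odd k) h1 h2 => /= h1 h2; lra.
Qed.

Lemma dyadicS n u : dyadic n.+1 u = (bit n u + (dyadic n u).*2)%N.
Proof. by rewrite -(dyadic_half n) odd_double_half. Qed.

Lemma dyadic0 u : 0 <= u < 1 -> dyadic 0 u = 0%N.
Proof. by move=> /andP[u0 u1]; apply: truncn_def; rewrite expr0 mul1r u0 u1. Qed.

Lemma Ex_dyadic (F : nat -> R) n :
  bounded_measurable (fun u : mR => F (dyadic n u)) ->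
  Ex unif (fun u => F (dyadic n u)) = (2 ^+ n)^-1 * \sum_(k < 2 ^ n) F k.
Proof.
move=> bFd; have n0 : (0 : R) < 2 ^+ n by rewrite exprn_gt0.
pose I (k : nat) : set mR := `[(k%:R / 2 ^+ n), (k.+1%:R / 2 ^+ n)[%classic.
have mI k : measurable (I k) by exact: measurable_itv.
have bI k : bounded_measurable (fun u : mR => F k * \1_(I k) u).
  by apply: bmZ; exact: bm_indic.
have IE k u : 0 <= u -> (u \in I k) = (dyadic n u == k).
  move=> u0; rewrite /I; apply/idP/eqP.
    rewrite inE/= in_itv/= ler_pdivrMr// ltr_pdivlMr// => h.
    by apply: truncn_def; rewrite mulrC.
  move=> <-; rewrite inE/= in_itv/= ler_pdivrMr// ltr_pdivlMr// (mulrC u).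
  by apply: truncn_itv; rewrite mulr_ge0// ltW.
have lt2 u : 0 <= u < 1 -> (dyadic n u < 2 ^ n)%N.
  move=> /andP[u0 u1]; rewrite truncn_lt_nat ?mulr_ge0 ?(ltW n0)//.
  by rewrite natrX gtr_pMr.
have E u : 0 < u < 1 -> F (dyadic n u) = \sum_(k < 2 ^ n) F k * \1_(I k) u.
  move=> /andP[/ltW u0 u1]; have u01 : 0 <= u < 1 by apply/andP.
  rewrite (bigD1 (Ordinal (lt2 u u01)))//= big1 ?addr0 => [|k kn].
    by rewrite indicE IE// eqxx mulr1.
  rewrite indicE IE// (_ : _ == _ = false) ?mulr0//.
  by apply/negbTE; apply: contra kn => /eqP kE; apply/eqP/val_inj.
have bF : bounded_measurable (fun u : mR => \sum_(k < 2 ^ n) F k * \1_(I k) u).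
  by apply: bm_sum => k _; exact: bI.
rewrite (eq_Ex_unif bFd bF E) Ex_sum; last by move=> k _; exact: bI.
rewrite mulr_sumr; apply: eq_bigr => k _.
rewrite ExZ; last exact: bm_indic.
rewrite mulrC; congr (_ * _).
have uI : unif (I k) = ((2 ^+ n)^-1)%:E.
  rewrite unif_itv ?divr_ge0 ?(ltW n0)//.
  - by rewrite -mulrBl -natrB// subSnn mul1r.
  - by rewrite ltr_pM2r ?invr_gt0// ltr_nat.
  - by rewrite ler_pdivrMr// mul1r -natrX ler_nat.
by rewrite /Ex /Rintegral integral_indic// setIT -[fine _]/(fine (unif (I k))) uI.
Qed.

Lemma sum_double (F : nat -> R) n :
  \sum_(k < n.*2) F k = \sum_(k < n) (F k.*2 + F k.*2.+1).
Proof.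
elim: n => [|n IH]; first by rewrite !big_ord0.
by rewrite doubleS !big_ord_recr/= IH addrA.
Qed.

(** Independence of the digits as a product formula. [H] recovers the product from the integer, its
    last digit being the parity; pairing 2k with 2k + 1 averages that digit out. *)
Lemma Ex_prod_bits (h : nat -> bool -> R) n :
  Ex unif (fun u => \prod_(i < n) h i (bit i u)) =
  \prod_(i < n) ((h i true + h i false) / 2).
Proof.
pose H := fix H (n k : nat) : R :=
  if n is n'.+1 then H n' k./2 * h n' (odd k) else 1.
have HE u : \prod_(i < n) h i (bit i u) = H n (dyadic n u).
  elim: n => [|k IH]; first by rewrite big_ord0.
  by rewrite big_ord_recr/= IH dyadic_half.
have bP : bounded_measurable (fun u : mR => \prod_(i < n) h i (bit i u)).
  by apply: bm_prod => i _; exact: bit_bm.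
rewrite (eq_Ex unif HE) Ex_dyadic; last exact: eq_bm bP.
elim: n {HE bP} => [|n IH]; first by rewrite expn0 big_ord1/= big_ord0 expr0 invr1 mul1r.
rewrite big_ord_recr/= -IH expnS mul2n.
rewrite (sum_double (fun k => H n k./2 * h n (odd k))).
rewrite (eq_bigr (fun k : 'I__ => H n k * (h n true + h n false))) => [|k _]; last first.
  by rewrite /= !uphalf_double doubleK !odd_double/= addrC mulrDr.
rewrite -mulr_suml exprS; move: (\sum_(_ < _) _) (h n true + h n false) => a b.
have n2 : (2 : R) ^+ n != 0 by rewrite expf_neq0.
by field.
Qed.


(** Each digit up to the largest index used receives the factor of its only preimage, or the factor
    1, whose average is 1. *)
Lemma Ex_prod_bits_inj (phi : nat -> nat) (h : nat -> bool -> R) n : injective phi ->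
  Ex unif (fun u => \prod_(k < n) h k (bit (phi k) u)) =
  \prod_(k < n) ((h k true + h k false) / 2).
Proof.
move=> phi_inj.
pose N := (\max_(k < n) phi k).+1.
have phiN (k : 'I_n) : (phi k < N)%N by rewrite ltnS (leq_bigmax (F := fun k : 'I_n => phi k)).
pose ph (k : 'I_n) : 'I_N := Ordinal (phiN k).
pose g (i : nat) (b : bool) := \prod_(k < n | phi k == i) h k b.
have gE u : \prod_(k < n) h k (bit (phi k) u) = \prod_(i < N) g i (bit i u).
  rewrite (partition_big ph xpredT)//=; apply: eq_bigr => i _.
  by rewrite /g; apply: eq_big => [k|k /eqP <-//]; rewrite -val_eqE.
rewrite (eq_Ex unif gE) Ex_prod_bits [RHS](partition_big ph xpredT)//=.
apply: eq_bigr => i _; rewrite /g.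
under [RHS]eq_bigl do rewrite -val_eqE/=.
case: (pickP [pred k : 'I_n | phi k == i]) => [k /= /eqP ki|no].
  have uk : (fun k' : 'I_n => phi k' == i) =1 pred1 k.
    by move=> k' /=; rewrite -ki (inj_eq phi_inj) val_eqE.
  by rewrite !(big_pred1 k).
by rewrite !big_pred0// -[2]/(1 + 1) divff// pnatr_eq0.
Qed.

(** Any function of finitely many distinct digits is a sum of point masses, each of which is a
    product over the digits. *)
Lemma Ex_bits (phi : nat -> nat) n (F : {ffun 'I_n -> bool} -> R) : injective phi ->
  Ex unif (fun u => F [ffun k : 'I_n => bit (phi k) u]) = (2 ^- n) * \sum_e F e.
Proof.
move=> phi_inj.
pose D (e : {ffun 'I_n -> bool}) (k : nat) (b : bool) : R :=
  if insub k is Some k' then (e k' == b)%:R else 1.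
have DE e (k : 'I_n) b : D e k b = (e k == b)%:R by rewrite /D valK.
have bP e : bounded_measurable (fun u : mR => \prod_(k < n) D e k (bit (phi k) u)).
  by apply: bm_prod => k _; exact: bit_bm.
have FE u : F [ffun k : 'I_n => bit (phi k) u] =
    \sum_e F e * \prod_(k < n) D e k (bit (phi k) u).
  rewrite (bigD1 [ffun k : 'I_n => bit (phi k) u])//= big1 => [|k _]; last first.
    by rewrite DE ffunE eqxx.
  rewrite mulr1 big1 ?addr0// => e ne.
  have [k nk] : exists k, e k != bit (phi k) u.
    apply/existsP; rewrite -negb_forall; apply: contra ne => /forallP h.
    by apply/eqP/ffunP => k; rewrite ffunE; apply/eqP.
  by rewrite (bigD1 k)//= DE (negbTE nk) mul0r mulr0.
rewrite (eq_Ex unif FE) Ex_sum => [|e _]; last by apply: bmZ; exact: bP.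
rewrite mulr_sumr; apply: eq_bigr => e _; rewrite ExZ; last exact: bP.
rewrite Ex_prod_bits_inj// mulrC; congr (_ * _).
rewrite (eq_bigr (fun=> 2^-1)) => [|k _].
  by rewrite prodr_const card_ord exprVn.
by rewrite !DE; case: (e k); rewrite ?addr0 ?add0r mul1r.
Qed.

Definition bits_sum (phi : nat -> nat) (n : nat) (u : R) : R :=
  \sum_(k < n) (bit (phi k) u)%:R / 2 ^+ k.+1.

Lemma bits_sum_id n u : 0 <= u < 1 -> bits_sum id n u = (dyadic n u)%:R / 2 ^+ n.
Proof.
move=> u01; rewrite /bits_sum; elim: n => [|n IH]; first by rewrite big_ord0 dyadic0// mul0r.
have n2 : (2 : R) ^+ n != 0 by rewrite expf_neq0.
rewrite big_ord_recr/= IH dyadicS natrD -mul2n natrM exprS.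
by field.
Qed.

Lemma bits_sum_le1 phi n u : bits_sum phi n u <= 1 - 2 ^- n.
Proof.
elim: n => [|n IH]; first by rewrite /bits_sum big_ord0 expr0 invr1 subrr.
rewrite /bits_sum big_ord_recr/= -/(bits_sum phi n u).
have e2 : (0 : R) < 2 ^- n.+1 by rewrite invr_gt0 exprn_gt0.
have -> : (2 : R) ^- n.+1 = 2 ^- n / 2 by rewrite exprS invfM mulrC.
have h : 2 ^- n = 2 * (2 ^- n / 2) :> R by field.
have : (bit (phi n) u)%:R / 2 ^+ n.+1 <= 2 ^- n.+1 :> R.
  by rewrite ler_piMl ?(ltW e2)//; case: bit.
rewrite (_ : 2 ^- n.+1 = 2 ^- n / 2); last by rewrite exprS invfM mulrC.
by lra.
Qed.

Lemma bits_sum_cvg phi u : cvgn (fun n => bits_sum phi n u).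
Proof.
apply: nondecreasing_is_cvgn.
  apply/nondecreasing_seqP => n; rewrite /bits_sum big_ord_recr/= lerDl.
  by rewrite divr_ge0// exprn_ge0.
by exists 1 => _ [n _ <-]; rewrite (le_trans (bits_sum_le1 _ _ _)).
Qed.

Definition bits_real (phi : nat -> nat) (u : R) : R := limn (fun n => bits_sum phi n u).

Lemma bits_sum_real phi u : bits_sum phi n u @[n --> \oo] --> bits_real phi u.
Proof. exact: bits_sum_cvg. Qed.

(** The partial digit sums are dyadic truncations, within 2^-n below [u]. *)
Lemma bits_real_id u : 0 <= u < 1 -> bits_real id u = u.
Proof.
move=> u01; apply: cvg_lim => //.
have h n : u - 2 ^- n <= bits_sum id n u <= u.
  have n2 : (0 : R) < 2 ^+ n by rewrite exprn_gt0.
  have /andP[u0 _] := u01.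
  have := truncn_itv (mulr_ge0 (exprn_ge0 n (ler0n R 2)) u0).
  rewrite bits_sum_id// -/(dyadic n u) -(natr1 (dyadic n u)) => /andP[h1 h2].
  rewrite ler_pdivrMr// (mulrC u) h1 andbT lerBlDr -[X in _ + X]mul1r -mulrDl.
  rewrite ler_pdivlMr// (mulrC u). exact: ltW.
apply: (@squeeze_cvgr _ _ _ _ (fun n => u - 2 ^- n) (fun=> u)).
- exact: nearW.
- rewrite -[X in _ --> X]subr0; apply: cvgB; first exact: cvg_cst.
  rewrite (_ : (fun n => 2 ^- n) = (fun n => (2^-1 : R) ^+ n)); last first.
    by apply/funext => n; rewrite exprVn.
  by apply: cvg_expr; rewrite ger0_norm// invf_lt1// ltr1n.
- exact: cvg_cst.
Qed.

Lemma measurable_bits_sum phi n :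
  measurable_fun (setT : set mR) (fun u : mR => bits_sum phi n u).
Proof.
have [] // : bounded_measurable (fun u : mR => bits_sum phi n u).
apply: bm_sum => k _.
exact: (bit_bm (fun b => b%:R / 2 ^+ k.+1)).
Qed.

Lemma measurable_bits_real phi : measurable_fun (setT : set mR) (bits_real phi : mR -> R).
Proof.
apply: (measurable_fun_cvg (measurable_bits_sum phi)) => u _.
exact: bits_sum_real.
Qed.

(* For phi = id the digit series is u itself, and the law of a finite digit sum is the same
   for all injective phi. *)
Lemma Ex_bits_real phi (f : R -> R) : injective phi ->
  bounded_measurable (f : mR -> R) ->
  Ex unif (fun u => f (bits_real phi u)) = Ex unif f.
Proof.
move=> phi_inj bf.
have mr : measurable_fun (setT : set mR) (bits_real phi : mR -> mR).
  exact: measurable_bits_real.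
rewrite -(Ex_law unif mr bf); apply: (@eq_measure_Ex _ mR R (law unif mr) unif f) => A mA.
apply: law_unique => // l c.
have bc : bounded_measurable (fun u : mR => cos (l * u + c)) := bm_cos (measurable_affine l c).
have lim (psi : nat -> nat) : Ex unif (fun u => cos (l * bits_sum psi n u + c)) @[n --> \oo] -->
    Ex unif (fun u => cos (l * bits_real psi u + c)).
  apply: (@Ex_cvg _ _ _ unif (fun n u => cos (l * bits_sum psi n u + c)) _ 1).
  - move=> n; have mb := measurable_bits_sum psi n.
    have [] // : bounded_measurable (fun u : mR => cos (l * bits_sum psi n u + c)).
    by apply: bm_cos; apply: measurable_funD => //; exact: measurable_funM.
  - by move=> n u; exact: cos_max.
  - move=> u; apply: continuous_cvg; first exact: continuous_cos.
    apply: cvgD; last exact: cvg_cst.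
    by apply: cvgM; [exact: cvg_cst|exact: bits_sum_real].
rewrite (Ex_law unif mr bc).
transitivity (Ex unif (fun u => cos (l * bits_real id u + c))); last first.
  apply: eq_Ex_unif => //.
    apply: bm_cos; apply: measurable_funD => //; apply: measurable_funM => //.
    exact: measurable_bits_real.
  by move=> u /andP[/ltW u0 u1]; rewrite bits_real_id// u0.
have E psi n : injective psi -> Ex unif (fun u => cos (l * bits_sum psi n u + c)) =
    2 ^- n * \sum_(e : {ffun 'I_n -> bool}) cos (l * (\sum_(k < n) (e k)%:R / 2 ^+ k.+1) + c).
  move=> psi_inj; rewrite -(Ex_bits (fun e : {ffun 'I_n -> bool} =>
    cos (l * (\sum_(k < n) (e k)%:R / 2 ^+ k.+1) + c)) psi_inj).
  by apply: eq_Ex => u; congr cos; congr (_ * _ + _); apply: eq_bigr => k _; rewrite ffunE.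
have := lim id.
rewrite (_ : (fun n => _) = fun n => Ex unif (fun u => cos (l * bits_sum phi n u + c))).
  by move=> h; exact: (cvg_unique _ (lim phi) h).
by apply/funext => n; rewrite !E.
Qed.

End UniformBits.

(** * Sigma-algebras generated by sets of digits *)

Section BitFields.
Context {R : realType}.
Notation mR := (measurableTypeR R).
Notation unif := (@unif R).

(** Conditions imposed digit by digit: rectangles are closed under intersection, and their
    indicators are products over the digits. *)
Definition bit_cylinders (S : pred nat) : set (set mR) :=
  [set A | exists n (b : nat -> bool -> bool),
     A = [set u | forall i, (i < n)%N -> S i -> b i (bit i u)]].

(** Equal to 1 at the digits that are not constrained, so that cylinders of different lengths can be
    written as products over a common range. *)
Definition bit_factor (S : pred nat) n (b : nat -> bool -> bool) (i : nat) (x : bool) : R :=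
  ((i < n)%N && S i ==> b i x)%:R.

Lemma indic_bits (S : pred nat) n (b : nat -> bool -> bool) N (u : mR) : (n <= N)%N ->
  \1_([set u : mR | forall i, (i < n)%N -> S i -> b i (bit i u)]) u =
  \prod_(i < N) bit_factor S n b i (bit i u) :> R.
Proof.
move=> nN; rewrite indicE; case: (boolP (u \in _)) => [|nu].
  rewrite inE /= => h; rewrite big1// => i _; rewrite /bit_factor.
  by case: implyP => // nh; exfalso; apply: nh => /andP[/h]; apply.
suff [i [ni Si nb]] : exists i, [/\ (i < n)%N, S i & ~~ b i (bit i u)].
  rewrite (bigD1 (Ordinal (leq_trans ni nN)))//= /bit_factor ni Si/= (negbTE nb).
  by rewrite mul0r.
apply: contrapT => h; move/negP: nu; apply; rewrite inE /= => i ni Si.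
by apply/negP => /negP nb; apply: h; exists i.
Qed.

Lemma bit_cylindersE S A : bit_cylinders S A ->
  exists n b, forall N, (n <= N)%N -> forall u,
    \1_A u = \prod_(i < N) bit_factor S n b i (bit i u) :> R.
Proof. by move=> [n [b ->]]; exists n, b => N nN u; exact: indic_bits. Qed.

Lemma measurable_bit_cylinders S : bit_cylinders S `<=` measurable.
Proof.
move=> A /bit_cylindersE[n [b /(_ n (leqnn _)) AE]].
have [mf _] : bounded_measurable (fun u : mR => \prod_(i < n) bit_factor S n b i (bit i u)).
  by apply: bm_prod => i _; exact: bit_bm.
have -> : A = (fun u : mR => \prod_(i < n) bit_factor S n b i (bit i u)) @^-1` [set 1].
  apply/seteqP; split => u /=; rewrite -AE indicE.
    by move=> Au; rewrite mem_set.
  by case: (boolP (u \in A)) => [/set_mem//|_ /eqP]; rewrite eq_sym oner_eq0.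
by rewrite -[X in measurable X]setTI; apply: mf => //; exact: measurable_set1.
Qed.

Lemma bit_cylindersT S : bit_cylinders S setT.
Proof. by exists 0%N, (fun _ _ => true); apply/seteqP; split. Qed.

Lemma bit_cylindersI S : setI_closed (bit_cylinders S).
Proof.
move=> _ _ [n [b ->]] [n' [b' ->]].
exists (maxn n n'), (fun i x => ((i < n)%N ==> b i x) && ((i < n')%N ==> b' i x)).
apply/seteqP; split => u /=.
  move=> [h h'] i _ Si; apply/andP; split; apply/implyP => ni; [exact: h|exact: h'].
move=> h; split => i ni Si.
  by have /andP[/implyP/(_ ni)] := h i (leq_trans ni (leq_maxl _ _)) Si.
by have /andP[_ /implyP/(_ ni)] := h i (leq_trans ni (leq_maxr _ _)) Si.
Qed.

Lemma unif_Ex (A : set mR) : measurable A -> unif A = (Ex unif (\1_A))%:E.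
Proof.
by move=> mA; rewrite /Ex /Rintegral integral_indic ?setIT// fineK// fin_num_measure.
Qed.

(** At each digit at least one of the two factors is constantly 1, so averaging the product digit by
    digit separates the two events. *)
Lemma bit_cylinders_indep (S S' : pred nat) A B : (forall i, S i -> ~~ S' i) ->
  bit_cylinders S A -> bit_cylinders S' B ->
  unif (A `&` B) = (unif A * unif B)%E.
Proof.
move=> dS cA cB.
have mA := measurable_bit_cylinders cA; have mB := measurable_bit_cylinders cB.
rewrite !unif_Ex//; last exact: measurableI.
have [n [b AE]] := bit_cylindersE cA; have [n' [b' BE]] := bit_cylindersE cB.
pose N := maxn n n'.
have {}AE := AE N (leq_maxl _ _); have {}BE := BE N (leq_maxr _ _).
have ABE u : \1_(A `&` B) u = \prod_(i < N) (bit_factor S n b i (bit i u) *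
    bit_factor S' n' b' i (bit i u)) :> R.
  by rewrite indicI/= AE BE big_split.
rewrite (eq_Ex unif AE) (eq_Ex unif BE) (eq_Ex unif ABE).
rewrite (Ex_prod_bits (fun i x => bit_factor S n b i x * bit_factor S' n' b' i x)).
rewrite !Ex_prod_bits -EFinM -big_split/=; congr (_%:E); apply: eq_bigr => i _.
have [Si|nSi] := boolP (S i).
  have bE x : bit_factor S' n' b' i x = 1 by rewrite /bit_factor (negbTE (dS i Si)) andbF.
  by rewrite !bE !mulr1 -[1 + 1]/2 divff ?mulr1// pnatr_eq0.
have bE x : bit_factor S n b i x = 1 by rewrite /bit_factor (negbTE nSi) andbF.
by rewrite !bE !mul1r -[1 + 1]/2 divff ?mul1r// pnatr_eq0.
Qed.

Lemma measurable_bit_field (S : pred nat) i (F : bool -> R) : S i ->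
  measurable_fun setT (fun u : g_sigma_algebraType (bit_cylinders S) => F (bit i u)).
Proof.
move=> Si _ Y mY; rewrite setTI; apply: sub_sigma_algebra.
exists i.+1, (fun k x => (k == i) ==> `[< Y (F x) >]).
apply/seteqP; split => u /=.
  by move=> Yu k _ Sk; apply/implyP => /eqP ->; apply/asboolP.
by move=> /(_ i (leqnn _) Si); rewrite eqxx => /asboolP.
Qed.

Lemma measurable_bits_field (S : pred nat) (phi : nat -> nat) : (forall k, S (phi k)) ->
  measurable_fun setT (bits_real phi : g_sigma_algebraType (bit_cylinders S) -> R).
Proof.
move=> Sphi.
have mS n : measurable_fun setT (bits_sum phi n : g_sigma_algebraType (bit_cylinders S) -> R).
  rewrite (_ : bits_sum phi n = fun u => \sum_(k < n) (bit (phi k) u)%:R / 2 ^+ k.+1)//.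
  apply: measurable_sum => k.
  exact: (measurable_bit_field (fun b => b%:R / 2 ^+ k.+1)).
apply: (measurable_fun_cvg mS) => u _.
exact: bits_sum_real.
Qed.

End BitFields.

(** * The quantile transform *)

Section Quantile.
Context {R : realType}.
Notation mR := (measurableTypeR R).
Variable nu : probability mR R.

Definition distr (x : R) : R := fine (nu `]-oo, x]%classic).

(** The identity viewed as a random variable under [nu], so that [distr] inherits the known
    properties of [cdf]. *)
Let idR : mR -> R := idfun.
HB.instance Definition _ := @isMeasurableFun.Build _ _ _ _ idR (@measurable_id _ _ setT).
Let X : {RV nu >-> R} := idR.

Lemma distrE x : (distr x)%:E = cdf X x.
Proof. by rewrite /distr fineK ?fin_num_measure. Qed.

Lemma distr_le x y : x <= y -> distr x <= distr y.
Proof. by move=> xy; rewrite -lee_fin !distrE; exact: cdf_nondecreasing. Qed.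

Lemma distr01 x : 0 <= distr x <= 1.
Proof. by rewrite -!lee_fin distrE cdf_ge0 cdf_le1. Qed.

Definition quantile (u : R) : R :=
  if 0 < u < 1 then inf [set x | u <= distr x] else 0.

(** The limits of the distribution function make the set of candidates nonempty and bounded below;
    right continuity makes its infimum a member. *)
Lemma quantile_le u x : 0 < u < 1 -> (quantile u <= x) = (u <= distr x).
Proof.
move=> /[dup] u01 /andP[u0 u1]; rewrite /quantile u01.
set E := [set _ | _].
have cdfR : (distr y @[y --> +oo] --> (1 : R)).
  by apply/fine_cvg; exact: (cvg_cdfy1 X).
have cdfL : (distr y @[y --> -oo] --> (0 : R)).
  by apply/fine_cvg; exact: (cvg_cdfNy0 X).
have [x1 ux1] : exists x, u <= distr x.
  have /filter_ex[y uy] : \forall y \near +oo, u < distr y by exact: (cvgr_gt _ cdfR).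
  by exists y; exact: ltW.
have [x0 ux0] : exists x, distr x < u.
  have /filter_ex[y uy] : \forall y \near -oo, distr y < u by exact: (cvgr_lt _ cdfL).
  by exists y.
have lbE : lbound E x0.
  move=> y /= uy; rewrite leNgt; apply/negP => yx0.
  by have := le_lt_trans (distr_le (ltW yx0)) ux0; rewrite ltNge uy.
have hE : has_inf E by split; [exists x1|exists x0].
have inE : u <= distr (inf E).
  have rc : distr y @[y --> (inf E)^'+] --> distr (inf E).
    by apply: fine_cvg; rewrite distrE; exact: (@cdf_right_continuous _ _ _ nu X (inf E)).
  apply: (cvgr_to_ge rc); near=> y.
  have yE : 0 < y - inf E by rewrite subr_gt0; near: y; exact: nbhs_right_gt.
  have [z Ez zy] := inf_adherent yE hE.
  apply: (le_trans Ez); apply: distr_le; rewrite ltW// (lt_le_trans zy)//.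
  by rewrite addrC subrK.
apply/idP/idP => [h|h]; first exact: le_trans inE (distr_le h).
by apply: ge_inf => //; exists x0.
Unshelve. all: by end_near. Qed.

Lemma measurable_quantile : measurable_fun (setT : set mR) (quantile : mR -> mR).
Proof.
apply: (measurability (@RGenOInfty.G R)) => [|/= _ [_] [r] -> <-].
  exact: RGenOInfty.measurableE.
rewrite setTI.
have -> : quantile @^-1` `]r, +oo[%classic =
    (`]0, 1[%classic `&` `]distr r, +oo[%classic) `|`
    (~` `]0, 1[%classic `&` [set u | r < 0]).
  apply/seteqP; split => u /=; rewrite !in_itv/= !andbT.
    have [u01|nu01] := boolP (0 < u < 1).
      by rewrite !ltNge quantile_le// => h; left.
    by rewrite /quantile (negbTE nu01); right; split => //; exact/negP.
  move=> [[u01]|[/negP nu01]]; first by rewrite !ltNge quantile_le.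
  by rewrite /quantile (negbTE nu01).
apply: measurableU; apply: measurableI; try exact: measurable_itv.
  by apply: measurableC; exact: measurable_itv.
case: (r < 0); first by rewrite (_ : [set _ | _] = setT)//; apply/seteqP; split.
by rewrite (_ : [set _ | _] = set0)//; apply/seteqP; split.
Qed.

(** On ]0, 1[ the quantile exceeds x exactly when u exceeds [distr x], an event of uniform
    probability 1 - [distr x]; rays determine the law. *)
Lemma Ex_quantile (f : R -> R) : bounded_measurable (f : mR -> R) ->
  Ex unif (fun u => f (quantile u)) = Ex nu f.
Proof.
move=> bf; rewrite -(Ex_law unif measurable_quantile bf).
apply: (@eq_measure_Ex _ mR R (law unif measurable_quantile) nu f) => A mA.
apply: ray_unique => // x.
have lawE : law unif measurable_quantile `]x, +oo[%classic =
    unif (quantile @^-1` `]x, +oo[%classic) by [].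
have mQ : measurable (quantile @^-1` `]x, +oo[%classic : set mR).
  by rewrite -[X in measurable X]setTI; apply: measurable_quantile => //; exact: measurable_itv.
have mD : measurable (`]distr x, +oo[%classic : set mR) by exact: measurable_itv.
rewrite lawE unif_Ex// (eq_Ex_unif (bm_indic R mQ) (bm_indic R mD)) => [|u u01]; last first.
  rewrite !indicE; congr (_%:R); congr nat_of_bool; apply/idP/idP; rewrite !inE/= !in_itv/= !andbT.
    by rewrite !ltNge quantile_le.
  by rewrite !ltNge quantile_le.
rewrite -unif_Ex// -[X in nu X]setCitvl probability_setC//.
have nuE : nu `]-oo, x]%classic = (distr x)%:E by rewrite /distr fineK// fin_num_measure.
have /andP[d0 d1] := distr01 x.
have unifD : unif `]-oo, distr x]%classic = (distr x)%:E.
  rewrite unifE//.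
  have -> : `]-oo, distr x]%classic `&` `[0, 1]%classic = `[0, distr x]%classic.
    apply/seteqP; split => u /=; rewrite !in_itv/=.
      by move=> [-> /andP[-> _]].
    by move=> /andP[-> ud]; split => //; rewrite (le_trans ud d1).
  rewrite lebesgue_measure_itv/= lte_fin; case: ltP => h.
    by rewrite oppr0 adde0.
  by congr (_%:E); apply/eqP; rewrite eq_le d0 h.
by rewrite -setCitvl probability_setC// unifD nuE.
Qed.

End Quantile.

(** * Independent normal variables on the unit interval *)

Section NormalSequence.
Context {R : realType}.
Notation mR := (measurableTypeR R).
Notation unif := (@unif R).

(** The coding of pairs distributes the digits into infinitely many disjoint rows, row [j] feeding
    the j-th variable. [bit_row] recovers the row, with default 0 for numbers that encode no
    pair. *)
Definition bit_code (j k : nat) : nat := pickle (j, k).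

Definition bit_row (i : nat) : nat :=
  if (unpickle i : option (nat * nat)%type) is Some p then p.1 else 0%N.

Lemma bit_codeK j k : bit_row (bit_code j k) = j.
Proof. by rewrite /bit_row /bit_code pickleK. Qed.

Lemma bit_code_inj j : injective (bit_code j).
Proof. by move=> k k' /(pcan_inj pickleK) []. Qed.

Definition normal01 : probability mR R := normal_prob 0 1.

Definition gauss (j : nat) (u : R) : R := quantile normal01 (bits_real (bit_code j) u).

Lemma measurable_gauss j : measurable_fun (setT : set mR) (gauss j : mR -> R).
Proof.
have mq := measurable_quantile normal01.
have mb : measurable_fun (setT : set mR) (bits_real (bit_code j) : mR -> mR).
  exact: measurable_bits_real.
exact: (measurableT_comp mq mb).
Qed.

Lemma measurable_gauss_field (S : pred nat) j : (forall k, S (bit_code j k)) ->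
  measurable_fun setT (gauss j : g_sigma_algebraType (@bit_cylinders R S) -> R).
Proof.
move=> Sj; have mq := measurable_quantile normal01.
have mb : measurable_fun setT
    (bits_real (bit_code j) : g_sigma_algebraType (@bit_cylinders R S) -> mR).
  exact: measurable_bits_field.
exact: (measurableT_comp mq mb).
Qed.

Lemma Ex_gauss j (f : R -> R) : bounded_measurable (f : mR -> R) ->
  Ex unif (fun u => f (gauss j u)) = Ex normal01 f.
Proof.
move=> bf; rewrite -(Ex_quantile normal01 bf).
apply: (@Ex_bits_real _ (bit_code j) (fun v => f (quantile normal01 v))).
  exact: bit_code_inj.
exact: (bm_measurable_comp (measurable_quantile normal01) bf).
Qed.

(** Induction on the number of variables by the addition formula: the first J variables use rows
    below J, the next one row J. The sine of the new term has mean 0, seen as a cosine with phase -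
    pi / 2. *)
Lemma Ex_gauss_cos (a : nat -> R) (J : nat) (c : R) :
  Ex unif (fun u => cos (\sum_(j < J) a j * gauss j u + c)) =
  expR (- (\sum_(j < J) a j ^+ 2) / 2) * cos c.
Proof.
elim: J c => [|J IH] c.
  rewrite big_ord0 oppr0 mul0r expR0 mul1r -[RHS](Ex_cst unif).
  by apply: eq_Ex => u; rewrite big_ord0 add0r.
pose S : pred nat := fun i => (bit_row i < J)%N.
pose S' : pred nat := fun i => bit_row i == J.
have SJ j k : (j < J)%N -> S (bit_code j k) by move=> jJ; rewrite /S bit_codeK.
have SJ' k : S' (bit_code J k) by rewrite /S' bit_codeK eqxx.
have dS i : S i -> ~~ S' i by rewrite /S /S' => h; rewrite neq_ltn h.
pose A (u : R) := \sum_(j < J) a j * gauss j u + c.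
pose B (u : R) := a J * gauss J u.
have mA : measurable_fun setT (A : g_sigma_algebraType (@bit_cylinders R S) -> R).
  apply: measurable_funD => //; apply: measurable_sum => j.
  by apply: measurable_funM => //; apply: measurable_gauss_field => k; exact: SJ.
have mB : measurable_fun setT (B : g_sigma_algebraType (@bit_cylinders R S') -> R).
  by apply: measurable_funM => //; exact: measurable_gauss_field.
have mA' : measurable_fun setT (A : mR -> R).
  apply: measurable_funD => //; apply: measurable_sum => j.
  by apply: measurable_funM => //; exact: measurable_gauss.
have mB' : measurable_fun setT (B : mR -> R).
  by apply: measurable_funM => //; exact: measurable_gauss.
have AB (f g : R -> R) :
    bounded_measurable (fun u : g_sigma_algebraType (@bit_cylinders R S) => f (A u)) ->
    bounded_measurable (fun u : g_sigma_algebraType (@bit_cylinders R S') => g (B u)) ->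
    Ex unif (fun u => f (A u) * g (B u)) = Ex unif (fun u => f (A u)) * Ex unif (fun u => g (B u)).
  move=> bf bg; apply: (indep_Ex (G1 := bit_cylinders S) (G2 := bit_cylinders S')) => //.
  - exact: measurable_bit_cylinders.
  - exact: measurable_bit_cylinders.
  - exact: bit_cylindersT.
  - exact: bit_cylindersT.
  - exact: bit_cylindersI.
  - exact: bit_cylindersI.
  - by move=> C D; exact: bit_cylinders_indep.
have E u : cos (\sum_(j < J.+1) a j * gauss j u + c) =
    cos (A u) * cos (B u) - sin (A u) * sin (B u).
  by rewrite big_ord_recr/= -cosD; congr cos; rewrite /A /B; ring.
rewrite (eq_Ex unif E) ExB; last 2 first.
- by apply: bmM; exact: bm_cos.
- by apply: bmM; exact: bm_sin.
rewrite (AB cos cos (bm_cos mA) (bm_cos mB)) (AB sin sin (bm_sin mA) (bm_sin mB)).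
have cosB : Ex unif (fun u => cos (B u)) = expR (- a J ^+ 2 / 2).
  rewrite (Ex_gauss J (f := fun x => cos (a J * x))).
    rewrite (eq_Ex normal01 (g := fun x => cos (a J * x + 0))) => [|x]; last by rewrite addr0.
    by rewrite /normal01 Ex_normal_cos// cos0 mulr1 expr1n mulr1.
  apply: eq_bm (bm_cos (measurable_affine (a J) 0)) => x.
  by rewrite addr0.
have sinB : Ex unif (fun u => sin (B u)) = 0.
  rewrite (Ex_gauss J (f := fun x => sin (a J * x))).
    rewrite (eq_Ex normal01 (g := fun x => cos (a J * x + - (pi / 2)))) => [|x]; last first.
      by rewrite cosBpihalf.
    by rewrite /normal01 Ex_normal_cos// cosN cos_pihalf mulr0.
  apply: eq_bm (bm_sin (measurable_affine (a J) 0)) => x.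
  by rewrite addr0.
rewrite sinB mulr0 subr0 cosB IH mulrAC -expRD big_ord_recr/=; congr (expR _ * _).
by field.
Qed.

End NormalSequence.

(** * Cholesky factorisation of a possibly degenerate kernel *)

Section Cholesky.
Context {R : realType}.

Definition psd (K : nat -> nat -> R) : Prop := forall (k : nat) (ns : 'I_k -> nat) (x : 'I_k -> R),
  0 <= \sum_i \sum_j x i * x j * K (ns i) (ns j).

Definition schur (K : nat -> nat -> R) (i n n' : nat) : R :=
  K n n' - K n i * K i n' / K i i.

Lemma psd_diag K n : psd K -> 0 <= K n n.
Proof.
by move=> /(_ 1%N (fun=> n) (fun=> 1)); rewrite !big_ord1 !mul1r.
Qed.

(** The degenerate case of the Cauchy-Schwarz inequality: a nonzero entry beside a zero diagonal
    would make the form negative on the span of two basis vectors. *)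
Lemma psd_diag0 K i n : (forall a b, K a b = K b a) -> psd K -> K i i = 0 -> K n i = 0.
Proof.
move=> Ksym Kpsd Kii; apply/eqP; apply/negPn/negP => Kni.
(* Chosen so that the form takes the value K n n + 2 s K n i = -1 at s e_i + e_n. *)
pose s := - (K n n + 1) / (2 * K n i).
have := Kpsd 2 (fun a => if a == ord0 then i else n) (fun a => if a == ord0 then s else 1).
rewrite !big_ord_recl !big_ord0 /= !addr0 Kii (Ksym i n).
have -> : s * s * 0 + s * 1 * K n i + (1 * s * K n i + 1 * 1 * K n n) = -1.
  by rewrite /s; field.
by rewrite lerNr oppr0 ler10.
Qed.

Lemma schur_sym K i : (forall a b, K a b = K b a) -> forall a b, schur K i a b = schur K i b a.
Proof. by move=> Ksym a b; rewrite /schur Ksym (Ksym i b) (Ksym a i) (mulrC (K i a)). Qed.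

(* The Schur complement of [K] evaluates the form [K] at [x - t e_i], where [t] is the
   minimiser; when [K i i = 0] the division by zero makes it [K] itself. *)
Lemma schur_psd K i : (forall a b, K a b = K b a) -> psd K -> psd (schur K i).
Proof.
move=> Ksym Kpsd k ns x.
pose S := \sum_j x j * K (ns j) i.
pose t := S / K i i.
pose ns' (a : 'I_k.+1) := oapp ns i (unlift ord0 a).
pose x' (a : 'I_k.+1) := oapp x (- t) (unlift ord0 a).
have := Kpsd k.+1 ns' x'.
rewrite big_ord_recl big_ord_recl /= /ns' /x' unlift_none/=.
under eq_bigr do rewrite liftK/=.
have S1 : \sum_(j < k) - t * x j * K i (ns j) = - t * S.
  by rewrite /S mulr_sumr; apply: eq_bigr => j _; rewrite -mulrA (Ksym i).
have -> : \sum_(a < k) \sum_(j < k.+1) oapp x (- t) (unlift ord0 (lift ord0 a)) *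
      oapp x (- t) (unlift ord0 j) *
      K (oapp ns i (unlift ord0 (lift ord0 a))) (oapp ns i (unlift ord0 j)) =
    - t * S + \sum_i0 \sum_j x i0 * x j * K (ns i0) (ns j).
  rewrite /S mulr_sumr -big_split/=; apply: eq_bigr => a _.
  rewrite big_ord_recl liftK unlift_none/=; congr (_ + _); first ring.
  by apply: eq_bigr => j _; rewrite liftK.
rewrite S1 => h.
have -> : \sum_i0 \sum_j x i0 * x j * schur K i (ns i0) (ns j) =
    \sum_i0 \sum_j x i0 * x j * K (ns i0) (ns j) - S * S / K i i.
  have -> : S * S / K i i = \sum_i0 \sum_j x i0 * x j * (K (ns i0) i * K i (ns j) / K i i).
    rewrite /S !mulr_suml; apply: eq_bigr => a _.
    rewrite mulr_sumr mulr_suml; apply: eq_bigr => b _.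
    by rewrite (Ksym i); ring.
  rewrite -sumrB; apply: eq_bigr => a _; rewrite -sumrB; apply: eq_bigr => b _.
  by rewrite /schur; ring.
apply: le_trans h _; rewrite addrA; move: (\sum_(_ < _) _) => Q.
rewrite [leRHS]addrC lerD2r le_eqVlt; apply/orP; left; apply/eqP.
rewrite /t; have [->|Kn] := eqVneq (K i i) 0; first by rewrite invr0; ring.
by field.
Qed.

Variable Gam : nat -> nat -> R.
Hypothesis Gam_sym : forall a b, Gam a b = Gam b a.
Hypothesis Gam_psd : psd Gam.

(** The kernel that remains after the indices below i have been eliminated. *)
Fixpoint residual (i : nat) : nat -> nat -> R :=
  if i is i'.+1 then schur (residual i') i' else Gam.

(** When the pivot vanishes, division by zero gives a zero column, which is the right choice for a
    degenerate kernel. *)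
Definition chol (n i : nat) : R := residual i n i / Num.sqrt (residual i i i).

Lemma residual_sym i a b : residual i a b = residual i b a.
Proof. by elim: i a b => [|i IH] // a b; apply: schur_sym. Qed.

Lemma residual_psd i : psd (residual i).
Proof. by elim: i => [|i IH] //=; apply: schur_psd => //; exact: residual_sym. Qed.

Lemma chol_mul i n n' : chol n i * chol n' i = residual i n i * residual i i n' / residual i i i.
Proof.
rewrite /chol mulrACA -invfM -expr2 sqr_sqrtr; last exact/psd_diag/residual_psd.
by rewrite (residual_sym i n').
Qed.

(** Elimination clears the column of a nonzero pivot; below a zero pivot the column vanishes
    already, by positive semidefiniteness. *)
Lemma residual0 m n i : (i < m)%N -> residual m n i = 0.
Proof.
elim: m n => // m IH n; rewrite ltnS leq_eqVlt => /predU1P[->|im] /=; rewrite /schur.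
  have [r0|r0] := eqVneq (residual m m m) 0; last by rewrite mulfK// subrr.
  by rewrite r0 invr0 !mulr0 subr0 (psd_diag0 n (residual_sym m) (residual_psd m) r0).
by rewrite !(IH _ im) mulr0 mul0r subr0.
Qed.

Lemma chol0 n i : (n < i)%N -> chol n i = 0.
Proof. by move=> ni; rewrite /chol residual_sym residual0// mul0r. Qed.

(** Each elimination step subtracts the rank-one kernel given by one column of [chol], so the sum
    telescopes. *)
Lemma cholE m n n' : Gam n n' = \sum_(i < m) chol n i * chol n' i + residual m n n'.
Proof.
elim: m => [|m IH]; first by rewrite big_ord0 add0r.
by rewrite big_ord_recr/= -addrA chol_mul /schur [X in _ + X]addrC subrK.
Qed.

Lemma chol_kernel m n n' : (n' < m)%N -> Gam n n' = \sum_(i < m) chol n i * chol n' i.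
Proof. by move=> nm; rewrite (cholE m) residual0// addr0. Qed.

End Cholesky.

(** * The Gaussian process with a prescribed covariance *)

Section GaussianProcess.
Context {R : realType}.
Notation mR := (measurableTypeR R).
Notation unif := (@unif R).
Variable Gam : nat -> nat -> R.
Hypotheses (Gam_sym : forall a b, Gam a b = Gam b a) (Gam_psd : psd Gam).

Definition gproc (n : nat) (u : mR) : R := \sum_(i < n.+1) chol Gam n i * gauss i u.

(** By triangularity the coefficients beyond n vanish, so finitely many members of the process can
    be written over the same normal variables. *)
Lemma gproc_widen N n u : (n < N)%N -> gproc n u = \sum_(i < N) chol Gam n i * gauss i u.
Proof.
move=> nN; rewrite /gproc (big_ord_widen N (fun i => chol Gam n i * gauss i u) nN).
rewrite [RHS](bigID (fun i : 'I_N => (i < n.+1)%N))/= [X in _ = _ + X]big1 ?addr0// => i.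
by rewrite -leqNgt => ni; rewrite chol0// mul0r.
Qed.

Lemma measurable_gproc n : measurable_fun (setT : set mR) (gproc n : mR -> R).
Proof.
by apply: measurable_sum => i; apply: measurable_funM => //; exact: measurable_gauss.
Qed.

Definition gauss_proc n : {RV unif >-> R} := mfun_Sub (mem_set (measurable_gproc n)).

Section Combination.
Variables (k : nat) (ns : 'I_k -> nat) (x : 'I_k -> R).

Definition quad_form : R := \sum_i \sum_j x i * x j * Gam (ns i) (ns j).

Lemma Ex_gproc_cos c :
  Ex unif (fun u => cos (\sum_a x a * gproc (ns a) u + c)) = expR (- quad_form / 2) * cos c.
Proof.
pose N := (\max_a ns a).+1.
have nN a : (ns a < N)%N by rewrite ltnS (leq_bigmax (F := ns)).
pose b i := \sum_a x a * chol Gam (ns a) i.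
have E u : \sum_a x a * gproc (ns a) u = \sum_(i < N) b i * gauss i u.
  under eq_bigr do rewrite (gproc_widen _ (nN _)) mulr_sumr.
  rewrite exchange_big/=; apply: eq_bigr => i _.
  by rewrite /b mulr_suml; apply: eq_bigr => a _; rewrite mulrA.
have -> : quad_form = \sum_(i < N) b i ^+ 2.
  have bE i : b i ^+ 2 = \sum_a \sum_a' x a * x a' * (chol Gam (ns a) i * chol Gam (ns a') i).
    rewrite expr2 /b mulr_suml; apply: eq_bigr => a _.
    by rewrite mulr_sumr; apply: eq_bigr => a' _; ring.
  under [RHS]eq_bigr do rewrite bE.
  rewrite exchange_big; apply: eq_bigr => a _; rewrite exchange_big; apply: eq_bigr => a' _.
  by rewrite -mulr_sumr -chol_kernel.
rewrite -Ex_gauss_cos; apply: eq_Ex => u.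
by rewrite E.
Qed.

End Combination.

Lemma quad_form_ge0 k (ns : 'I_k -> nat) x : 0 <= quad_form ns x.
Proof. exact: Gam_psd. Qed.

(** The cosine expectations of a linear combination are those of the centred normal law with
    variance [quad_form], and they determine the law. *)
Lemma gaussian_gauss_proc : gaussian_process gauss_proc.
Proof.
move=> k ns a; exists 0, (Num.sqrt (quad_form ns a)) => A mA.
set X := fun u : mR => _.
have mX : measurable_fun (setT : set mR) (X : mR -> mR).
  by apply: measurable_sum => i; apply: measurable_funM => //; exact: measurable_gproc.
transitivity (law unif mX A) => //.
have lawE l c : Ex (law unif mX) (fun y => cos (l * y + c)) =
    expR (- (l ^+ 2 * quad_form ns a) / 2) * cos c.
  rewrite (Ex_law unif mX); last exact: bm_cos (measurable_affine l c).
  have -> : l ^+ 2 * quad_form ns a = quad_form ns (fun i => l * a i).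
    rewrite /quad_form mulr_sumr; apply: eq_bigr => i _; rewrite mulr_sumr.
    by apply: eq_bigr => j _; ring.
  rewrite -Ex_gproc_cos; apply: eq_Ex => u; congr (cos (_ + _)).
  by rewrite /X mulr_sumr; apply: eq_bigr => i _; rewrite mulrA.
have s2 := sqr_sqrtr (quad_form_ge0 ns a).
(* With variance 0 the combination is compared with the point mass at 0, as [gaussian_law]
   prescribes. *)
rewrite /gaussian_law; case: eqVneq => [s0|sn0].
  apply: (law_unique (Q1 := law unif mX) (Q2 := \d_(0 : mR) : probability mR R)) => // l c.
  rewrite lawE -s2 s0 expr0n/= mulr0 oppr0 mul0r expR0 mul1r.
  rewrite /Ex /Rintegral integral_dirac//.
    by rewrite diracE mem_set//= mul1r mulr0 add0r.
  by apply/measurable_EFinP; case: (bm_cos (measurable_affine l c)).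
apply: (law_unique (Q1 := law unif mX)
  (Q2 := normal_prob 0 (Num.sqrt (quad_form ns a)) : probability mR R)) => // l c.
rewrite lawE Ex_normal_cos ?s2//.
by rewrite lt_neqAle eq_sym sn0 sqrtr_ge0.
Qed.

End GaussianProcess.

(** * Convergence of the traces *)

Lemma cvgn_invr (R : realType) : N%:R^-1 @[N --> \oo] --> (0 : R).
Proof.
apply/gtr0_cvgV0; last exact: cvgr_idn.
by near=> N; rewrite ltr0n; near: N; exact: nbhs_infty_gt.
Unshelve. all: by end_near. Qed.

Lemma cvgn_sqrt_invr (R : realType) : (Num.sqrt N%:R)^-1 @[N --> \oo] --> (0 : R).
Proof.
rewrite (_ : (fun N => _) = (fun N => Num.sqrt (N%:R^-1 : R))); last first.
  by apply/funext => N; rewrite sqrtrV.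
by rewrite -[X in _ --> X]sqrtr0; apply: continuous_cvg; [exact: sqrt_continuous|exact: cvgn_invr].
Qed.

Section Convergence.
Context {R : realType} {m r2 t : nat} {q : 'I_t -> nat}.
Hypothesis hq : forall j : 'I_t, (3 <= q j)%N.
Context (d : nat -> measure_display) (T : forall N : nat, measurableType (d N)).
Context (P : forall N : nat, probability (T N) R).
Variable M : forall N : nat, wreath_model m r2 q N (P N).
Notation unif := (@unif R).

(** The moments are read off the model with N = 1, the smallest one that has a site; [Ex_potential]
    transports them to all others. *)
Let mu (j : nat) : R := Ex (P 1%N) (fun w => potential (M 1%N) ord0 w ^+ j).

Let hmu N (k : 'I_N) j : Ex (P N) (fun w => potential (M N) k w ^+ j) = mu j.
Proof. exact: Ex_potential. Qed.

Let K : R := total_bound (R := R) (m := m) (r2 := r2) (t := t).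
Let K0 : 0 <= K. Proof. by rewrite /K total_boundE. Qed.
Let nc : R := norm_const (R := R) (m := m) (r2 := r2) (t := t).

Let S N := wreath_site_model (@hmu N).
Let mV N (s : 'S_N) : measurable (VN (M N) @^-1` [set s]).
Proof. exact: measurable_VN_preimage. Qed.
Let VU N := fun s f => @VN_uniform R m r2 t q N _ _ _ (M N) s f.

(** The lower bound -C / N holds for all large N, while [stat_cov] does not depend on N. *)
Lemma stat_cov_ge0 k (ns : 'I_k -> nat) al : 0 <= stat_cov mu ns al.
Proof.
pose C := (2 * (6 * stat_range ns))%N%:R *
  ((stat_degree ns)%:R * (2 * stat_bound K ns al) ^+ 2 + `|stat_cov mu ns al|).
have lim : N%:R^-1 * C @[N --> \oo] --> (0 : R).
  rewrite -(mul0r C); apply: cvgM; last exact: cvg_cst.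
  exact: cvgn_invr.
have limN : - (N%:R^-1 * C) @[N --> \oo] --> (0 : R).
  by rewrite -oppr0; exact: cvgN.
apply: (cvgr_to_le limN); near=> N.
apply: (stat_cov_ge al K0 (S N)); first by near: N; exact: nbhs_infty_gt.
by near: N; exact: nbhs_infty_ge.
Unshelve. all: by end_near. Qed.

(* [walk_cov] is centred at its first argument, hence not visibly symmetric. *)
Definition limit_cov (n n' : nat) : R :=
  nc ^+ n * nc ^+ n' * ((walk_cov mu n n' + walk_cov mu n' n) / 2).

Lemma limit_cov_sym n n' : limit_cov n n' = limit_cov n' n.
Proof. by rewrite /limit_cov; ring. Qed.

(** Symmetrising the covariance does not change its quadratic form, so [limit_cov] inherits
    positivity from [stat_cov]. *)
Lemma quad_form_stat_cov k (ns : 'I_k -> nat) (x : 'I_k -> R) :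
  quad_form limit_cov ns x = stat_cov mu ns (fun i => x i * nc ^+ ns i).
Proof.
pose f i j := x i * nc ^+ ns i * (x j * nc ^+ ns j) * walk_cov mu (ns i) (ns j).
have -> : stat_cov mu ns (fun i => x i * nc ^+ ns i) = \sum_i \sum_j f i j by [].
have -> : quad_form limit_cov ns x = (\sum_i \sum_j f i j + \sum_i \sum_j f j i) / 2.
  rewrite -big_split/= mulr_suml; apply: eq_bigr => i _.
  rewrite -big_split/= mulr_suml; apply: eq_bigr => j _.
  by rewrite /f /limit_cov; ring.
by rewrite [X in _ + X]exchange_big/=; field.
Qed.

Lemma limit_cov_psd : psd limit_cov.
Proof.
move=> k ns x; have := quad_form_stat_cov ns x; rewrite /quad_form => ->.
exact: stat_cov_ge0.
Qed.

Let G := gauss_proc limit_cov.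

Lemma cvg_cos_trace k (ns : 'I_k -> nat) (l : 'rV[R]_k) (c : R) :
  Ex (P N) (fun w => cos (dot l (\row_i centered_trace (M N) (ns i) w) + c)) @[N --> \oo] -->
  Ex unif (fun u => cos (dot l (\row_i G (ns i) u) + c)).
Proof.
have -> : Ex unif (fun u => cos (dot l (\row_i G (ns i) u) + c)) =
    expR (- stat_cov mu ns (trace_coef (m := m) (r2 := r2) (t := t) ns l) / 2) * cos c.
  rewrite -(quad_form_stat_cov ns (l 0)).
  rewrite -(Ex_gproc_cos limit_cov_sym limit_cov_psd); apply: eq_Ex => u.
  by congr (cos (_ + _)); apply: eq_bigr => i _; rewrite mxE.
set v := stat_cov _ _ _.
pose C := clt_const K mu ns (trace_coef (m := m) (r2 := r2) (t := t) ns l).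
have lim : (Num.sqrt N%:R)^-1 * C @[N --> \oo] --> (0 : R).
  rewrite -(mul0r C); apply: cvgM; last exact: cvg_cst.
  exact: cvgn_sqrt_invr.
apply/cvgrPdist_le => e e0; near=> N.
have E : Ex (P N) (fun w => cos (dot l (\row_i centered_trace (M N) (ns i) w) + c)) =
    Ex (P N) (fun w => cos (fluctuation (P := P N) (xi := potential (M N))
      ns (trace_coef (m := m) (r2 := r2) (t := t) ns l) (VN (M N)) w + c)).
  by apply: eq_Ex => w; rewrite (dot_centered_trace (@hmu N)).
rewrite E distrC; apply: le_trans.
  apply: (fluctuation_cos_error K0 (@mV N) (S := S N) (@VU N)).
  - by near: N; exact: nbhs_infty_gt.
  - by near: N; exact: nbhs_infty_ge.
  - exact: stat_cov_ge0.
rewrite (le_trans (ler_norm _))//.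
near: N; move/cvgrPdist_le : lim => /(_ e e0); apply: filterS => N.
by rewrite sub0r normrN.
Unshelve. all: by end_near. Qed.

(** A single trace is the case of one exponent with coefficient 1 of the general fluctuation. *)
Lemma Ex_centered_trace_le n : exists C : R,
  \forall N \near \oo, Ex (P N) (fun w => `|centered_trace (M N) n w|) <= C.
Proof.
pose ns (i : 'I_1) := n.
pose l : 'rV[R]_1 := const_mx 1.
pose al := trace_coef (m := m) (r2 := r2) (t := t) ns l.
exists (1 + (stat_degree ns)%:R * (2 * stat_bound K ns al) ^+ 2 +
  (2 * (2 * (6 * stat_range ns)))%N%:R * (stat_bound K ns al + `|stat_mean mu ns al|)).
near=> N.
have E w : centered_trace (M N) n w =
    fluctuation (P := P N) (xi := potential (M N)) ns al (VN (M N)) w.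
  rewrite -(dot_centered_trace (@hmu N)) /dot big_ord1 !mxE.
  by rewrite mul1r.
rewrite (eq_Ex (P N) (g := fun w => `|fluctuation (P := P N) (xi := potential (M N)) ns al
  (VN (M N)) w|)); last by move=> w; rewrite E.
apply: (Ex_fluctuation_le al K0 (@mV N) (S := S N) (@VU N)).
  by near: N; exact: nbhs_infty_gt.
by near: N; exact: nbhs_infty_ge.
Unshelve. all: by end_near. Qed.

Lemma tight_trace k (ns : 'I_k -> nat) (e : R) : 0 < e -> exists L0, forall L, L0 <= L ->
  \forall N \near \oo, tail (P N) (fun w => \row_i centered_trace (M N) (ns i) w) L <= e.
Proof.
move=> e0; have [C hC] := choice (fun i => Ex_centered_trace_le (ns i)).
(* By Markov's inequality the tail is at most the sum of the C i divided by L; the summand 1 keeps L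
   positive. *)
exists (`|\sum_i C i| / e + 1) => L LL.
have L0 : 0 < L by rewrite (lt_le_trans _ LL)// ltr_wpDl// divr_ge0// ltW.
have hCN : \forall N \near \oo, forall i,
    Ex (P N) (fun w => `|centered_trace (M N) (ns i) w|) <= C i.
  by apply: filter_forall => i; exact: hC.
apply: filterS hCN => N CN; rewrite /tail.
apply: (@le_trans _ _ (\sum_i L^-1 * C i)).
  apply: ler_sum => i _.
  have bt : bounded_measurable (centered_trace (M N) (ns i)) := bm_centered_trace (@hmu N) (ns i).
  apply: (@le_trans _ _ (L^-1 * Ex (P N) (fun w => `|centered_trace (M N) (ns i) w|))).
    rewrite -ExZ; last exact: bm_norm.
    apply: le_Ex.
    - apply: (tail_bm (X := fun w => \row_i centered_trace (M N) (ns i) w)) => j.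
      rewrite (_ : (fun w => _) = centered_trace (M N) (ns j)).
        by case: (bm_centered_trace (@hmu N) (ns j)).
      by apply/funext => w; rewrite mxE.
    - by apply: bmZ; exact: bm_norm.
    - move=> w; rewrite mxE; case: ltP => h /=; last first.
        by rewrite mulr_ge0 ?invr_ge0 ?(ltW L0).
      by rewrite ler_pdivlMl// mulr1 ltW.
  by rewrite ler_wpM2l ?invr_ge0 ?(ltW L0)//.
rewrite -mulr_sumr ler_pdivrMl// (le_trans (ler_norm _))//.
have : `|\sum_i C i| / e <= L by rewrite (le_trans _ LL)// lerDl.
by rewrite ler_pdivrMr.
Qed.

Lemma trace_fdd_converges : fdd_converges P (fun N n => ZN (M N) n) unif (fun n => G n).
Proof.
move=> k ns f cf [B fB].
have mY (n : nat) : measurable_fun setT (G n) by exact: measurable_gproc.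
have mYr (i : 'I_k) : measurable_fun setT (fun u => (\row_i G (ns i) u : 'rV[R]_k) 0 i).
  rewrite (_ : (fun u => _) = G (ns i)); first exact: mY.
  by apply/funext => u; rewrite mxE.
have bY := continuous_bm (X := fun u => \row_i G (ns i) u) mYr cf fB.
rewrite (bm_expectation unif bY).
rewrite (_ : (fun N => _) = (fun N => (Ex (P N)
    (fun w => f (\row_i centered_trace (M N) (ns i) w)))%:E)); last first.
  by apply/funext => N; rewrite (expectation_ZN hq (@hmu N) ns cf fB).
apply: cvg_EFin; first exact: nearW.
apply: (weak_cvg (X := fun N w => \row_i centered_trace (M N) (ns i) w)
  (Y := fun u => \row_i G (ns i) u) _ mYr _ _ cf fB).
- move=> N i; rewrite (_ : (fun w => _) = centered_trace (M N) (ns i)).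
    by case: (bm_centered_trace (@hmu N) (ns i)).
  by apply/funext => w; rewrite mxE.
- exact: tight_trace.
- exact: cvg_cos_trace.
Qed.

Lemma trace_limit_gaussian : gaussian_process G.
Proof. exact: gaussian_gauss_proc limit_cov_sym limit_cov_psd. Qed.

End Convergence.

Theorem theorem1p2 (R : realType) (m r2 t : nat) (q : 'I_t -> nat)
    (hq : forall j : 'I_t, (3 <= q j)%N)
    (d : nat -> measure_display) (T : forall N : nat, measurableType (d N))
    (P : forall N : nat, probability (T N) R)
    (M : forall N : nat, wreath_model m r2 q N (P N)) :
  exists (d' : measure_display) (T' : measurableType d')
         (P' : probability T' R) (G : nat -> {RV P' >-> R}),
    gaussian_process G /\
    fdd_converges P (fun N n => ZN (M N) n) P' (fun n => G n).
Proof.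
exists _, (measurableTypeR R), (@unif R), (gauss_proc (limit_cov M)).
by split; [exact: trace_limit_gaussian|exact: trace_fdd_converges].
Qed.
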